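(* Let $r>0$ and $E=\mathbb{R}\times\{0,r\}$ with the Euclidean distance $d$, and let $s\in\mathbb{R}$ with $0<|s|<r/\sqrt3$. Let $\Pi^0$ be a homogeneous Poisson process on $\mathbb{R}$ with rate $1$, let $\Pi^r=\{x: x-s\in\Pi^0\}$ be its copy shifted by $s$, and let $\Pi=(\Pi^0\times\{0\})\cup(\Pi^r\times\{r\})$, a point process on $E$. Then the greedy walk on $\Pi$ starting from $S_0=(0,0)$ almost surely visits all points of $\Pi$.
   Context: Greedy walk: given a simple point process $\Pi$ (viewed as a random set of points) in a metric space $(E,d)$ and a starting point $S_0\in E$, the greedy walk $(S_n)_{n\ge0}$ on $\Pi$ is defined recursively by $S_{n+1}=\arg\min\{d(X,S_n): X\in\Pi,\ X\notin\{S_0,S_1,\dots,S_n\}\}$. For the process considered here every step is almost surely uniquely defined. *)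

(* Defs.v *)
From mathcomp Require Import all_boot all_order all_algebra.
From mathcomp Require Import all_classical all_reals all_analysis.
From mathcomp Require Import measurable_realfun.
Set Implicit Arguments.
Unset Strict Implicit.
Unset Printing Implicit Defensive.
Import Order.TTheory GRing.Theory Num.Theory.
Import numFieldNormedType.Exports.
Local Open Scope classical_set_scope.
Local Open Scope ring_scope.

Definition argmin {T : Type} {R : realType} (f : T -> R) (A : set T) : set T :=
  [set x | A x /\ forall y, A y -> f x <= f y].

Definition is_greedy_walk {T : Type} {R : realType} (dist : T -> T -> R)
    (Pi : set T) (x0 : T) (S : nat -> T) : Prop :=
  S 0%N = x0 /\
  forall n, argmin (fun X => dist X (S n))
    [set X | Pi X /\ forall k, (k <= n)%N -> X <> S k] (S n.+1).

(* The norm that the library puts on [R * R] is the sup norm, hence this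
   explicit Euclidean distance. *)
Definition euclid_dist {R : realType} (x y : R * R) : R :=
  Num.sqrt ((x.1 - y.1) ^+ 2 + (x.2 - y.2) ^+ 2).

(* The number of points in [A] of the random set [Pi], possibly [+oo]. *)
Definition npoints {d : measure_display} {Omega : measurableType d}
    {R : realType} (Pi : Omega -> set R) (A : set R) (w : Omega) : \bar R :=
  counting (Pi w `&` A).

Definition simple_point_process {d : measure_display}
    {Omega : measurableType d} {R : realType} (Pi : Omega -> set R) : Prop :=
  (forall (w : Omega) (a b : R), finite_set (Pi w `&` `[a, b])) /\
  (forall A : set R, measurable A -> measurable_fun [set: Omega] (npoints Pi A)).

Definition mutually_independent {d : measure_display}
    {Omega : measurableType d} {R : realType} (P : probability Omega R)
    (n : nat) (X : 'I_n -> Omega -> \bar R) : Prop :=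
  forall B : 'I_n -> set (\bar R), (forall i, measurable (B i)) ->
    (P (\bigcap_(i in [set: 'I_n]) (X i @^-1` B i)) =
     \prod_(i < n) P (X i @^-1` B i))%E.

(* The Poisson weights are written out because the library's [poisson_pmf] is
   constantly [1] at rate [0], whereas null sets [A] must have no points. *)
Definition poisson_process {d : measure_display} {Omega : measurableType d}
    {R : realType} (P : probability Omega R) (rate : R)
    (Pi : Omega -> set R) : Prop :=
  [/\ simple_point_process Pi,
      forall A : set R, measurable A -> (lebesgue_measure A < +oo)%E ->
        forall k : nat,
        let m := rate * fine (lebesgue_measure A) in
        P [set w | npoints Pi A w = k%:R%:E] =
          (m ^+ k / k`!%:R * expR (- m))%:E
    & forall (n : nat) (A : 'I_n -> set R),
        (forall i, measurable (A i)) -> trivIset setT A ->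
        mutually_independent P (fun i => npoints Pi (A i))].

Definition two_line_process {R : realType} (r s : R) (Pi0 : set R) :
    set (R * R) :=
  (Pi0 `*` [set 0]) `|` ([set x | Pi0 (x - s)] `*` [set r]).

(* Main.v *)
Require Import Defs.
From HB Require Import structures.
From mathcomp Require Import all_boot all_order all_algebra.
From mathcomp Require Import all_classical all_reals all_analysis.
From mathcomp Require finmap.
From mathcomp Require Import measurable_realfun.
From mathcomp Require Import ring lra zify.
Set Implicit Arguments.
Unset Strict Implicit.
Unset Printing Implicit Defensive.
Import Order.TTheory GRing.Theory Num.Theory.
Import numFieldNormedType.Exports.
Local Open Scope classical_set_scope.
Local Open Scope ring_scope.

(** After exchanging the lines and reflecting, [s > 0] and a walk that misses a
    point escapes to the right.  A point of [E] is written [(x, b)], with [x] its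
    base point in the process on the line [false] and [b] its line; twins are at
    distance [rho = sqrt (r^2 + s^2)], and [2 * s < rho] because [s < r / sqrt 3].

    Clusters are the maximal runs of base points with gaps below [rho].  When the
    walk leaves a cluster to the right, the line [false] of the cluster is
    complete.  Hence, if a walk escapes to the right, then for some rational [q]
    and some integer [h] the walk in [[q, +oo[] that starts from the leftmost point
    always finds an unvisited point that is closer than [q - h] (the negation of
    [returns]).  It suffices to show that this has probability [0] for [q = 0].

    If it has positive probability, then so has the event [no_return] that a fixed
    finite pattern starts at [0], makes the walk leave one point behind, and then
    releases a walk that never comes back for it.  By stationarity and a maximal
    inequality of Hardy-Littlewood type, far away there is a [z] such that, with
    large probability, translates of this event (seen up to [z] only) occur behind
    [z] at all scales.  An empty interval [[z, z + 8 * C[], which has a probability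
    independent of [z], then drives the walk back from one missed point to the
    next, down to the pattern at [0].  So with probability bounded below the event
    [no_return] is refuted only after [z], which is impossible as [z] grows. *)

(** * Walks on two shifted copies of a set *)

(** The condition [2 * s < rho] acts mainly through one fact: [r ^ 2 + (y - s) ^ 2 <= y ^ 2] forces
    [y >= rho ^ 2 / (2 * s) > rho], so over distances below [rho] a walk on the line [true] never
    prefers the line [false] ahead of it. This breaks the symmetry of the lines, and it is why the
    point left behind by the pattern lies on the line [true]. The obstacle to a renewal argument is
    that never returning depends on the whole future, so translates of [no_return] are not
    independent. Hence the events with a horizon: they are independent of what lies beyond it, and
    their probability decreases to that of [no_return] as the horizon recedes. For missed points at
    all scales simultaneously, only stationarity and a union over scales remain, and the maximal
    inequality does this in one stroke. The ratio [9 / 8] of consecutive scales is small enough for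
    the walk to prefer the next missed point behind it to a leap to the unvisited region near [z]:
    [(9 / 8) ^ 2 - 1 = 17 / 64] is well below [1]. The width [8 * C] is fixed before [z], so the
    probability of the empty interval stays bounded below while the late refutations of [no_return]
    become improbable. *)

Definition position {R : realType} (s : R) (u : R * bool) : R :=
  u.1 + (if u.2 then s else 0).

Definition sqdist {R : realType} (r s : R) (u v : R * bool) : R :=
  (position s u - position s v) ^+ 2 + (if u.2 == v.2 then 0 else r ^+ 2).

Definition visited {R : realType} (S : nat -> R * bool) (n : nat) (v : R * bool)
  : bool := v \in mkseq S n.+1.

Definition greedy {R : realType} (r s : R) (X : set R) (S : nat -> R * bool) :=
  forall n, [/\ X (S n.+1).1, ~~ visited S n (S n.+1) &
    forall v, X v.1 -> ~~ visited S n v ->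
      sqdist r s (S n) (S n.+1) <= sqdist r s (S n) v].

Section walk.
Variables (R : realType) (S : nat -> R * bool).

Lemma visitedP n v : reflect (exists2 k, (k <= n)%N & S k = v) (visited S n v).
Proof.
rewrite /visited /mkseq; apply: (iffP mapP) => [[k]|[k kn <-]].
  by rewrite mem_iota add0n => kn ->; exists k.
by exists k => //; rewrite mem_iota add0n ltnS.
Qed.

Lemma visitedS n v : visited S n.+1 v = (v == S n.+1) || visited S n v.
Proof.
by rewrite /visited mkseqS mem_rcons inE.
Qed.

Lemma visited_self n : visited S n (S n).
Proof. by apply/visitedP; exists n. Qed.

Lemma visited_le m n v : (m <= n)%N -> visited S m v -> visited S n v.
Proof.
move=> mn /visitedP[k km <-]; apply/visitedP; exists k => //.
exact: leq_trans mn.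
Qed.

End walk.

Record shift_params {R : realType} (r s rho : R) : Prop := ShiftParams {
  shift_r0 : 0 < r;
  shift_s0 : 0 < s;
  shift_rho0 : 0 < rho;
  shift_rho2 : rho ^+ 2 = r ^+ 2 + s ^+ 2;
  shift_s2 : 2 * s < rho }.

Ltac nlia :=
  repeat match goal with
  | H : context [@Order.lt] |- _ => clear H
  | H : context [@Order.le] |- _ => clear H
  | H : context [greedy] |- _ => clear H
  | H : context [shift_params] |- _ => clear H
  | H : context [@pair] |- _ => clear H
  | H : @eq ?T _ _ |- _ =>
    tryif first [unify T nat | unify T bool] then fail else clear H
  end; lia.

Section inequalities.
Variables (R : realType) (r s rho : R).
Hypothesis hp : shift_params r s rho.

Lemma r_lt_rho : r < rho. Proof. by have [r0 s0 rho0 rho2 s2] := hp; nra. Qed.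

Lemma s5_lt_r3 : 5 * s < 3 * r.
Proof.
have [r0 s0 rho0 rho2 s2] := hp.
have h : 4 * s ^+ 2 < rho ^+ 2 by nra.
have h' : 3 * s ^+ 2 < r ^+ 2 by lra.
nra.
Qed.

Lemma sq_within w : r ^+ 2 + w ^+ 2 <= rho ^+ 2 -> - s <= w <= s.
Proof. by have [r0 s0 rho0 rho2 s2] := hp => h; apply/andP; split; nra. Qed.

Lemma sq_within_lt w : r ^+ 2 + w ^+ 2 < rho ^+ 2 -> - s < w < s.
Proof. by have [r0 s0 rho0 rho2 s2] := hp => h; apply/andP; split; nra. Qed.

(** The first inequality gives [rho ^ 2 <= 2 * y * s] and the second [y <= 2 * s], hence
    [rho <= 2 * s]. It excludes a crossing between [(x, true)] and [(x + y, false)], in either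
    direction, when an unvisited point of the current line lies at distance at most [y] and below
    [rho]. *)
Lemma no_forward_cross y : 0 < y -> r ^+ 2 + (y - s) ^+ 2 <= y ^+ 2 ->
  r ^+ 2 + (y - s) ^+ 2 <= rho ^+ 2 -> False.
Proof.
have [r0 s0 rho0 rho2 s2] := hp; move=> y0 h1 /sq_within /andP[_ h2].
have h3 : rho ^+ 2 <= 2 * (y * s) by nra.
have h4 : rho ^+ 2 <= 4 * s ^+ 2 by nra.
nra.
Qed.

(** Expanding leaves [2 * D * s + s ^ 2 < 2 * D * r], which follows from [r < rho <= D] and
    [5 * s < 3 * r]. Seen from the line [false] on the left, a point of the line [true] at base
    distance [D] thus beats every point of the line [false] that is at least [r] further. *)
Lemma left_entry D xi : rho <= D -> D + r <= xi ->
  r ^+ 2 + (D + s) ^+ 2 < xi ^+ 2.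
Proof.
have [r0 s0 rho0 rho2 s2] := hp; move=> hD hxi; have h5 := s5_lt_r3; have h6 := r_lt_rho.
have h7 : (D + r) ^+ 2 <= xi ^+ 2 by nra.
have h8 : 2 * (D * s) + s ^+ 2 < 2 * (D * r).
  have : 0 < (D - r) * (r - s) by nra.
  by nra.
nra.
Qed.

(** Here [w] is the base distance from a point of the line [false] back to a hole of the line
    [true], and [Z] the one to a point left of the cluster; the hole beats that point on either
    line. *)
Lemma left_exit w Z : 0 <= w -> w + rho < Z ->
  r ^+ 2 + (w - s) ^+ 2 < Z ^+ 2 /\ (w - s) ^+ 2 < (Z - s) ^+ 2.
Proof.
have [r0 s0 rho0 rho2 s2] := hp; move=> w0 hZ.
have h : (w + rho) ^+ 2 < Z ^+ 2 by nra.
split; last by nra.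
have : 0 <= w * rho by nra.
nra.
Qed.

Lemma sqdist_same x y b : sqdist r s (x, b) (y, b) = (x - y) ^+ 2.
Proof.
by rewrite /sqdist /position /= eqxx; case: b; rewrite ?addr0 //; ring.
Qed.

Lemma sqdist_ft x y : sqdist r s (x, false) (y, true) = r ^+ 2 + (y + s - x) ^+ 2.
Proof. by rewrite /sqdist /position /=; ring. Qed.

Lemma sqdist_tf x y : sqdist r s (x, true) (y, false) = r ^+ 2 + (y - x - s) ^+ 2.
Proof. by rewrite /sqdist /position /=; ring. Qed.

End inequalities.

(** * Clusters *)

Section cluster.
Variables (R : realType) (r s rho : R).
Hypothesis hp : shift_params r s rho.
Variables (X : set R) (S : nat -> R * bool) (c : nat -> R) (N : nat).
Hypothesis gS : greedy r s X S.
Hypothesis c_lt : forall i j, (i < j <= N)%N -> c i < c j.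
Hypothesis c_gap : forall i, (i < N)%N -> c i.+1 - c i < rho.
Hypothesis c_in : forall i, (i <= N)%N -> X (c i).
Hypothesis c_out : forall y, X y ->
  y < c 0 - rho \/ (exists2 j, (j <= N)%N & y = c j) \/ c N + rho < y.

Lemma c_le i j : (i <= j <= N)%N -> c i <= c j.
Proof.
case/andP; rewrite leq_eqVlt => /predU1P[->//|ij] jN.
by apply/ltW/c_lt; rewrite ij.
Qed.

Lemma c_inj i j (b b' : bool) : (i <= N)%N -> (j <= N)%N ->
  ((c i, b) == (c j, b')) = (i == j) && (b == b').
Proof.
move=> iN jN; rewrite xpair_eqE; congr (_ && _).
case: (ltngtP i j) => [ij|ji|->]; last by rewrite eqxx.
  by rewrite lt_eqF// c_lt// ij.
by rewrite gt_eqF// c_lt// ji.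
Qed.

Definition on_line (b : bool) (P : nat -> bool) (n : nat) :=
  forall j, (j <= N)%N -> visited S n (c j, b) = P j.

Lemma on_lineS b b' k n (P Q : nat -> bool) : on_line b P n ->
  S n.+1 = (c k, b') -> (k <= N)%N ->
  (forall j, (j <= N)%N -> Q j = P j || (j == k) && (b == b')) ->
  on_line b Q n.+1.
Proof.
by move=> hP Sn kN PQ j jN; rewrite visitedS hP// Sn c_inj// PQ// orbC.
Qed.

Lemma on_line_out b n (P : nat -> bool) : on_line b P n ->
  (forall j, (j <= N)%N -> (S n.+1).1 <> c j) -> on_line b P n.+1.
Proof.
move=> hP Sn j jN; rewrite visitedS hP//.
by case: eqP => // h; case: (Sn j jN); rewrite -h.
Qed.

Lemma next_min n v : X v.1 -> ~~ visited S n v ->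
  sqdist r s (S n) (S n.+1) <= sqdist r s (S n) v.
Proof. by case: (gS n) => _ _ h; exact: h. Qed.

Lemma next_in n j b (P : nat -> bool) : (j <= N)%N -> on_line b P n -> ~~ P j ->
  sqdist r s (S n) (S n.+1) <= sqdist r s (S n) (c j, b).
Proof. by move=> jN hP Pj; apply: next_min; [exact: c_in|rewrite hP]. Qed.

Variant next_spec n : Prop :=
| NextLeft of (S n.+1).1 < c 0 - rho
| NextRight of c N + rho < (S n.+1).1
| NextIn j b of (j <= N)%N & S n.+1 = (c j, b) & ~~ visited S n (c j, b).

Lemma nextP n : next_spec n.
Proof.
case: (gS n) => Xn un _; case: (c_out Xn) => [h|[[j jN h]|h]].
- exact: NextLeft.
- apply: (@NextIn n j (S n.+1).2) => //; first by rewrite -h; case: (S n.+1).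
  by rewrite -h; move: un; case: (S n.+1).
- exact: NextRight.
Qed.

(* The possible states of a cluster [c 0 < ... < c N] as long as the walk has
   not been to its right.  In [stO] the walk is on the left of the unvisited
   part, and in [stD] the line [false] is complete. *)
Definition stO i m n :=
  [/\ on_line false (fun j => j < i)%N n, on_line true (fun j => j < m)%N n,
      (m <= i <= N.+1)%N, ((m < i)%N -> (i <= N)%N -> r <= c i - c i.-1)
    & (S n).1 < c 0 - rho \/ exists2 k, (k < m)%N & S n = (c k, true)].

(** The walk advances along the line [false], with the line [true] untouched from [i0] on. *)
Definition stL0 i0 i n :=
  [/\ on_line false (fun j => j <= i)%N n, on_line true (fun j => j < i0)%N n,
      (i0 <= i <= N)%N & S n = (c i, false)].

(** Having crossed back from the line [false], the walk enlarges an interval of the line [true] at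
    both ends; the hole from [i0] to [k] can still be filled. The gap of at least [r] after [c i] is
    what made the crossing preferable. *)
Definition stMid i0 k m i n :=
  [/\ on_line false (fun j => j <= i)%N n,
      on_line true (fun j => (j < i0) || (k <= j <= m))%N n,
      [&& i0 < k, k <= m, m <= i, i <= N & m < N]%N,
      ((i < N)%N -> r <= c i.+1 - c i)
    & S n = (c k, true) \/ S n = (c m, true)].

(** A sweep along the line [true] towards the right end. If a hole remains on the left of [k], it is
    already out of reach, at distance more than [rho]. *)
Definition stSwR i0 k m i n :=
  [/\ on_line false (fun j => j < i)%N n,
      on_line true (fun j => (j < i0) || (k <= j <= m))%N n,
      [&& i0 <= k, k <= m, m <= N, i <= N.+1 & (m < N) || (i <= N)]%N,
      ((i0 < k)%N -> (i <= m)%N && (rho < c i - c k.-1))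
    & S n = (c m, true)].

(** The sweep back along the line [false], from the right end down to the visited part. *)
Definition stSw0 i0 k l i n :=
  [/\ on_line false (fun j => (j < i) || (l <= j))%N n,
      on_line true (fun j => (j < i0) || (k <= j))%N n,
      [&& i0 <= k, k <= N, i < l & l <= N]%N,
      ((i0 < k)%N -> (k <= i)%N && (rho < c i - c k.-1))
    & S n = (c l, false)].

Definition stD i0 k n :=
  [/\ on_line false (fun=> true) n,
      on_line true (fun j => (j < i0) || (k <= j))%N n,
      (i0 <= k)%N
    & (i0 < k)%N -> (k <= N)%N /\ exists2 j, (k <= j <= N)%N &
        S n = (c j, true) \/ (S n = (c j, false) /\ rho < c j - c k.-1)].

(** The candidate is [(c m, true)]: later points of its line are farther, and so is every
    [(xi, false)] with [c m + r <= xi]. If [m < i], the gap condition puts the whole unvisited part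
    of the line [false] in that range; only for [m = i] can [(c i, false)] win. *)
Lemma stO_step i m n : stO i m n -> (m <= N)%N ->
  [\/ stO i m n.+1,
      m = i /\ stL0 i i n.+1,
      stSwR m m m i n.+1 | [/\ m = N, i = N.+1 & stD N N n.+1]].
Proof.
have [r0 s0 rho0 rho2 s2] := hp; have rlt := r_lt_rho hp; have sr := s5_lt_r3 hp.
move=> [fa tr /andP[mi iN] gap cur] mN.
have nb : sqdist r s (S n) (S n.+1) <= sqdist r s (S n) (c m, true).
  by apply: (next_in mN tr); rewrite ltnn.
have c0m : c 0 <= c m by apply: c_le.
have cmN : c m <= c N by apply: c_le; rewrite mN leqnn.
have curP : (S n).1 < c 0 - rho /\ (S n).2 = false \/
   (S n).2 = true /\ (S n).1 < c m.
  case: cur => [h|[k km ->]].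
    case E : (S n).2; [right|by left]; split => //; lra.
  by right; split => //; apply: c_lt; rewrite km.
have {curP} far xi : c m + r <= xi ->
    sqdist r s (S n) (c m, true) < sqdist r s (S n) (xi, false).
  move=> hxi; case: curP; case: (S n) => y b /= [].
    move=> hy ->; rewrite sqdist_ft sqdist_same.
    have := @left_entry _ r s rho hp (c m - y) (xi - y) ltac:(lra) ltac:(lra).
    by lra.
  move=> -> hy; rewrite sqdist_same sqdist_tf; nra.
case: (nextP n) => [L|Rt|j [] jN E un].
- apply: Or41; split=> //; last by left.
  + apply: on_line_out => // j jN h; have : c 0 <= c j by apply: c_le.
    lra.
  + apply: on_line_out => // j jN h; have : c 0 <= c j by apply: c_le.
    lra.
  + exact/andP.
- exfalso; case E : (S n.+1) Rt nb => [y []] /= Rt; last first.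
    by have := far y ltac:(lra); lra.
  case: cur => [|[k km ->]]; last first.
    have : c k < c m by apply: c_lt; rewrite km.
    by rewrite !sqdist_same; nra.
  case: (S n) => z [] /= hz; rewrite ?sqdist_same ?sqdist_ft; nra.
- have jm : (m <= j)%N by move: un; rewrite tr// -leqNgt.
  have {jm} jm : j = m.
    apply/eqP; rewrite eqn_leq jm andbT leqNgt; apply/negP => mj.
    have cmj : c m < c j by apply: c_lt; rewrite mj.
    move: nb; rewrite E; case: cur => [|[k km ->]]; last first.
      have : c k < c m by apply: c_lt; rewrite km.
      by rewrite !sqdist_same; nra.
    by case: (S n) => z [] /= hz; rewrite ?sqdist_same ?sqdist_ft; nra.
  rewrite {}jm in E un jN.
  have fa' : on_line false (fun j => j < i)%N n.+1.
    by apply: (on_lineS fa E) => // j' _; rewrite andbF orbF.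
  have tr' : on_line true (fun j => (j < m) || (m <= j <= m))%N n.+1.
    by apply: (on_lineS tr E) => // j' _; rewrite andbT; nlia.
  (* A sweep needs something left to visit; [m = N] and [i = N.+1] means that this very step
     completes the cluster. *)
  have [hm|/norP[h1 h2]] := boolP ((m < N) || (i <= N))%N.
    by apply: Or43; split => //; [nlia|rewrite ltnn].
  have mE : m = N by nlia.
  apply: Or44; split => //; first by nlia.
  have -> : N = m by [].
  split => //.
  + by move=> j' jN'; rewrite fa'//; nlia.
  + by move=> j' jN'; rewrite tr'//; nlia.
  + by rewrite ltnn.
- have ij : (i <= j)%N by move: un; rewrite fa// -leqNgt.
  have [mi'|mi'] := ltnP m i.
    exfalso; have := gap mi' (leq_trans ij jN).
    have : c m <= c i.-1 by apply: c_le; nlia.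
    have : c i <= c j by apply: c_le; nlia.
    move=> h1 h2 h3; have := far (c j) ltac:(lra); rewrite -E; lra.
  have {mi} mi : m = i by nlia.
  subst m; apply: Or42; split => //.
  have {ij} ij : j = i.
    apply/eqP; rewrite eqn_leq ij andbT leqNgt; apply/negP => mj.
    have cmj : c i < c j by apply: c_lt; rewrite mj.
    have : sqdist r s (S n) (S n.+1) <= sqdist r s (S n) (c i, false).
      by apply: (next_in mN fa); rewrite ltnn.
    move: nb; rewrite E; case: cur => [|[k km ->]]; last first.
      have h1 : c k < c i by apply: c_lt; rewrite km.
      rewrite sqdist_same !sqdist_tf => h2.
      have h3 : r <= c i - c k by have := sqr_ge0 (c j - c k - s); nra.
      nra.
    by case: (S n) => z [] /= hz; rewrite ?sqdist_same ?sqdist_tf; nra.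
  rewrite {}ij in E un jN.
  split => //.
  + by apply: (on_lineS fa E) => // j' _; rewrite andbT; nlia.
  + by apply: (on_lineS tr E) => // j' _; rewrite andbF orbF.
  + by rewrite leqnn.
Qed.

Lemma stO_full i m n : stO i m n -> (N < m)%N -> stD 0 0 n.
Proof.
move=> [fa tr h _ _] Nm; split => //.
- by move=> j jN; rewrite fa//; nlia.
- by move=> j jN; rewrite tr//; nlia.
Qed.

(** A crossing of length at most [rho] moves the base point by at most [2 * s < rho], so a step of
    that length, on either line, cannot jump over the gaps around the cluster. *)
Lemma next_near n j b : S n = (c j, b) -> (j <= N)%N ->
  sqdist r s (S n) (S n.+1) <= rho ^+ 2 ->
  exists j' b', [/\ (j' <= N)%N, S n.+1 = (c j', b') & ~~ visited S n (c j', b')].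
Proof.
have [r0 s0 rho0 rho2 s2] := hp.
move=> Sn jN; have c0j : c 0 <= c j by apply: c_le.
have cjN : c j <= c N by apply: c_le; rewrite jN leqnn.
case: (nextP n) => [||j' b' j'N E un _]; last by exists j', b'.
  case: (S n.+1) => y b' /= hy; rewrite Sn => {Sn} h; exfalso; move: h.
  case: b; case: b'; rewrite ?sqdist_same ?sqdist_tf ?sqdist_ft.
  - nra.
  - by move/(sq_within hp)/andP => [h1 h2]; lra.
  - by move/(sq_within hp)/andP => [h1 h2]; lra.
  - nra.
case: (S n.+1) => y b' /= hy; rewrite Sn => {Sn} h; exfalso; move: h.
case: b; case: b'; rewrite ?sqdist_same ?sqdist_tf ?sqdist_ft.
- nra.
- by move/(sq_within hp)/andP => [h1 h2]; lra.
- by move/(sq_within hp)/andP => [h1 h2]; lra.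
- nra.
Qed.

(** The next point of the line is within [rho]. A crossing within [rho] lands strictly behind in
    base, by less than [2 * s], and costs at least [r], so it is taken only before a gap of at least
    [r]. At the last point the unvisited twin, at distance [rho], takes the place of the next
    point. *)
Lemma stL0_step i0 i n : stL0 i0 i n ->
  [\/ (i < N)%N /\ stL0 i0 i.+1 n.+1, stO i.+1 i0.+1 n.+1,
      exists j, stMid i0 j j i n.+1 | i = N /\ stD i0 N n.+1].
Proof.
have [r0 s0 rho0 rho2 s2] := hp.
move=> [fa tr /andP[i0i iN] Sn].
have [iN'|iN'] := ltnP i N.
- have gap := c_gap iN'; have ci : c i < c i.+1 by apply: c_lt; rewrite ltnSn.
  have nb : sqdist r s (S n) (S n.+1) <= sqdist r s (S n) (c i.+1, false).
    by apply: (next_in _ fa) => //; rewrite ltnn.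
  have nb' : sqdist r s (S n) (S n.+1) < rho ^+ 2.
    apply: (le_lt_trans nb); rewrite Sn sqdist_same; nra.
  have [j' [[] [j'N E un]]] := next_near Sn iN (ltW nb').
  + have i0j : (i0 <= j')%N by move: un; rewrite tr// -leqNgt.
    move: nb nb'; rewrite Sn E sqdist_ft sqdist_same => nb nb'.
    have /andP[h1 h2] := sq_within_lt hp nb'.
    have rg : r <= c i.+1 - c i by have := sqr_ge0 (c j' + s - c i); nra.
    have j'i : (j' < i)%N.
      rewrite ltnNge; apply/negP => h.
      have : c i <= c j' by apply: c_le; rewrite h.
      lra.
    have [ji0|ji0] := eqVneq j' i0.
      subst j'; apply: Or42; split => //; last by right; exists i0.
      * by apply: (on_lineS fa E) => // j _; rewrite andbF orbF.
      * by apply: (on_lineS tr E) => // j _; rewrite andbT; nlia.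
      * by nlia.
    apply: Or43; exists j'; split => //; last by left.
    * by apply: (on_lineS fa E) => // j _; rewrite andbF orbF.
    * by apply: (on_lineS tr E) => // j _; rewrite andbT; nlia.
    * by nlia.
  + have i0j : (i < j')%N by move: un; rewrite fa// -ltnNge.
    have ij : j' = i.+1.
      apply/eqP; rewrite eqn_leq i0j andbT leqNgt; apply/negP => h.
      have : c i.+1 < c j' by apply: c_lt; rewrite h.
      move: nb; rewrite E Sn !sqdist_same; nra.
    subst j'; apply: Or41; split => //; split => //.
    * by apply: (on_lineS fa E) => // j _; rewrite andbT; nlia.
    * by apply: (on_lineS tr E) => // j _; rewrite andbF orbF.
    * by nlia.
- have iE : i = N by nlia.
  subst i.
  have nb : sqdist r s (S n) (S n.+1) <= sqdist r s (S n) (c N, true).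
    by apply: (next_in _ tr) => //; rewrite -leqNgt.
  have nb' : sqdist r s (S n) (S n.+1) <= rho ^+ 2.
    by apply: (le_trans nb); rewrite Sn sqdist_ft; nra.
  have [j' [[] [j'N E un]]] := next_near Sn iN nb'; last first.
    by move: un; rewrite fa// j'N.
  have i0j : (i0 <= j')%N by move: un; rewrite tr// -leqNgt.
  have [ji0|ji0] := eqVneq j' i0.
    subst j'; apply: Or42; split => //; last by right; exists i0.
    + by apply: (on_lineS fa E) => // j jN; rewrite andbF orbF; nlia.
    + by apply: (on_lineS tr E) => // j jN; rewrite andbT; nlia.
    + by nlia.
    + by nlia.
  have [jN|jN] := ltnP j' N.
    apply: Or43; exists j'; split => //; last by left.
    + by apply: (on_lineS fa E) => // j _; rewrite andbF orbF.
    + by apply: (on_lineS tr E) => // j _; rewrite andbT; nlia.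
    + by nlia.
    + by nlia.
  have jE : j' = N by nlia.
  subst j'; apply: Or44; split => //; split => //.
  + by apply: (on_lineS fa E) => // j jN'; rewrite andbF orbF jN'.
  + by apply: (on_lineS tr E) => // j jN'; rewrite andbT; nlia.
  + by move=> _; split => //; exists N; [nlia|left].
Qed.

(** The unvisited part of the line [false] lies ahead and is excluded by [no_forward_cross], so the
    interval grows at one of its ends. When it meets [i0] the hole is closed and the orderly state
    [stO] is back. *)
Lemma stMid_step i0 k m i n : stMid i0 k m i n ->
  [\/ exists k' m', stMid i0 k' m' i n.+1, stO i.+1 m.+1 n.+1,
      stSwR i0 k m.+1 i.+1 n.+1 | i = N /\ stD i0 k n.+1].
Proof.
have [r0 s0 rho0 rho2 s2] := hp; have rlt := r_lt_rho hp; have sr := s5_lt_r3 hp.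
move=> [fa tr /and5P[i0k km mi iN mN] gap cur].
have kN : (k <= N)%N by nlia.
have ckm : c k <= c m by apply: c_le; nlia.
have ck1 : c k.-1 < c k by apply: c_lt; nlia.
have cm1 : c m < c m.+1 by apply: c_lt; nlia.
have gk : c k - c k.-1 < rho.
  by have := @c_gap k.-1; rewrite prednK; [apply; nlia|nlia].
have gm := c_gap mN.
have [x [Sx xE]] : exists x, S n = (c x, true) /\ (x = k \/ x = m).
  by case: cur => h; [exists k|exists m]; split => //; [left|right].
have xN : (x <= N)%N by nlia.
have kx : c k <= c x by apply: c_le; nlia.
have xm : c x <= c m by apply: c_le; nlia.
have nk : sqdist r s (S n) (S n.+1) <= sqdist r s (S n) (c k.-1, true).
  by apply: (next_in _ tr); nlia.
have nm : sqdist r s (S n) (S n.+1) <= sqdist r s (S n) (c m.+1, true).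
  by apply: (next_in _ tr); nlia.
have nb' : sqdist r s (S n) (S n.+1) <= rho ^+ 2.
  case: xE => xE; subst x.
    by apply: (le_trans nk); rewrite Sx sqdist_same; nra.
  by apply: (le_trans nm); rewrite Sx sqdist_same; nra.
have [j' [[] [j'N E un]]] := next_near Sx xN nb'; last first.
  exfalso; have ij : (i < j')%N by move: un; rewrite fa// -ltnNge.
  have nj : sqdist r s (S n) (S n.+1) <= sqdist r s (S n) (c j', true).
    by apply: (next_in _ tr); nlia.
  have xj : c x < c j' by apply: c_lt; nlia.
  move: nj nb'; rewrite E Sx sqdist_same sqdist_tf => nj nb'.
  apply: (@no_forward_cross _ r s rho hp (c j' - c x)) => //; first by lra.
  by apply: (le_trans nj); nra.
have fa' : on_line false (fun j => j <= i)%N n.+1.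
  by apply: (on_lineS fa E) => // j _; rewrite andbF orbF.
have [j'k|kj'] := ltnP j' k.
  have jk : j' = k.-1.
    apply/eqP; rewrite eqn_leq; apply/andP; split; first by nlia.
    rewrite leqNgt; apply/negP => h.
    have : c j' < c k.-1 by apply: c_lt; nlia.
    move: nk; rewrite E Sx !sqdist_same; nra.
  have [ki|ki] := eqVneq k.-1 i0.
    apply: Or42; split => //; last by right; exists i0; [nlia|rewrite E jk ki].
    + by apply: (on_lineS tr E) => // j _; rewrite andbT; nlia.
    + by nlia.
  apply: Or41; exists k.-1, m; split => //; last by left; rewrite E jk.
  + by apply: (on_lineS tr E) => // j _; rewrite andbT; nlia.
  + by nlia.
have jm : (m < j')%N by move: un; rewrite tr//; nlia.
have {jm} jm : j' = m.+1.
  apply/eqP; rewrite eqn_leq jm andbT leqNgt; apply/negP => h.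
  have : c m.+1 < c j' by apply: c_lt; nlia.
  move: nm; rewrite E Sx !sqdist_same; nra.
subst j'.
have tr' : on_line true (fun j => (j < i0) || (k <= j <= m.+1))%N n.+1.
  by apply: (on_lineS tr E) => // j _; rewrite andbT; nlia.
have [mi'|mi'] := ltnP m i.
  have [mN'|mN'] := ltnP m.+1 N.
    by apply: Or41; exists k, m.+1; split => //; [nlia|right].
  have iE : i = N by nlia.
  apply: Or44; split => //; split => //.
  - by move=> j jN; rewrite fa'//; nlia.
  - by move=> j jN; rewrite tr'//; nlia.
  - by nlia.
  - by move=> _; split => //; exists m.+1; [nlia|left].
have iE : i = m by nlia.
subst i; apply: Or43; split => //.
- by nlia.
(* The step to [m.+1], which is at least [r], was not longer than the one to [k.-1]. So
   [c i.+1 - c k.-1] contains two stretches of length at least [r], and [rho < 2 * r]. *)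
- move=> _; rewrite leqnn /=.
  have := gap mN; move: nk; rewrite E Sx !sqdist_same.
  have r2 : rho < 2 * r by nra.
  case: xE => xE; subst x => nk g; nra.
Qed.

(** The hole is too far, and the line [false] ahead is excluded by [no_forward_cross]. At the right
    end the twin at distance [rho] is the only candidate, and the sweep turns back. *)
Lemma stSwR_step i0 k m i n : stSwR i0 k m i n ->
  [\/ (m < N)%N /\ stSwR i0 k m.+1 i n.+1, stSw0 i0 k N i n.+1
    | stD i0 k n.+1].
Proof.
have [r0 s0 rho0 rho2 s2] := hp.
move=> [fa tr /and5P[i0k km mN iN hmi] gap Sn].
have left_far j : (i0 <= j < k)%N -> rho < c m - c j.
  move=> /andP[i0j jk].
  have /andP[im g] := gap (leq_ltn_trans i0j jk).
  have : c j <= c k.-1 by apply: c_le; nlia.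
  have : c i <= c m by apply: c_le; nlia.
  lra.
have [mN'|Nm] := ltnP m N.
- have g := c_gap mN'; have cm : c m < c m.+1 by apply: c_lt; nlia.
  have nb : sqdist r s (S n) (S n.+1) <= sqdist r s (S n) (c m.+1, true).
    by apply: (next_in _ tr); nlia.
  have nb' : sqdist r s (S n) (S n.+1) < rho ^+ 2.
    by apply: (le_lt_trans nb); rewrite Sn sqdist_same; nra.
  have [j' [[] [j'N E un]]] := next_near Sn mN (ltW nb'); last first.
    exfalso; move: nb nb'; rewrite E Sn sqdist_same sqdist_tf => nb nb'.
    have /andP[h1 h2] := sq_within_lt hp nb'.
    have mj : (m < j')%N.
      rewrite ltnNge; apply/negP => h.
      have : c j' <= c m by apply: c_le; nlia.
      lra.
    have : c m.+1 <= c j' by apply: c_le; nlia.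
    move=> h3; apply: (@no_forward_cross _ r s rho hp (c j' - c m)).
    + lra.
    + by apply: (le_trans nb); nra.
    + exact: ltW.
  have [j'k|kj'] := ltnP j' k.
    have := @left_far j'; rewrite j'k andbT.
    move=> h; have {}h : rho < c m - c j' by apply: h; move: un; rewrite tr//; nlia.
    by move: nb'; rewrite E Sn sqdist_same; nra.
  have jm : (m < j')%N by move: un; rewrite tr//; nlia.
  have {jm} jm : j' = m.+1.
    apply/eqP; rewrite eqn_leq jm andbT leqNgt; apply/negP => h.
    have : c m.+1 < c j' by apply: c_lt; nlia.
    move: nb; rewrite E Sn !sqdist_same; nra.
  subst j'.
  have fa' : on_line false (fun j => j < i)%N n.+1.
    by apply: (on_lineS fa E) => // j _; rewrite andbF orbF.
  have tr' : on_line true (fun j => (j < i0) || (k <= j <= m.+1))%N n.+1.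
    by apply: (on_lineS tr E) => // j _; rewrite andbT; nlia.
  have [h|/norP[h1 h2]] := boolP ((m.+1 < N) || (i <= N))%N.
    apply: Or31; split => //; split => //; first by nlia.
    by move=> /gap /andP[h1 h2]; rewrite h2 andbT; nlia.
  apply: Or33; split => //.
  + by move=> j jN; rewrite fa'//; nlia.
  + by move=> j jN; rewrite tr'//; nlia.
  + by move=> _; split; [nlia|exists m.+1; [nlia|left]].
- have mE : m = N by nlia.
  subst m; have iN' : (i <= N)%N by nlia.
  have nb : sqdist r s (S n) (S n.+1) <= sqdist r s (S n) (c N, false).
    by apply: (next_in _ fa); nlia.
  have nb' : sqdist r s (S n) (S n.+1) <= rho ^+ 2.
    by apply: (le_trans nb); rewrite Sn sqdist_tf; nra.
  have [j' [[] [j'N E un]]] := next_near Sn mN nb'.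
    have := @left_far j' => h.
    have {}h : rho < c N - c j' by apply: h; move: un; rewrite tr//; nlia.
    by move: nb'; rewrite E Sn sqdist_same; nra.
  have jE : j' = N.
    apply/eqP; rewrite eqn_leq j'N /= leqNgt; apply/negP => h.
    have : c j' < c N by apply: c_lt; nlia.
    move: nb'; rewrite E Sn sqdist_tf => /(sq_within hp)/andP[h1 h2]; lra.
  subst j'.
  have fa' : on_line false (fun j => (j < i) || (N <= j))%N n.+1.
    by apply: (on_lineS fa E) => // j jN; rewrite andbT; nlia.
  have tr' : on_line true (fun j => (j < i0) || (k <= j))%N n.+1.
    by apply: (on_lineS tr E) => // j jN; rewrite andbF orbF; nlia.
  have [iN''|iN''] := ltnP i N.
    apply: Or32; split => //; first by nlia.
    move=> /[dup] i0k' /gap /andP[h1 h2]; rewrite h2 andbT leqNgt; apply/negP => h.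
    have : c i <= c k.-1 by apply: c_le; nlia.
    lra.
  have iE : i = N by nlia.
  apply: Or33; split => //.
  + by move=> j jN; rewrite fa'//; nlia.
  + move=> /gap /andP[h1 h2]; split => //; exists N; first by nlia.
    by right; split => //; rewrite -{1}iE.
Qed.

(** Moving left on the line [false] mirrors moving right on the line [true], because the offset
    between the lines changes sign as well. So [no_forward_cross] now excludes crossings to the hole
    on the left. *)
Lemma stSw0_step i0 k l i n : stSw0 i0 k l i n ->
  stSw0 i0 k l.-1 i n.+1 \/ stD i0 k n.+1.
Proof.
have [r0 s0 rho0 rho2 s2] := hp.
move=> [fa tr /and4P[i0k kN il lN] gap Sn].
have cl : c l.-1 < c l by apply: c_lt; nlia.
have g : c l - c l.-1 < rho.
  by have := @c_gap l.-1; rewrite prednK; [apply; nlia|nlia].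
have nb : sqdist r s (S n) (S n.+1) <= sqdist r s (S n) (c l.-1, false).
  by apply: (next_in _ fa); nlia.
have nb' : sqdist r s (S n) (S n.+1) < rho ^+ 2.
  by apply: (le_lt_trans nb); rewrite Sn sqdist_same; nra.
have [j' [[] [j'N E un]]] := next_near Sn lN (ltW nb').
  exfalso.
  have kj : (i0 <= j' < k)%N by move: un; rewrite tr//; nlia.
  have ki : (k <= i)%N by have /andP[] := gap (ltac:(nlia)).
  have : c j' <= c l.-1 by apply: c_le; nlia.
  move: nb nb'; rewrite E Sn sqdist_same sqdist_ft => nb nb' h.
  have e : (c j' + s - c l) ^+ 2 = (c l - c j' - s) ^+ 2 by ring.
  rewrite e in nb nb'.
  apply: (@no_forward_cross _ r s rho hp (c l - c j')).
  - lra.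
  - by apply: (le_trans nb); nra.
  - exact: ltW.
have jl : (i <= j' < l)%N by move: un; rewrite fa//; nlia.
have {}jl : j' = l.-1.
  apply/eqP; rewrite eqn_leq; apply/andP; split; first by nlia.
  rewrite leqNgt; apply/negP => h.
  have : c j' < c l.-1 by apply: c_lt; nlia.
  move: nb; rewrite E Sn !sqdist_same; nra.
subst j'.
have fa' : on_line false (fun j => (j < i) || (l.-1 <= j))%N n.+1.
  by apply: (on_lineS fa E) => // j jN; rewrite andbT; nlia.
have tr' : on_line true (fun j => (j < i0) || (k <= j))%N n.+1.
  by apply: (on_lineS tr E) => // j jN; rewrite andbF orbF.
have [il'|il'] := ltnP i l.-1; first by left; split => //; nlia.
right; split => //.
- by move=> j jN; rewrite fa'//; nlia.
- move=> /gap /andP[ki h]; split => //; exists l.-1; first by nlia.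
  by right; split => //; have -> : l.-1 = i by nlia.
Qed.

(** This bound holds before the outcome of the step is known; it prevents a departure from the
    cluster in the middle of a sweep. *)
Lemma stSwR_near i0 k m i n : stSwR i0 k m i n ->
  exists j b, (j <= N)%N /\ S n.+1 = (c j, b).
Proof.
have [r0 s0 rho0 rho2 s2] := hp.
move=> [fa tr /and5P[i0k km mN iN hmi] gap Sn].
suff /(next_near Sn mN)[j [b [jN E _]]] :
  sqdist r s (S n) (S n.+1) <= rho ^+ 2 by exists j, b.
have [mN'|Nm] := ltnP m N.
  have g := c_gap mN'; have cm : c m < c m.+1 by apply: c_lt; nlia.
  have nb : sqdist r s (S n) (S n.+1) <= sqdist r s (S n) (c m.+1, true).
    by apply: (next_in _ tr); nlia.
  by apply: (le_trans nb); rewrite Sn sqdist_same; nra.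
have mE : m = N by nlia.
subst m; apply: le_trans (_ : sqdist r s (S n) (c N, false) <= _).
  by apply: (next_in _ fa); nlia.
by rewrite Sn sqdist_tf; nra.
Qed.

Lemma stSw0_near i0 k l i n : stSw0 i0 k l i n ->
  exists j b, (j <= N)%N /\ S n.+1 = (c j, b).
Proof.
have [r0 s0 rho0 rho2 s2] := hp.
move=> [fa tr /and4P[i0k kN il lN] gap Sn].
suff /(next_near Sn lN)[j [b [jN E _]]] :
  sqdist r s (S n) (S n.+1) <= rho ^+ 2 by exists j, b.
have cl : c l.-1 < c l by apply: c_lt; nlia.
have g : c l - c l.-1 < rho.
  by have := @c_gap l.-1; rewrite prednK; [apply; nlia|nlia].
apply: le_trans (_ : sqdist r s (S n) (c l.-1, false) <= _).
  by apply: (next_in _ fa); nlia.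
by rewrite Sn sqdist_same; nra.
Qed.

(** By [left_exit] the hole is preferred to everything left of the cluster, so it is filled from its
    right end unless the walk departs to the right. *)
Lemma stD_step i0 k n : stD i0 k n -> (i0 < k)%N ->
  stD i0 k.-1 n.+1 \/ (c N + rho < (S n.+1).1 /\ on_line false (fun=> true) n.+1).
Proof.
have [r0 s0 rho0 rho2 s2] := hp.
move=> [fa tr i0k cur] i0k'; have [kN [j jkN {}cur]] := cur i0k'.
have nb : sqdist r s (S n) (S n.+1) <= sqdist r s (S n) (c k.-1, true).
  by apply: (next_in _ tr); nlia.
have c0k : c 0 <= c k.-1 by apply: c_le; nlia.
have ckj : c k.-1 < c j by apply: c_lt; nlia.
case: (nextP n) => [Le|Ri|j' [] j'N E un].
- exfalso; move: nb Le; case: (S n.+1) => y b /=; case: cur => [->|[-> w]].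
    case: b; rewrite ?sqdist_same ?sqdist_tf => nb Le; nra.
  have h : c j - c k.-1 + rho < c j - y -> _ := left_exit hp (w := c j - c k.-1) (ltac:(lra)).
  case: b; rewrite ?sqdist_same ?sqdist_ft => nb Le; have [] := h ltac:(lra) => h1 h2.
    have e : (c k.-1 + s - c j) ^+ 2 = (c j - c k.-1 - s) ^+ 2 by ring.
    have e' : (y + s - c j) ^+ 2 = (c j - y - s) ^+ 2 by ring.
    rewrite e e' in nb; lra.
  have e : (c k.-1 + s - c j) ^+ 2 = (c j - c k.-1 - s) ^+ 2 by ring.
  rewrite e in nb; lra.
- right; split => //; apply: on_line_out => // j' jN' h.
  have : c j' <= c N by apply: c_le; nlia.
  lra.
- have kj : (i0 <= j' < k)%N by move: un; rewrite tr//; nlia.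
  have jE : j' = k.-1.
    apply/eqP; rewrite eqn_leq; apply/andP; split; first by nlia.
    rewrite leqNgt; apply/negP => h.
    have : c j' < c k.-1 by apply: c_lt; nlia.
    move: nb; rewrite E; case: cur => [->|[-> w]].
      by rewrite !sqdist_same; nra.
    by rewrite !sqdist_ft; nra.
  subst j'; left; split => //.
  + by apply: (on_lineS fa E).
  + by apply: (on_lineS tr E) => // j' _; rewrite andbT; nlia.
  + by nlia.
  + by move=> _; split; [nlia|exists k.-1; [nlia|left]].
- by move: un; rewrite fa.
Qed.

End cluster.

Section half_done.
Variables (R : realType) (r s rho : R).
Hypothesis hp : shift_params r s rho.
Variables (X : set R) (S : nat -> R * bool) (c : nat -> R) (N : nat).
Hypothesis gS : greedy r s X S.
Hypothesis c_lt : forall i j, (i < j <= N)%N -> c i < c j.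
Hypothesis c_gap : forall i, (i < N)%N -> c i.+1 - c i < rho.
Hypothesis c_in : forall i, (i <= N)%N -> X (c i).
Hypothesis c_out : forall y, X y ->
  y < c 0 - rho \/ (exists2 j, (j <= N)%N & y = c j) \/ c N + rho < y.
Hypothesis c_start : (S 0).1 < c 0 - rho.

Definition incomplete n :=
  [\/ exists i m, stO r rho S c N i m n, exists i0 i, stL0 S c N i0 i n,
      exists i0 k m i, stMid r S c N i0 k m i n |
      (exists i0 k m i, stSwR rho S c N i0 k m i n) \/
      exists i0 k l i, stSw0 rho S c N i0 k l i n].

Lemma incomplete_cur n : incomplete n -> (S n).1 <= c N.
Proof.
have [r0 s0 rho0 rho2 s2] := hp.
have c0N : c 0 <= c N by apply: (c_le c_lt); rewrite leqnn.
have cN j : (j <= N)%N -> c j <= c N.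
  by move=> jN; apply: (c_le c_lt); rewrite jN leqnn.
case=> [[i [m [_ _ ? _ [|[k km ->]]]]]|[i0 [i [_ _ h ->]]]|
        [i0 [k [m [i [_ _ /and5P[h1 h2 h3 h4 h5] _ [->|->]]]]]]|
        [[i0 [k [m [i [_ _ /and5P[h1 h2 h3 h4 h5] _ ->]]]]]|
         [i0 [k [l [i [_ _ /and4P[h1 h2 h3 h4] _ ->]]]]]]] /=.
- lra.
- have [mN|mN] := leqP m N; first by apply: cN; nlia.
  apply: cN; nlia.
- by apply: cN; nlia.
- by apply: cN; nlia.
- by apply: cN; nlia.
- by apply: cN; nlia.
- by apply: cN; nlia.
Qed.

Lemma complete_keep n : on_line S c N false (fun=> true) n ->
  on_line S c N false (fun=> true) n.+1.
Proof. by move=> h j jN; rewrite visitedS h ?orbT. Qed.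

Lemma full_step k n : stD rho S c N k k n -> stD rho S c N k k n.+1.
Proof.
move=> [fa tr _ _]; split => //; last by rewrite ltnn.
  exact: complete_keep.
by move=> j jN; rewrite visitedS tr// [RHS](_ : _ = true) ?orbT//; nlia.
Qed.

Lemma incomplete0 : incomplete 0.
Proof.
have [r0 s0 rho0 rho2 s2] := hp.
have un j b : (j <= N)%N -> ~~ visited S 0 (c j, b).
  move=> jN; apply/visitedP => -[k]; rewrite leqn0 => /eqP -> h.
  have : c 0 <= c j by apply: (c_le c_lt).
  by move: c_start; rewrite h /=; lra.
apply: Or41; exists 0%N, 0%N; split => //; last by left.
- by move=> j jN; apply/negbTE/un.
- by move=> j jN; apply/negbTE/un.
Qed.

Lemma incomplete_step n : incomplete n ->
  incomplete n.+1 \/ exists i0 k, stD rho S c N i0 k n.+1.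
Proof.
case=> [[i [m h]]|[i0 [i h]]|[i0 [k [m [i h]]]]|[[i0 [k [m [i h]]]]|
    [i0 [k [l [i h]]]]]].
- have [mN|Nm] := leqP m N.
    have [h'|[_ h']|h'|[_ _ h']] := stO_step hp gS c_lt c_in c_out h mN.
    + by left; apply: Or41; exists i, m.
    + by left; apply: Or42; exists i, i.
    + by left; apply: Or44; left; exists m, m, m, i.
    + by right; exists N, N.
  by right; exists 0%N, 0%N; apply: full_step; exact: stO_full h Nm.
- have [[_ h']|h'|[j h']|[_ h']] := stL0_step hp gS c_lt c_gap c_in c_out h.
  + by left; apply: Or42; exists i0, i.+1.
  + by left; apply: Or41; exists i.+1, i0.+1.
  + by left; apply: Or43; exists i0, j, j, i.
  + by right; exists i0, N.
- have [[k' [m' h']]|h'|h'|[_ h']] := stMid_step hp gS c_lt c_gap c_in c_out h.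
  + by left; apply: Or43; exists i0, k', m', i.
  + by left; apply: Or41; exists i.+1, m.+1.
  + by left; apply: Or44; left; exists i0, k, m.+1, i.+1.
  + by right; exists i0, k.
- have [[_ h']|h'|h'] := stSwR_step hp gS c_lt c_gap c_in c_out h.
  + by left; apply: Or44; left; exists i0, k, m.+1, i.
  + by left; apply: Or44; right; exists i0, k, N, i.
  + by right; exists i0, k.
- have [h'|h'] := stSw0_step hp gS c_lt c_gap c_in c_out h.
  + by left; apply: Or44; right; exists i0, k, l.-1, i.
  + by right; exists i0, k.
Qed.

(** An incomplete state keeps the walk at or left of [c N], and the only way out of the incomplete
    states is through [stD], where the line [false] is complete forever. *)
Lemma half_done n :
  (incomplete n /\ forall k, (k <= n)%N -> (S k).1 <= c N) \/
  on_line S c N false (fun=> true) n.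
Proof.
elim: n => [|n [[IH cur]|IH]]; last by right; exact: complete_keep.
  left; split; first exact: incomplete0.
  by move=> k; rewrite leqn0 => /eqP ->; apply/incomplete_cur/incomplete0.
case: (incomplete_step IH) => [h|[i0 [k [h _ _ _]]]]; [left|by right].
split => // k; rewrite leq_eqVlt => /predU1P[->|]; first exact: incomplete_cur.
by rewrite ltnS; exact: cur.
Qed.

(** In contrast to [half_done], the exact state is kept for as long as the walk has not passed the
    cluster. Once the last hole is filled, [stD] with [i0 = k] persists. *)
Lemma front_state n : (forall k, (k <= n)%N -> (S k).1 <= c N) ->
  incomplete n \/ exists i0 k, stD rho S c N i0 k n.
Proof.
have [r0 s0 rho0 rho2 s2] := hp.
elim: n => [|n IH] cur; first by left; exact: incomplete0.
case: IH => [k kn|/incomplete_step//|[i0 [k h]]]; first by apply: cur; nlia.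
right; have [i0k|ki0] := ltnP i0 k.
  case: (stD_step hp gS c_lt c_in c_out h i0k) => [h'|[h' _]].
    by exists i0, k.-1.
  by have := cur n.+1 (leqnn _); lra.
case: (h) => _ _ i0k _; exists k, k.
by apply: full_step; have -> : k = i0 by [nlia]; move: h; have -> : k = i0 by nlia.
Qed.

End half_done.

(** * The succession of all clusters to the right of the start *)

Section sequence.
Variables (R : realType) (r s rho : R).
Hypothesis hp : shift_params r s rho.
Variables (X : set R) (S : nat -> R * bool) (x : nat -> R).
Hypothesis gS : greedy r s X S.
Hypothesis x_lt : forall i j, (i < j)%N -> x i < x j.
Hypothesis x_in : forall i, X (x i).
Hypothesis x_out : forall y, X y -> y < x 0 - rho \/ exists i, y = x i.
Hypothesis x_start : (S 0).1 < x 0 - rho.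
Hypothesis x_tie : forall i, x i.+1 - x i != rho.

Lemma x_le i j : (i <= j)%N -> x i <= x j.
Proof. by rewrite leq_eqVlt => /predU1P[->//|/x_lt/ltW]. Qed.

Lemma x_ltE i j : (x i < x j) = (i < j)%N.
Proof.
have [/x_lt //|ji] := ltnP i j; apply/negbTE; rewrite -leNgt; exact: x_le.
Qed.

(** A boundary is the index at which a cluster begins. Index [0] qualifies because [x_out] leaves a
    margin [rho] before it. *)
Definition boundary e := (e == 0)%N || (rho < x e - x e.-1).

Lemma boundary_lt e i : boundary e -> (i < e)%N -> x i < x e - rho.
Proof.
case/orP => [/eqP ->//|h] ie.
have : x i <= x e.-1 by apply: x_le; nlia.
lra.
Qed.

Lemma index_cases n : (S n).1 < x 0 - rho \/ exists i b, S n = (x i, b).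
Proof.
case: n => [|n]; first by left.
have [Xn _ _] := gS n; case: (x_out Xn) => [|[i h]]; first by left.
by right; exists i, (S n.+1).2; rewrite -h; case: (S n.+1).
Qed.

Lemma below_boundary n e : boundary e -> (S n).1 < x e -> (S n).1 < x e - rho.
Proof.
move=> be; case: (index_cases n) => [h _|[i [b ->]] /=].
  by have : x 0 <= x e by [apply: x_le]; lra.
by rewrite x_ltE; exact: boundary_lt.
Qed.

Lemma above_boundary n e : ~~ ((S n).1 < x e) -> exists i b,
  S n = (x i, b) /\ (e <= i)%N.
Proof.
case: (index_cases n) => [h|[i [b ->]] /=].
  have : x 0 <= x e by apply: x_le.
  by have [_ _ rho0 _ _] := hp; lra.
by rewrite x_ltE -leqNgt => h; exists i, b.
Qed.

Lemma last_boundary j : exists e, [/\ boundary e, (e <= j)%N &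
  forall e', (e < e' <= j)%N -> ~~ boundary e'].
Proof.
have h0 : exists e, boundary e && (e <= j)%N by exists 0%N; rewrite /boundary.
have hb e : boundary e && (e <= j)%N -> (e <= j)%N by case/andP.
case: (ex_maxnP h0 hb) => e /andP[be ej] em; exists e; split => // e' /andP[ee' ej'].
apply/negP => be'; have := em e'; rewrite be' ej' => /(_ isT); nlia.
Qed.

Definition reached n e := exists i b, (e <= i)%N /\ visited S n (x i, b).

Lemma reached_pred n e : reached n.+1 e -> (S n.+1).1 < x e -> reached n e.
Proof.
move=> [i [b [h]]]; rewrite visitedS => /orP[/eqP <-|v] /=; last by exists i, b.
by rewrite x_ltE; nlia.
Qed.

Section cluster_of.
Variables lo N : nat.
Hypothesis blo : boundary lo.
Hypothesis bhi : boundary (lo + N).+1.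
Hypothesis nob : forall e, (lo < e <= lo + N)%N -> ~~ boundary e.

Let c i := x (lo + i).

Lemma cluster_lt i j : (i < j <= N)%N -> c i < c j.
Proof. by case/andP=> ij _; apply: x_lt; rewrite ltn_add2l. Qed.

Lemma cluster_gap i : (i < N)%N -> c i.+1 - c i < rho.
Proof.
move=> iN; have := nob (e := lo + i.+1) ltac:(nlia).
by rewrite /boundary /c !addnS /= -leNgt le_eqVlt (negbTE (x_tie _)).
Qed.

Lemma cluster_in i : (i <= N)%N -> X (c i).
Proof. by move=> _; exact: x_in. Qed.

Lemma cluster_out y : X y ->
  y < c 0 - rho \/ (exists2 j, (j <= N)%N & y = c j) \/ c N + rho < y.
Proof.
have [r0 s0 rho0 rho2 s2] := hp; rewrite /c addn0.
case/x_out => [h|[i ->]].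
  by left; have : x 0 <= x lo by [apply: x_le]; lra.
have [ilo|loi] := ltnP i lo; first by left; exact: boundary_lt.
have [h|h] := leqP i (lo + N).
  by right; left; exists (i - lo)%N; [nlia|rewrite subnKC].
right; right; have := boundary_lt bhi (ltnSn _).
have : x (lo + N).+1 <= x i by apply: x_le.
lra.
Qed.

Lemma cluster_start : (S 0).1 < c 0 - rho.
Proof.
by rewrite /c addn0; have : x 0 <= x lo by [apply: x_le]; move: x_start; lra.
Qed.

End cluster_of.

(** A visit at or beyond [e] lies to the right of the cluster of [j], so the first alternative of
    [half_done] for that cluster is impossible. The cluster is cut out by the last boundary up to
    [j] and the first one after it. *)
Lemma behind_complete n j e : boundary e -> (j < e)%N -> reached n e ->
  visited S n (x j, false).
Proof.
have [r0 s0 rho0 rho2 s2] := hp.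
move=> be je re.
have [lo [blo loj nlo]] := last_boundary j.
have h0 : exists e', boundary e' && (j < e')%N by exists e; rewrite be je.
case: (ex_minnP h0) => -[|hi] /andP[bhi jhi] mhi; first by nlia.
have hie : (hi.+1 <= e)%N by apply: mhi; rewrite be je.
have hiE : hi = (lo + (hi - lo))%N by nlia.
rewrite hiE in bhi mhi.
have nob e' : (lo < e' <= lo + (hi - lo))%N -> ~~ boundary e'.
  move=> h; have [e'j|je'] := leqP e' j; first by apply: nlo; nlia.
  by apply/negP => be'; have := mhi e'; rewrite be' je' => /(_ isT); nlia.
have := @half_done _ r s rho hp X S _ _ gS (@cluster_lt lo (hi - lo)%N)
  (@cluster_gap lo (hi - lo)%N blo bhi nob) (@cluster_in lo (hi - lo)%N)
  (@cluster_out lo (hi - lo)%N blo bhi) (cluster_start lo) n.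
case=> [[_ h]|h]; last first.
  by have := h (j - lo)%N ltac:(nlia); rewrite subnKC.
exfalso; have [i [b [ei /visitedP[k kn Sk]]]] := re.
have := h k kn; rewrite Sk /= -hiE leNgt x_ltE; nlia.
Qed.

Lemma behind_line n i b e : boundary e -> (i < e)%N -> reached n e ->
  S n = (x i, b) -> b = true.
Proof.
have [r0 s0 rho0 rho2 s2] := hp.
move=> be ie re Sn; case: b Sn => // Sn; case: n => [|n] in Sn re *.
  exfalso; move: x_start; rewrite Sn /=; have : x 0 <= x i by apply: x_le.
  lra.
have re' : reached n e by apply: reached_pred => //; rewrite Sn /= x_lt.
by have [_ + _] := gS n; rewrite Sn (behind_complete be ie re').
Qed.

(** A walk that comes back leaves nothing unvisited on its right up to where it has been. The two
    claims, across clusters and inside one, need each other in the induction on time: if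
    [(x j, true)] were unvisited, the induction hypothesis would place the previous point to the
    right of it, and jumping over it to the left would not be greedy. *)
Lemma between_complete n :
  (forall j e e', boundary e -> boundary e' -> (e <= j < e')%N ->
     reached n e' -> (S n).1 < x e -> visited S n (x j, true)) /\
  (forall i b j e', S n = (x i, b) -> (i < j < e')%N ->
     (forall e, (i < e <= j)%N -> ~~ boundary e) -> boundary e' ->
     reached n e' -> visited S n (x j, true)).
Proof.
have [r0 s0 rho0 rho2 s2] := hp.
elim: n => [|n [IH1 IH2]].
  split=> [j e e' _ _ _ [i [b [_ /visitedP[k]]]]|i b j e' Sn _ _ _ _].
    rewrite leqn0 => /eqP -> h; move: x_start; rewrite h /=.
    by have : x 0 <= x i by [apply: x_le]; lra.
  by move: x_start; rewrite Sn /=; have : x 0 <= x i by [apply: x_le]; lra.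
split=> [j e e' be be' /andP[ej je'] re Sle|i b j e' Sn1 /andP[ij je'] nob be' re].
- have re' : reached n e'.
    apply: reached_pred => //; apply: (lt_le_trans Sle); apply: x_le; nlia.
  rewrite visitedS; apply/orP; right; apply: contrapT => /negP nv.
  have [uL|/above_boundary[c [b [Sn ec]]]] := boolP ((S n).1 < x e).
    by case/negP: nv; apply: (IH1 j e e') => //; rewrite ej.
  have vL := below_boundary be Sle.
  have xej : x e <= x j by exact: x_le.
  have [cj|jc] := ltnP c j.
    have [k [bk kj nk]] := last_boundary j.
    have [kc|ck] := leqP k c; case/negP: nv.
      apply: (IH2 c b j e') => //; first by rewrite cj.
      by move=> e2 h; apply: nk; nlia.
    by apply: (IH1 j k e') => //; [rewrite kj|rewrite Sn /= x_ltE].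
  have xjc : x j <= x c by exact: x_le.
  have nb : sqdist r s (S n) (S n.+1) <= sqdist r s (S n) (x j, true).
    by apply: (next_min gS) => //; exact: x_in.
  move: nb vL; rewrite Sn; case: (S n.+1) => y b' /= nb vL.
  have [h1 h2] := left_exit hp (w := x c - x j) (Z := x c - y) ltac:(lra) ltac:(lra).
  case: b b' Sn nb => -[] Sn; rewrite ?sqdist_same ?sqdist_tf ?sqdist_ft => nb.
  + nra.
  + nra.
  + have e1 : (x j + s - x c) ^+ 2 = (x c - x j - s) ^+ 2 by ring.
    have e2 : (y + s - x c) ^+ 2 = (x c - y - s) ^+ 2 by ring.
    by rewrite e1 e2 in nb; lra.
  + have e1 : (x j + s - x c) ^+ 2 = (x c - x j - s) ^+ 2 by ring.
    by rewrite e1 in nb; lra.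
- have re' : reached n e'.
    apply: reached_pred => //; rewrite Sn1 /= x_ltE; nlia.
  have bE : b = true by apply: (behind_line be' _ re Sn1); nlia.
  subst b.
  rewrite visitedS; apply/orP; right; apply: contrapT => /negP nv.
  have nb : sqdist r s (S n) (S n.+1) <= sqdist r s (S n) (x j, true).
    by apply: (next_min gS) => //; exact: x_in.
  have [_ un _] := gS n; rewrite Sn1 in un nb.
  have [lo [blo loi nlo]] := last_boundary i.
  have [uL|/above_boundary[c [b [Sn loc]]]] := boolP ((S n).1 < x lo).
    by case/negP: un; apply: (IH1 i lo e') => //; nlia.
  have [cj|jc|cj] := ltngtP c j.
  + case/negP: nv; apply: (IH2 c b j e') => //; first by rewrite cj.
    move=> e h; have [ei|ie] := leqP e i; [apply: nlo|apply: nob]; nlia.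
  + have xij : x i < x j by exact: x_lt.
    have xjc : x j < x c by exact: x_lt.
    rewrite Sn in nb; case: b Sn nb => Sn; rewrite ?sqdist_same ?sqdist_ft => nb.
      nra.
    have [ce'|ec'] := ltnP c e'.
      by have := behind_line be' ce' re' Sn.
    have : x e' <= x c by exact: x_le.
    have := boundary_lt be' je'; nra.
  + subst c; have bE : b = true by apply: (behind_line be' _ re' Sn).
    by case/negP: nv; rewrite -bE -Sn visited_self.
Qed.

End sequence.

(** * Cut points of a walk that escapes to the right *)

Section cut.
Variables (R : realType) (r s rho : R).
Hypothesis hp : shift_params r s rho.
Variables (X : set R) (S : nat -> R * bool) (x : nat -> R).
Hypothesis gS : greedy r s X S.
Hypothesis x_lt : forall i j, (i < j)%N -> x i < x j.
Hypothesis x_in : forall i, X (x i).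
Hypothesis x_out : forall y, X y -> y < x 0 - rho \/ exists i, y = x i.
Hypothesis x_start : (S 0).1 < x 0 - rho.
Hypothesis x_tie : forall i, x i.+1 - x i != rho.
Hypothesis x_boundary : forall i, exists2 e, (i < e)%N & boundary rho x e.
Hypothesis S_cvg : forall M, exists n0, forall n, (n0 <= n)%N -> M < (S n).1.

Let cases := index_cases gS x_out x_start.

(** From a cut on, the walk is the greedy walk on [[x i, +oo[] started at its leftmost point,
    whatever happened before. *)
Definition cut_at i T b :=
  [/\ S T = (x i, b),
      forall n, (T <= n)%N -> exists j b', S n = (x j, b') /\ (i <= j)%N &
      forall n, (n < T)%N -> (S n).1 < x i].

Lemma fresh_entry n i j b : position s (S n) < x i ->
  ~~ visited S n (x i, b) -> S n.+1 = (x j, b) -> (i <= j)%N -> j = i.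
Proof.
have [r0 s0 rho0 rho2 s2] := hp.
move=> pn ni Sn1 ij; apply/eqP; rewrite eqn_leq ij andbT leqNgt; apply/negP.
move=> /x_lt ij'.
have := next_min gS (v := (x i, b)) (x_in i) ni.
rewrite Sn1 /sqdist; move: pn; set p := position s (S n) => pn.
rewrite lerD2r /position /=; case: b {ni Sn1}; nra.
Qed.

Lemma cut_of_full n i :
  (forall m, (n < m)%N -> exists j b, S m = (x j, b)) ->
  (forall j b, (j < i)%N -> visited S n (x j, b)) ->
  (forall j b, (i <= j)%N -> ~~ visited S n (x j, b)) ->
  position s (S n) < x i -> exists T b, cut_at i T b.
Proof.
have [r0 s0 rho0 rho2 s2] := hp.
move=> ind full fresh pn; have [j [b Sn1]] := ind n.+1 (ltnSn _).
have ij : (i <= j)%N.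
  rewrite leqNgt; apply/negP => /(full _ b) v.
  by have [_ + _] := gS n; rewrite Sn1 v.
have ji := fresh_entry pn (fresh i b (leqnn _)) Sn1 ij; subst j.
exists n.+1, b; split => // [m nm|m mn].
  have [j [b' Sm]] := ind m nm; exists j, b'; split => //.
  rewrite leqNgt; apply/negP => /(full _ b') v.
  case: m Sm nm => // m Sm nm; have [_ + _] := gS m.
  by rewrite Sm (visited_le (nm : (n <= m)%N) v).
case: (cases m) => [h|[k [b' Sm]]].
  by have : x 0 <= x i by [apply: (x_le x_lt)]; lra.
rewrite Sm /= (x_ltE x_lt) ltnNge; apply/negP => /(fresh k b')/negP; apply.
by apply/visitedP; exists m.
Qed.

(** Let [t] be the last time left of all the [x i], and consider the cluster of the farthest point
    visited so far. All earlier clusters are complete, and in this one the state is [stO]. If both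
    lines are equally advanced, or nothing is left, the next step is a cut. Otherwise the walk
    sweeps the rest without a hole, and the cut is at the next cluster. *)
Lemma exists_cut : exists i T b, cut_at i T b.
Proof.
have [r0 s0 rho0 rho2 s2] := hp.
have [t tL tR] : exists2 t, (S t).1 < x 0 - rho &
    forall m, (t < m)%N -> exists j b, S m = (x j, b).
  have [n0 n0P] := S_cvg (x 0).
  have h0 : exists n, `[< (S n).1 < x 0 - rho >] by exists 0%N; apply/asboolP.
  have hb n : `[< (S n).1 < x 0 - rho >] -> (n <= n0)%N.
    move=> /asboolP h; rewrite leqNgt; apply/negP => n0n.
    by have := n0P n (ltnW n0n); lra.
  case: (ex_maxnP h0 hb) => t /asboolP tL tm; exists t => // m tm'.
  case: (cases m) => // h; have := tm m; rewrite asboolE => /(_ h); nlia.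
have ptL : position s (S t) < x 0.
  by rewrite /position; case: ifP => _; lra.
have [re|nre] := pselect (reached S x t 0); last first.
  exists 0%N; apply: (cut_of_full tR) => // j b _.
  by apply/negP => v; apply: nre; exists j, b.
have [f [[bf vf] fm]] : exists f, (exists b, visited S t (x f, b)) /\
    forall j b, visited S t (x j, b) -> (j <= f)%N.
  have [n0 n0P] : exists n0, forall k, (k <= t)%N -> (S k).1 <= x n0.
    elim: (t) => [|m [n0 n0P]].
      exists 0%N => k; rewrite leqn0 => /eqP ->; move: x_start; lra.
    case: (cases m.+1) => [h|[j [b Sm]]].
      exists n0 => k; rewrite leq_eqVlt => /predU1P[->|]; last exact: n0P.
      by have : x 0 <= x n0 by [apply: (x_le x_lt)]; lra.
    exists (maxn n0 j) => k; rewrite leq_eqVlt => /predU1P[->|km].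
      by rewrite Sm /=; apply: (x_le x_lt); rewrite leq_maxr.
    apply: (le_trans (n0P k km)); apply: (x_le x_lt); exact: leq_maxl.
  have h0 : exists f, `[< exists b, visited S t (x f, b) >].
    by case: re => i [b [_ v]]; exists i; apply/asboolP; exists b.
  have bnd j b : visited S t (x j, b) -> (j <= n0)%N.
    move=> /visitedP[k kt Sk]; have := n0P k kt; rewrite Sk /=.
    by rewrite leNgt (x_ltE x_lt) -leqNgt.
  have hb f : `[< exists b, visited S t (x f, b) >] -> (f <= n0)%N.
    by move=> /asboolP[b /bnd].
  case: (ex_maxnP h0 hb) => f /asboolP vf fm; exists f; split => // j b v.
  by apply: fm; apply/asboolP; exists b.
have [lo [blo lof nlo]] := last_boundary rho x f.
have hi0 : exists e, boundary rho x e && (f < e)%N.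
  by have [e fe be] := x_boundary f; exists e; rewrite be fe.
case: (ex_minnP hi0) => -[|hi] /andP[bhi fhi] mhi; first by nlia.
have [N hiE] : exists N, hi = (lo + N)%N by exists (hi - lo)%N; nlia.
subst hi.
have nob e : (lo < e <= lo + N)%N -> ~~ boundary rho x e.
  move=> h; have [ef|fe] := leqP e f; first by apply: nlo; nlia.
  by apply/negP => be; have := mhi e; rewrite be fe => /(_ isT); nlia.
have b0 : boundary rho x 0 by rewrite /boundary eqxx.
have relo : reached S x t lo by exists f, bf.
have full_lo j b : (j < lo)%N -> visited S t (x j, b).
  move=> jlo; case: b.
    have [h _] := between_complete hp gS x_lt x_in x_out x_start x_tie t.
    by apply: (h j 0%N lo) => //; lra.
  exact: (behind_complete hp gS x_lt x_in x_out x_start x_tie blo jlo relo).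
have fresh_hi j b : (lo + N < j)%N -> ~~ visited S t (x j, b).
  by move=> hj; apply/negP => /fm; nlia.
pose c i := x (lo + i).
have c0 : c 0 = x lo by rewrite /c addn0.
have xlo : x 0 <= x lo by apply: (x_le x_lt).
have c_lt := @cluster_lt R x x_lt lo N : forall i j, (i < j <= N)%N -> c i < c j.
have c_gap := cluster_gap x_tie blo bhi nob : forall i, (i < N)%N -> c i.+1 - c i < rho.
have c_in i : (i <= N)%N -> X (c i) by move=> _; exact: x_in.
have c_out := cluster_out hp x_lt x_out blo bhi :
  forall y, X y -> y < c 0 - rho \/ (exists2 j, (j <= N)%N & y = c j) \/ c N + rho < y.
have c_start : (S 0).1 < c 0 - rho by rewrite c0; move: x_start; lra.
have curN k : (k <= t)%N -> (S k).1 <= c N.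
  move=> kt; case: (cases k) => [h|[j [b Sk]]].
    have : x 0 <= c N by apply: (x_le x_lt).
    lra.
  rewrite Sk /=; apply: (x_le x_lt); apply: leq_trans (_ : f <= _)%N; last by nlia.
  by apply: (fm j b); apply/visitedP; exists k.
have xhi : x (lo + N) < x (lo + N).+1 - rho by apply: (boundary_lt x_lt bhi).
have in_split j : (j < (lo + N).+1)%N -> (j < lo)%N \/ exists2 k, (k <= N)%N & x j = c k.
  move=> h; have [?|?] := ltnP j lo; [by left|right].
  by exists (j - lo)%N; [nlia|rewrite /c subnKC].
have cutfull n k : (t <= n)%N -> stD rho S c N k k n -> 
    (forall j b, (lo + N < j)%N -> ~~ visited S n (x j, b)) ->
    (S n).1 <= c N -> exists i T b, cut_at i T b.
  move=> tn [fa tr _ _] fresh cn; exists (lo + N).+1; apply: (@cut_of_full n).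
  - by move=> m nm; apply: tR; nlia.
  - move=> j b /in_split[jlo|[k' kN ->]].
      exact: (visited_le tn (full_lo j b jlo)).
    by case: b; rewrite ?fa ?tr//; nlia.
  - by move=> j b h; apply: fresh.
  - by move: cn; rewrite /c /position; case: ifP => _; lra.
have notleft n : (t < n)%N -> ~ (S n).1 < c 0 - rho.
  case: n => // n tn h; have [j [b Sn]] := tR n.+1 tn.
  have jlo : (j < lo)%N.
    by rewrite -(x_ltE x_lt); move: h; rewrite Sn c0 /=; lra.
  have [_ + _] := gS n; rewrite Sn => /negP; apply.
  by apply: (visited_le _ (full_lo j b jlo)); nlia.
have noin k b : (k <= N)%N -> S t <> (c k, b).
  move=> kN h; have : x 0 <= c k by apply: (x_le x_lt).
  by move: tL; rewrite h /=; lra.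
have [inc|[i0 [k h]]] := front_state hp gS c_lt c_gap c_in c_out c_start curN; last first.
  have [i0k|ki0] := ltnP i0 k.
    by case: h => _ _ _ /(_ i0k)[_ [j jN [|[]]]] /noin; case; nlia.
  apply: (cutfull t k) => //; last exact: curN.
  by case: (h) => _ _ h1 _; move: h; have -> : i0 = k by nlia.
have [i [m hO]] : exists i m, stO r rho S c N i m t.
  case: inc => [//|[i0 [i [_ _ h /noin]]]|
        [i0 [k [m [i [_ _ /and5P[h1 h2 h3 h4 h5] _ [/noin|/noin]]]]]]|
        [[i0 [k [m [i [_ _ /and5P[h1 h2 h3 h4 h5] _ /noin]]]]]|
         [i0 [k [l [i [_ _ /and4P[h1 h2 h3 h4] _ /noin]]]]]]]; case; nlia.
have [mN|Nm] := leqP m N; last first.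
  apply: (cutfull t 0%N) => //; last exact: curN.
  exact: stO_full hO Nm.
have [mi|mi] := ltnP m i; last first.
  have [fa tr /andP[mi' iN] _ _] := hO.
  exists (lo + i)%N; apply: (cut_of_full tR).
  - move=> j b jlt; have [jlo|lj] := ltnP j lo; first exact: full_lo.
    have -> : x j = c (j - lo)%N by rewrite /c subnKC.
    by case: b; rewrite ?fa ?tr//; nlia.
  - move=> j b jge; have [jhi|hij] := leqP j (lo + N); last exact: fresh_hi.
    have -> : x j = c (j - lo)%N by rewrite /c subnKC//; nlia.
    by case: b; rewrite ?fa ?tr//; nlia.
  - apply: (lt_le_trans ptL); exact: (x_le x_lt).
(* A further [stO] would mean a position on the left after time [t], or a step to a visited point.
   So the sweep begins, with [i0 = k]: it has no hole behind it. *)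
have P1 : (exists m', stSwR rho S c N m m m' i t.+1) \/
    (exists l, stSw0 rho S c N m m l i t.+1) \/ exists k, stD rho S c N k k t.+1.
  have [h'|[h' _]|h'|[_ _ h']] := stO_step hp gS c_lt c_in c_out hO mN.
  - exfalso; have [_ tr _ _ _] := hO; have [_ _ h1 _ [h2|[k km Sk]]] := h'.
      exact: (notleft t.+1 (ltnSn t) h2).
    have [_ + _] := gS t; rewrite Sk tr ?km//; nlia.
  - by nlia.
  - by left; exists m.
  - by right; right; exists N.
(* [T.+1] will be the first time beyond the cluster. Since sweeps cannot jump out of it, the cluster
   is complete at time [T]. *)
have [T0 T0P] := S_cvg (c N).
have h0 : exists n, (t < n)%N && `[< c N < (S n).1 >].
  exists (maxn T0 t.+1); rewrite leq_maxr; apply/asboolP/T0P; exact: leq_maxl.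
case: (ex_minnP h0) => -[|T] /andP[tT /asboolP ST] Tm; first by nlia.
have Tmin n : (t < n)%N -> (n <= T)%N -> (S n).1 <= c N.
  move=> tn nT; rewrite leNgt; apply/negP => h; have := Tm n.
  by rewrite tn (asboolT h) => /(_ isT); nlia.
have tT' : (t < T)%N.
  rewrite ltn_neqAle -ltnS tT andbT; apply/eqP => tE; subst T.
  case: P1 => [[m' [_ _ /and5P[_ _ h _ _] _ Sn]]|[[l [_ _ /and4P[_ _ _ h] _ Sn]]|[k h]]].
  - have : c m' <= c N by apply: (c_le c_lt); nlia.
    by move: ST; rewrite Sn /=; lra.
  - have : c l <= c N by apply: (c_le c_lt); nlia.
    by move: ST; rewrite Sn /=; lra.
  - have [h'|[h' _]|h'|[_ _ h']] := stO_step hp gS c_lt c_in c_out hO mN.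
    + have [_ _ h1 _ [h2|[j jm Sj]]] := h'; first exact: (notleft t.+1 (ltnSn t) h2).
      by move: ST; rewrite Sj /=; have : c j <= c N by [apply: (c_le c_lt); nlia]; lra.
    + nlia.
    + have [_ _ _ _ Sj] := h'; move: ST; rewrite Sj /=.
      by have : c m <= c N by [apply: (c_le c_lt); nlia]; lra.
    + have [fa tr _ _ _] := hO; have [fa' tr' _ _] := h'.
      have := tr N (leqnn _); have := tr' N (leqnn _); rewrite ltnn leqnn /=.
      rewrite visitedS => /orP[/eqP SN|->]; last by nlia.
      by move: ST; rewrite -SN /=; lra.
have PT n : (t < n)%N -> (exists m', stSwR rho S c N m m m' i n) \/
    (exists l, stSw0 rho S c N m m l i n) \/ exists k, stD rho S c N k k n.
  elim: n => // n IH; rewrite ltnS leq_eqVlt => /predU1P[<-//|tn].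
  case: (IH tn) => [[m' h]|[[l h]|[k h]]].
  - have [[_ h']|h'|h'] := stSwR_step hp gS c_lt c_gap c_in c_out h.
    + by left; exists m'.+1.
    + by right; left; exists N.
    + by right; right; exists m.
  - have [h'|h'] := stSw0_step hp gS c_lt c_gap c_in c_out h.
    + by right; left; exists l.-1.
    + by right; right; exists m.
  - by right; right; exists k; exact: full_step.
have ST1 k b : (k <= N)%N -> S T.+1 <> (c k, b).
  move=> kN h; have : c k <= c N by apply: (c_le c_lt); nlia.
  by move: ST; rewrite h /=; lra.
have [k hk] : exists k, stD rho S c N k k T.
  case: (PT T tT') => [[m' h]|[[l h]|//]].
  - by have [j [b [jN /ST1]]] := stSwR_near hp gS c_lt c_gap c_in c_out h; case.
  - by have [j [b [jN /ST1]]] := stSw0_near hp gS c_lt c_gap c_in c_out h; case.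
apply: (cutfull T k) => //; last exact: Tmin.
move=> j b hj; apply/negP => /visitedP[k' k'T Sk'].
have [k't|tk'] := leqP k' t.
  by have /negP := fresh_hi j b hj; apply; apply/visitedP; exists k'.
by have := Tmin k' tk' k'T; rewrite Sk' /c /= leNgt (x_ltE x_lt) hj.
Qed.

End cut.

(** * Patterns that leave a point behind *)

Section paths.
Variables (R : realType) (r s : R).

(* A greedy walk inside [Z], listed backwards, that starts on line [b] from the
   leftmost point of [Z] and never looks to the right of [m]. *)
Fixpoint greedy_path (Z : set R) (m : R) (b : bool) (l : seq (R * bool)) : Prop :=
  if l isn't v :: l' then False else
  if l' isn't u :: _ then [/\ Z v.1, v.2 = b & forall y, Z y -> v.1 <= y]
  else [/\ greedy_path Z m b l', Z v.1 /\ v \notin l',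
           position s u <= m /\ sqdist r s u v < (m - position s u) ^+ 2 &
           forall w, Z w.1 -> w \notin l' -> sqdist r s u v <= sqdist r s u w].

Lemma greedy_path_cons Z m b v u l : greedy_path Z m b [:: v, u & l] =
  [/\ greedy_path Z m b (u :: l), Z v.1 /\ v \notin u :: l,
      position s u <= m /\ sqdist r s u v < (m - position s u) ^+ 2 &
      forall w, Z w.1 -> w \notin u :: l -> sqdist r s u v <= sqdist r s u w].
Proof. by []. Qed.

Definition window (o m : R) (X : set R) : set R := [set y | X y /\ o <= y < m].

(* Some greedy path inside [o, m[ gets stuck at distance at least [h], measured
   from [o], of everything that remains unvisited. *)
Definition returns (o m h : R) (b : bool) (X : set R) : Prop :=
  exists u l, [/\ greedy_path (window o m X) m b (u :: l),
    position s u - o + h <= m - position s u &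
    forall w, window o m X w.1 -> w \notin u :: l ->
      (position s u - o + h) ^+ 2 <= sqdist r s u w].

Fixpoint history (S : nat -> R * bool) (n k : nat) : seq (R * bool) :=
  if k is k'.+1 then S (n + k)%N :: history S n k' else [:: S n].

Lemma historyE (S : nat -> R * bool) n k : exists l,
  history S n k = S (n + k)%N :: l.
Proof. by case: k => [|k] /=; [rewrite addn0; exists [::]|exists (history S n k)]. Qed.

Lemma mem_history (S : nat -> R * bool) n k v : reflect
  (exists2 i, (n <= i <= n + k)%N & S i = v) (v \in history S n k).
Proof.
elim: k => [|k IH] /=.
  rewrite inE; apply: (iffP eqP) => [->|[i h <-]].
    by exists n => //; rewrite leqnn leq_addr.
  by congr S; nlia.
rewrite inE; apply: (iffP orP) => [[/eqP->|/IH[i h Si]]|[i h Si]].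
- by exists (n + k.+1)%N => //; rewrite leq_addr leqnn.
- by exists i => //; nlia.
- have [ik|ik] := eqVneq i (n + k.+1)%N; first by left; rewrite -ik Si.
  by right; apply/IH; exists i => //; nlia.
Qed.

(** As long as the walk stays in [[o, z[] and sees no further than [z], its history is a greedy path
    of the window. The step that leaves to the left ends at position at most [o - h], so nothing
    unvisited in the window was nearer than [position - o + h]. *)
Lemma restricted_walk_returns (X : set R) (S : nat -> R * bool) (o z h : R)
    (n1 n : nat) :
  greedy r s X S -> 0 <= h -> 0 <= s ->
  (n1 <= n)%N ->
  (forall y, X y -> o <= y -> (S n1).1 <= y) -> X (S n1).1 ->
  (forall v, o <= v.1 -> visited S n1 v -> v = S n1) ->
  (forall v, X v.1 -> v.1 < o -> ~~ visited S n1 v -> position s v <= o - h) ->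
  (forall k, (n1 <= k <= n)%N -> o <= (S k).1) ->
  (forall k, (n1 <= k <= n)%N -> position s (S k) <= z /\
     sqdist r s (S k) (S k.+1) < (z - position s (S k)) ^+ 2) ->
  (S n.+1).1 < o -> returns o z h (S n1).2 X.
Proof.
move=> gS h0 s0 n1n first X1 fresh left_far inside safe out.
have inZ k : (n1 <= k <= n)%N -> X (S k).1.
  move=> /andP[]; rewrite leq_eqVlt => /predU1P[<-//|].
  by case: k => // k _ _; case: (gS k).
have posge u : u.1 <= position s u :> R by rewrite /position; case: ifP => _; lra.
have inz k : (n1 <= k <= n)%N -> window o z X (S k).1.
  move=> hk; split; first exact: inZ.
  rewrite inside//=; have [ek|] := eqVneq k n.
    have [p1 p2] := safe k hk; apply: le_lt_trans (posge _) _.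
    rewrite lt_neqAle p1 andbT; apply/eqP => p3.
    move: p2; rewrite p3 subrr expr0n /= ltNge => /negP; apply.
    by rewrite /sqdist addr_ge0 ?sqr_ge0//; case: ifP => _; rewrite ?sqr_ge0.
  move=> kn; have [p1 p2] := safe k hk; apply: le_lt_trans (posge _) _.
  rewrite lt_neqAle p1 andbT; apply/eqP => p3.
  move: p2; rewrite p3 subrr expr0n /= ltNge => /negP; apply.
  by rewrite /sqdist addr_ge0 ?sqr_ge0//; case: ifP => _; rewrite ?sqr_ge0.
have memh k w : (n1 + k <= n)%N -> o <= w.1 ->
    (w \in history S n1 k) = visited S (n1 + k) w.
  move=> hk ow; apply/idP/idP => [/mem_history[i /andP[_ h1] <-]|/visitedP[i h1 Si]].
    by apply/visitedP; exists i.
  apply/mem_history; have [n1i|in1] := leqP n1 i.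
    by exists i => //; rewrite n1i.
  exists n1; first by rewrite leqnn leq_addr.
  by apply/esym/fresh => //; apply/visitedP; exists i => //; exact: ltnW.
have gp k : (n1 + k <= n)%N -> greedy_path (window o z X) z (S n1).2 (history S n1 k).
  elim: k => [|k IH] hk.
    rewrite /=; split => // [|y [Xy /andP[oy _]]]; last exact: first.
    by apply: inz; nlia.
  have {}IH := IH ltac:(nlia).
  have [l hl] := historyE S n1 k.
  have [Xn un mn] := gS (n1 + k)%N.
  have -> : history S n1 k.+1 = S (n1 + k.+1)%N :: history S n1 k by [].
  rewrite hl greedy_path_cons -hl.
  have -> : (n1 + k.+1 = (n1 + k).+1)%N by nlia.
  split => //.
  - have i1 : (n1 <= (n1 + k).+1 <= n)%N by nlia.
    by split; [exact: inz|rewrite memh ?inside//; nlia].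
  - by apply: safe; nlia.
  - move=> w [Xw /andP[ow _]]; rewrite memh//; last by nlia.
    by exact: mn.
have [l hl] := historyE S n1 (n - n1).
have en : (n1 + (n - n1) = n)%N by nlia.
have [Xn un mn] := gS n.
have [p1 p2] := safe n ltac:(nlia).
have far : (position s (S n) - o + h) ^+ 2 <= sqdist r s (S n) (S n.+1).
  have pl : position s (S n.+1) <= o - h.
    apply: left_far => //; apply: contra un => v; exact: visited_le v.
  have pn : o <= position s (S n) by apply: le_trans (posge _); apply: inside; nlia.
  rewrite /sqdist -[X in X <= _]addr0; apply: lerD.
    by rewrite -[X in _ <= X]/(_ ^+ 2); nra.
  by case: ifP => _; rewrite ?sqr_ge0.
exists (S n), l; rewrite -[in S n :: l]en -hl; split.
- by apply: gp; rewrite en.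
- have pn : o <= position s (S n) by apply: le_trans (posge _); apply: inside; nlia.
  have := le_lt_trans far p2; nra.
- move=> w [Xw /andP[ow _]]; rewrite memh ?en// => nw.
  by apply: (le_trans far); exact: mn.
Qed.

End paths.

(** The first gap, just below [rho], draws the walk along the line [false] to [c 1]. The second,
    about [s], puts [(c 1, true)] almost opposite [(c 2, false)], where the walk crosses and misses
    [(c 0, true)]. Later gaps, just above [rho], make it visit each base point on both lines before
    moving on. *)
Record pattern {R : realType} (s rho delta : R) (c : nat -> R) (K : nat) : Prop :=
  Pattern {
  pattern_01 : rho - 3 * delta <= c 1 - c 0 <= rho - delta;
  pattern_12 : s - delta <= c 2 - c 1 <= s + delta;
  pattern_gap : forall k, (2 <= k < K + 3)%N ->
    rho + delta <= c k.+1 - c k <= rho + 3 * delta }.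

Section pattern.
Variables (R : realType) (r s rho delta Gam : R).
Hypothesis hp : shift_params r s rho.
Hypothesis hd : [/\ 0 < delta, 8 * delta < s, (rho + 3 * delta) * (2 * s) < rho ^+ 2
  & rho ^+ 2 < Gam * (2 * s) /\ 4 * rho < Gam].
Variables (X : set R) (S : nat -> R * bool) (c : nat -> R) (K : nat).
Hypothesis gS : greedy r s X S.
Hypothesis pc : pattern s rho delta c K.
Hypothesis c_in : forall k, (k <= K + 3)%N -> X (c k).
Hypothesis c_out : forall y, X y ->
  [\/ y <= c 0 - Gam, exists2 k, (k <= K + 3)%N & y = c k | c (K + 3)%N < y].
Variable n0 : nat.
Hypothesis before : forall k, (k <= n0)%N -> (S k).1 <= c 0 - Gam.
Hypothesis enter : c 0 <= (S n0.+1).1.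

Lemma pattern_lt i j : (i < j <= K + 3)%N -> c i < c j.
Proof.
have [r0 s0 rho0 rho2 s2] := hp; have [d0 ds dk [G1 G2]] := hd.
have [/andP[p1 _] /andP[p2 _] p3] := pc.
suff inc k : (k < K + 3)%N -> c k < c k.+1.
  move=> /andP[ij jK]; have [d jE] : exists d, j = (i + d).+1 by exists (j - i.+1)%N; nlia.
  subst j; elim: d jK {ij} => [|d IH] jK; first by rewrite addn0; apply: inc; nlia.
  apply: (lt_trans (IH ltac:(nlia))); rewrite addnS; apply: inc; nlia.
case: k => [|[|k]] hk; [lra|lra|].
by have /andP[] := p3 k.+2 hk; lra.
Qed.

Lemma pattern_le i j : (i <= j <= K + 3)%N -> c i <= c j.
Proof.
case/andP; rewrite leq_eqVlt => /predU1P[->//|ij] jN.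
by apply/ltW/pattern_lt; rewrite ij.
Qed.

(* The points relative to [c p], where [2 <= p], sorted by location. *)
Lemma pattern_cases p y : (p < K + 3)%N -> X y ->
  [\/ y <= c 0 - Gam, exists2 k, (k <= p)%N & y = c k | c p.+1 <= y].
Proof.
move=> pK /c_out[h|[k kK ->]|h]; first by apply: Or31.
  have [kp|pk] := leqP k p; first by apply: Or32; exists k.
  by apply: Or33; apply: pattern_le; nlia.
apply: Or33; apply: le_trans (ltW h); apply: pattern_le; nlia.
Qed.

Lemma greedy_min n v : X v.1 -> ~~ visited S n v ->
  sqdist r s (S n) (S n.+1) <= sqdist r s (S n) v.
Proof. by case: (gS n) => _ _ h; exact: h. Qed.

(** Coming from [(y, true)], the line [false] is nearer as soon as [2 * s * (c 0 - y) > rho ^ 2],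
    which is the reason for the first bound on [Gam]. *)
Lemma pattern_enter : S n0.+1 = (c 0, false).
Proof.
have [r0 s0 rho0 rho2 s2] := hp; have [d0 ds dk [G1 G2]] := hd.
have un b : ~~ visited S n0 (c 0, b).
  apply/visitedP => -[k kn Sk]; have := before kn; rewrite Sk /=; lra.
have := greedy_min (v := (c 0, false)) (c_in (leq0n _)) (un false).
move: enter (before (leqnn n0)); case: (S n0) => y b; case: (S n0.+1) => y' b' /=.
move=> e l; case: b b' => -[]; rewrite ?sqdist_same ?sqdist_ft ?sqdist_tf => h.
- exfalso; nra.
- by congr pair; apply/eqP; rewrite eq_le e andbT; nra.
- exfalso; nra.
- by congr pair; apply/eqP; rewrite eq_le e andbT; nra.
Qed.

(** The line alternates with [j] because each isolated base point is left from the twin of the point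
    at which it was entered. *)
Definition on_track j n :=
  [/\ S n = (c j.+2, ~~ odd j),
      forall k b, (k <= j.+2)%N -> visited S n (c k, b) = ((k, b) != (0, true)),
      forall v, c j.+2 < v.1 -> ~~ visited S n v &
      forall k, (n0 < k <= n)%N -> c 0 <= (S k).1].

(** The five steps are [(c 0, false)], [(c 1, false)], [(c 2, false)], [(c 1, true)], [(c 2, true)].
    The last two avoid [(c 0, true)] because their lengths are about [r] and [s], whereas
    [c 1 - c 0] is almost [rho]. *)
Lemma pattern_start : on_track 0 (n0 + 5).
Proof.
have [r0 s0 rho0 rho2 s2] := hp; have [d0 ds dk [G1 G2]] := hd.
have [/andP[p1 p1'] /andP[p2 p2'] p3] := pc.
have rlt := r_lt_rho hp; have sr := s5_lt_r3 hp.
have sd : (s + delta) ^+ 2 < r ^+ 2 by nra.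
have [p4 p4'] : rho + delta <= c 3 - c 2 /\ c 3 - c 2 <= rho + 3 * delta.
  by have /andP[] := p3 2%N ltac:(nlia).
have E1 := pattern_enter.
have unv v : c 0 <= v.1 -> ~~ visited S n0 v.
  move=> h; apply/visitedP => -[k kn Sk]; have := before kn; rewrite Sk /=; lra.
have cases y : X y -> [\/ y <= c 0 - Gam, y = c 0, y = c 1 | y = c 2 \/ c 3 <= y].
  move=> /(@pattern_cases 2 y ltac:(nlia))[h|[[|[|[|//]]] _ ->]|h].
  - by apply: Or41.
  - by apply: Or42.
  - by apply: Or43.
  - by apply: Or44; left.
  - by apply: Or44; right.
have in1 : X (c 1) by apply: c_in; nlia.
have in2 : X (c 2) by apply: c_in; nlia.
have E2 : S n0.+2 = (c 1, false).
  have [Xn un _] := gS n0.+1; rewrite visitedS E1 in un.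
  have := @greedy_min n0.+1 (c 1, false) in1.
  rewrite visitedS E1 (negbTE (unv _ _)) /=; last by lra.
  rewrite orbF xpair_eqE eqxx andbT gt_eqF; last by lra.
  move=> /(_ isT); move: un Xn; case: (S n0.+2) => y [] /= un /cases h.
    rewrite sqdist_same sqdist_ft => h1; exfalso.
    case: h => [h|h|h|[h|h]]; nra.
  rewrite !sqdist_same => h1; congr pair.
  case: h => [h|h|//|[h|h]]; [nra| |nra|nra].
  by move: un; rewrite h eqxx.
have E3 : S n0.+3 = (c 2, false).
  have [Xn un _] := gS n0.+2; rewrite !visitedS E1 E2 in un.
  have := @greedy_min n0.+2 (c 2, false) in2.
  rewrite !visitedS E1 E2 (negbTE (unv _ _)) /=; last by lra.
  rewrite orbF !xpair_eqE eqxx !andbT !gt_eqF; [|lra|lra].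
  move=> /(_ isT); move: un Xn; case: (S n0.+3) => y [] /= un /cases h.
    rewrite sqdist_same sqdist_ft => h1; exfalso.
    case: h => [h|h|h|[h|h]]; nra.
  rewrite !sqdist_same => h1; congr pair.
  case: h => [h|h|h|[//|h]]; [nra| | |nra].
    by move: un; rewrite h eqxx orbT.
  by move: un; rewrite h eqxx.
have E4 : S n0.+4 = (c 1, true).
  have [Xn un _] := gS n0.+3; rewrite !visitedS E1 E2 E3 in un.
  have := @greedy_min n0.+3 (c 1, true) in1.
  rewrite !visitedS E1 E2 E3 (negbTE (unv _ _)) /=; last by lra.
  rewrite !xpair_eqE !andbF /= => /(_ isT).
  move: un Xn; case: (S n0.+4) => y [] /= un /cases h; last first.
    rewrite sqdist_same sqdist_ft => h1; exfalso.
    case: h => [h|h|h|[h|h]]; [nra| | | |nra].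
      by move: un; rewrite h eqxx !orbT.
      by move: un; rewrite h eqxx !orbT.
    by move: un; rewrite h eqxx.
  rewrite !sqdist_ft => h1; congr pair.
  case: h => [h|h|//|[h|h]]; exfalso; nra.
have E5 : S n0.+4.+1 = (c 2, true).
  have [Xn un _] := gS n0.+4; rewrite !visitedS E1 E2 E3 E4 in un.
  have := @greedy_min n0.+4 (c 2, true) in2.
  rewrite !visitedS E1 E2 E3 E4 (negbTE (unv _ _)) /=; last by lra.
  rewrite !xpair_eqE !andbF /= andbT orbF gt_eqF; last by lra.
  move=> /(_ isT); move: un Xn; case: (S n0.+4.+1) => y [] /= un /cases h; last first.
    rewrite sqdist_same sqdist_tf => h1; exfalso.
    have h2 : (c 1 - c 2) ^+ 2 <= (s + delta) ^+ 2 by nra.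
    by have := sqr_ge0 (y - c 1 - s); lra.
  rewrite !sqdist_same => h1; congr pair.
  case: h => [h|h|h|[//|h]]; [nra|nra| |nra].
  by move: un; rewrite h eqxx.
rewrite !addnS addn0; split => //.
- have unvc k b : (k <= 2)%N -> visited S n0 (c k, b) = false.
    by move=> k2; apply/negbTE/unv => /=; apply: pattern_le; nlia.
  have ne01 : (c 0 == c 1) = false by apply/lt_eqF/pattern_lt; nlia.
  have ne02 : (c 0 == c 2) = false by apply/lt_eqF/pattern_lt; nlia.
  have ne12 : (c 1 == c 2) = false by apply/lt_eqF/pattern_lt; nlia.
  clear -E1 E2 E3 E4 E5 unvc ne01 ne02 ne12.
  move=> [|[|[|//]]] [] _; rewrite !visitedS E1 E2 E3 E4 E5 unvc// !xpair_eqE;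
    by rewrite ?(eq_sym (c 1) (c 0)) ?(eq_sym (c 2) (c 0)) ?(eq_sym (c 2) (c 1))
         ?ne01 ?ne02 ?ne12 ?eqxx.
- case=> v b /= hv; rewrite !visitedS E1 E2 E3 E4 E5 !xpair_eqE.
  rewrite (negbTE (unv (v, b) _)) /=; last by lra.
  have h1 : c 1 < v by lra.
  have h0 : c 0 < v by lra.
  by rewrite (gt_eqF hv) (gt_eqF h1) (gt_eqF h0).
- move=> k hk.
  have : [\/ k = n0.+1, k = n0.+2, k = n0.+3 | k = n0.+4 \/ k = n0.+4.+1].
    have : (k = n0.+1 \/ k = n0.+2 \/ k = n0.+3 \/ k = n0.+4 \/ k = n0.+4.+1)%N.
      by nlia.
    case=> [|[|[|h]]]; [exact: Or41|exact: Or42|exact: Or43|exact: Or44].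
  by case=> [->|->|->|[->|->]]; rewrite ?E1 ?E2 ?E3 ?E4 ?E5 /=; lra.
Qed.

Lemma on_track_far j : (j < K.+1)%N -> rho + 3 * delta < c j.+2 - c 0 /\
  ((0 < j)%N -> 2 * rho - 3 * delta + s <= c j.+2 - c 0).
Proof.
have [r0 s0 rho0 rho2 s2] := hp; have [d0 ds dk [G1 G2]] := hd.
have [/andP[p1 p1'] /andP[p2 p2'] p3] := pc.
move=> jK; have h : c 2 <= c j.+2 by apply: pattern_le; nlia.
split; first by lra.
move=> j0; have h3 : c 3 <= c j.+2 by apply: pattern_le; nlia.
by have /andP[] := p3 2%N ltac:(nlia); lra.
Qed.

(** On the line [true], a gap of at most [rho + 3 * delta] is not worth crossing, since
    [(rho + 3 * delta) * (2 * s) < rho ^ 2]. The missed point stays farther than the gap because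
    [8 * delta < s]. *)
Lemma pattern_move j n : (j <= K)%N -> on_track j n ->
  S n.+1 = (c j.+3, ~~ odd j).
Proof.
have [r0 s0 rho0 rho2 s2] := hp; have [d0 ds dk [G1 G2]] := hd.
have rlt := r_lt_rho hp; have sr := s5_lt_r3 hp.
move=> jK [Sn vis unv _].
have [f1 f2] := on_track_far (ltac:(nlia) : (j < K.+1)%N).
have [_ _ p3] := pc; have /andP[g1 g2] := p3 j.+2 ltac:(nlia).
have [Xn un _] := gS n.
have nb : sqdist r s (S n) (S n.+1) <= sqdist r s (S n) (c j.+3, ~~ odd j).
  by apply: greedy_min; [apply: c_in; nlia|apply: unv => /=; lra].
move: un Xn nb; rewrite Sn; case: (S n.+1) => y b /= un.
move=> /(@pattern_cases j.+2 y ltac:(nlia)) h.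
have {h} : [\/ y <= c 0 - Gam, (y = c 0 /\ b = true) | c j.+3 <= y].
  case: h => [h|[k kj yk]|h]; [by apply: Or31| |by apply: Or33].
  apply: Or32; subst y; move: un; rewrite vis// negbK => /eqP[-> ->].
  by [].
have [j0|j0] := posnP j.
  subst j => /=; case: b {un} => -[h|[h hb]|h]; rewrite ?sqdist_same ?sqdist_tf => nb //.
  - exfalso; nra.
  - exfalso; nra.
  - by congr pair; nra.
  - exfalso; nra.
  - exfalso; nra.
have {}f2 := f2 j0.
case: (odd j) => /=; case: b {un} => -[h|[h hb]|h]; rewrite ?sqdist_same ?sqdist_tf ?sqdist_ft => nb //.
- exfalso; nra.
- exfalso; nra.
- exfalso; nra.
- exfalso; nra.
- by congr pair; nra.
- exfalso; nra.
- exfalso; nra.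
- by congr pair; nra.
- exfalso; nra.
- exfalso; nra.
Qed.

(** The twin is at distance [rho], the gaps on both sides exceed [rho], and a crossing of length at
    most [rho] shifts the base point by at most [2 * s]. *)
Lemma pattern_twin j n : (j < K)%N -> on_track j n ->
  S n.+2 = (c j.+3, odd j).
Proof.
have [r0 s0 rho0 rho2 s2] := hp; have [d0 ds dk [G1 G2]] := hd.
have rlt := r_lt_rho hp; have sr := s5_lt_r3 hp.
move=> jK tr; have Sn1 := pattern_move (ltnW jK) tr.
have [Sn vis unv _] := tr.
have [f1 f2] := on_track_far (ltac:(nlia) : (j.+1 < K.+1)%N).
have {}f2 := f2 isT.
have [_ _ p3] := pc; have /andP[g1 g2] := p3 j.+2 ltac:(nlia).
have /andP[g3 g4] := p3 j.+3 ltac:(nlia).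
have [Xn un _] := gS n.+1.
have nb : sqdist r s (S n.+1) (S n.+2) <= sqdist r s (S n.+1) (c j.+3, odd j).
  apply: greedy_min; first by apply: c_in; nlia.
  rewrite visitedS Sn1 xpair_eqE eqxx negb_or unv/=; last by lra.
  by case: (odd j).
move: un Xn nb; rewrite visitedS Sn1; case: (S n.+2) => y b /= un.
move=> /(@pattern_cases j.+3 y ltac:(nlia)) h nb.
have h0 : [\/ y <= c 0 - Gam, (y = c 0 /\ b = true), (y = c j.+3 /\ b = odd j) | c j.+4 <= y].
  case: h => [h|[k kj yk]|h]; [by apply: Or41| |by apply: Or44].
  move: kj; rewrite leq_eqVlt => /predU1P[kE|kj].
    apply: Or43; split; first by rewrite yk kE.
    by move: un; rewrite yk kE xpair_eqE eqxx; case: (b); case: (odd j).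
  apply: Or42; subst y; move: un; rewrite vis// negb_or negbK => /andP[_ /eqP[-> ->]].
  by [].
have nb' : sqdist r s (c j.+3, ~~ odd j) (y, b) <= rho ^+ 2.
  apply: (le_trans nb); case: (odd j); rewrite /= ?sqdist_ft ?sqdist_tf rho2; lra.
have [nb1 nb2] : (b = ~~ odd j -> - rho <= c j.+3 - y <= rho) /\
    (b = odd j -> if odd j then - s <= y + s - c j.+3 <= s
                 else - s <= y - c j.+3 - s <= s).
  move: nb'; case: (odd j); case: (b);
    rewrite /= ?sqdist_ft ?sqdist_tf ?sqdist_same => nb'; split=> // _;
    by [exact: (sq_within hp)|apply/andP; split; nra].
clear - h0 nb1 nb2 r0 s0 rho0 s2 d0 ds G1 G2 f1 f2 g1 g2 g3 g4.
have [bo|bo] : b = ~~ odd j \/ b = odd j by case: (b); case: (odd j); auto.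
  have /andP[n1 n2] := nb1 bo; case: h0 => [h|[h hb]|[-> ->//]|h]; exfalso; lra.
have := nb2 bo; rewrite bo; case: ifP => oj /andP[n1 n2];
  case: h0 => [h|[h hb]|[-> hb]|h]; rewrite ?hb//; exfalso; lra.
Qed.

Lemma on_track_step j n : (j < K)%N -> on_track j n -> on_track j.+1 n.+2.
Proof.
have [r0 s0 rho0 rho2 s2] := hp.
move=> jK tr; have S1 := pattern_move (ltnW jK) tr.
have S2 := pattern_twin jK tr; have [Sn vis unv ins] := tr.
have cj : c j.+2 < c j.+3 by apply: pattern_lt; nlia.
have c0j : c 0 <= c j.+3 by apply: pattern_le; nlia.
split => /=.
- by rewrite S2 negbK.
- move=> k b; rewrite leq_eqVlt => /predU1P[->|kj].
    rewrite !visitedS S1 S2 !xpair_eqE eqxx /=.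
    by case: (b); case: (odd j).
  have ne : (c k == c j.+3) = false by apply/lt_eqF/pattern_lt; nlia.
  by rewrite !visitedS S1 S2 !xpair_eqE ne /= vis.
- case=> v b /= hv; have hv' : c j.+2 < v by lra.
  by rewrite !visitedS S1 S2 !xpair_eqE (gt_eqF hv) /=; exact: unv.
- move=> k /andP[n0k]; rewrite leq_eqVlt => /predU1P[->|]; first by rewrite S2.
  rewrite ltnS leq_eqVlt => /predU1P[->|kn]; first by rewrite S1.
  by apply: ins; rewrite n0k.
Qed.

(** Five steps for the first three base points, two for each of the [K] isolated ones, and one to
    arrive at [c (K + 3)]. *)
Let n1 := (n0 + 5 + K.*2).+1.

Lemma pattern_end : [/\ S n1 = (c (K + 3)%N, ~~ odd K),
  forall v, c (K + 3)%N <= v.1 -> visited S n1 v -> v = S n1,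
  forall v, X v.1 -> v.1 < c (K + 3)%N -> ~~ visited S n1 v ->
    v = (c 0, true) \/ v.1 <= c 0 - Gam &
  forall k, (n0 < k <= n1)%N -> c 0 <= (S k).1 /\ S k <> (c 0, true)].
Proof.
have [r0 s0 rho0 rho2 s2] := hp.
have tr : on_track K (n0 + 5 + K.*2).
  suff h j : (j <= K)%N -> on_track j (n0 + 5 + j.*2) by apply: h.
  elim: j => [|j IH] jK; first by rewrite addn0; exact: pattern_start.
  have -> : (n0 + 5 + j.+1.*2 = (n0 + 5 + j.*2).+2)%N by nlia.
  by apply: on_track_step => //; apply: IH; exact: ltnW.
have S1 := pattern_move (leqnn K) tr; have [Sn vis unv ins] := tr.
rewrite -/n1 -[in c _](addn3 K) in S1.
have cK : c K.+2 < c (K + 3)%N by apply: pattern_lt; nlia.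
have c0K : c 0 < c (K + 3)%N by apply: pattern_lt; nlia.
split => //.
- move=> v hv; rewrite /n1 visitedS -/n1 => /orP[/eqP//|].
  by rewrite (negbTE (unv v _))//; lra.
- move=> [y b] /= Xy hy; rewrite /n1 visitedS -/n1 negb_or => /andP[_].
  case: (c_out Xy) => [h _|[k kK yk]|h]; [by right| |lra].
  have kK2 : (k <= K.+2)%N.
    rewrite leqNgt; apply/negP => h; have := pattern_le (i := (K + 3)%N) (j := k).
    by rewrite kK andbT -yk => /(_ ltac:(nlia)); lra.
  by rewrite yk vis// negbK => /eqP[-> ->]; left.
- move=> k /andP[n0k kn]; split.
    move: kn; rewrite /n1 leq_eqVlt -/n1 => /predU1P[->|kn]; first by rewrite S1 ltW.
    by apply: ins; rewrite n0k.
  move=> Sk; move: kn; rewrite /n1 leq_eqVlt -/n1 => /predU1P[kE|kn].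
    by move: S1; rewrite -kE Sk => -[h]; move: c0K; rewrite h ltxx.
  have := vis 0%N true isT; rewrite eqxx /= => /negP; apply.
  by apply/visitedP; exists k.
Qed.

Definition safe_step (z : R) k := position s (S k) <= z /\
  sqdist r s (S k) (S k.+1) < (z - position s (S k)) ^+ 2.

(** If a safe step left [[o, +oo[], then [restricted_walk_returns] would apply: what is unvisited
    behind [o], namely [(c 0, true)] and points before the pattern, lies at position at most
    [o - h]. *)
Lemma entered_unvisited o z h n : 0 <= h -> c 0 + s <= o - h ->
  o <= c (K + 3)%N -> c 0 < o -> (forall y, X y -> o <= y -> c (K + 3)%N <= y) ->
  ~ returns r s o z h (~~ odd K) X ->
  (forall k, (k < n)%N -> safe_step z k) -> ~~ visited S n (c 0, true).
Proof.
have [r0 s0 rho0 rho2 s2] := hp; have [d0 ds dk [G1 G2]] := hd.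
move=> h0 coh oc c0o first nret safe.
have [E fresh left_far ins] := pattern_end.
suff stay k : (n1 <= k <= n)%N -> o <= (S k).1.
  apply/visitedP => -[k kn Sk]; have [kn0|n0k] := leqP k n0.
    by have := before kn0; rewrite Sk /=; lra.
  have [kn1|n1k] := leqP k n1.
    by have [_] := ins k ltac:(nlia).
  by have := stay k ltac:(nlia); rewrite Sk /=; lra.
elim/ltn_ind: k => k IH /andP[n1k kn]; rewrite leNgt; apply/negP => out.
move: n1k; rewrite leq_eqVlt => /predU1P[kE|n1k].
  by move: out; rewrite -kE E /=; lra.
case: k => // k in IH n1k kn out *.
apply: nret; have -> : ~~ odd K = (S n1).2 by rewrite E.
have hX : X (S n1).1 by case: (gS (n0 + 5 + K.*2)).
apply: (@restricted_walk_returns _ r s X S o z h n1 k) => //.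
- exact: ltW.
- by move=> y Xy oy; rewrite E /=; apply: first.
- move=> v ov vis; apply: fresh => //; move: vis ov => /visitedP[[|i] hi <-] ov.
    by have := before (leq0n n0); lra.
  by apply: first => //; case: (gS i).
- move=> v Xv vo uv; case: (left_far v Xv _ uv); first by lra.
    by move=> ->; rewrite /position /=; lra.
  by rewrite /position; case: ifP => _; lra.
- by move=> i hi; apply: IH; nlia.
- by move=> i hi; apply: safe; nlia.
Qed.

End pattern.

(* The pattern sits in [y, y + len[, the walk that enters it from the left leaves
   the point [(c 0, true)] behind, and as far as one can see before [z] it does
   not return to it. *)
Record leaves_behind {R : realType} (r s rho delta Gam h len : R) (K : nat)
    (X : set R) (z y : R) (c : nat -> R) : Prop := LeavesBehind {
  lb_pattern : pattern s rho delta c K;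
  lb_in : forall k, (k <= K + 3)%N -> X (c k);
  lb_out : forall v, X v ->
    [\/ v < y, exists2 k, (k <= K + 3)%N & v = c k | c (K + 3)%N < v];
  lb_c0 : y + Gam <= c 0 <= y + Gam + delta;
  lb_len : y + len <= c (K + 3)%N;
  lb_first : forall v, X v -> y + len <= v -> c (K + 3)%N <= v;
  lb_returns : ~ returns r s (y + len) z h (~~ odd K) X }.

(** * The deterministic contradiction: an empty interval sends the walk back forever *)

Section bounce.
Variables (R : realType) (r s rho delta Gam h len : R) (K : nat).
Hypothesis hp : shift_params r s rho.
Hypothesis hd : [/\ 0 < delta, 8 * delta < s, (rho + 3 * delta) * (2 * s) < rho ^+ 2
  & rho ^+ 2 < Gam * (2 * s) /\ 4 * rho < Gam].
Hypothesis h0 : 0 <= h.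
Hypothesis hlen : Gam + delta + s + h <= len.
Variables (X : set R) (S : nat -> R * bool) (x : nat -> R).
Hypothesis gS : greedy r s X S.
Hypothesis S0 : S 0 = (0, false).
Hypothesis x_lt : forall i j, (i < j)%N -> x i < x j.
Hypothesis x_in : forall i, X (x i).
Hypothesis x_cov : forall y, X y -> exists i, y = x i.
Hypothesis X_ge0 : forall y, X y -> 0 <= y.
Hypothesis x_tie : forall i, x i.+1 - x i != rho.
Hypothesis S_cvg : forall M, exists n0, forall n, (n0 <= n)%N -> M < (S n).1.

Let lb := leaves_behind r s rho delta Gam h len K X.

Lemma left_behind_unvisited z y c n : 0 <= y -> lb z y c ->
  (forall k, (k < n)%N -> safe_step r s S z k) -> ~~ visited S n (c 0, true).
Proof.
have [r0 s0 rho0 rho2 s2] := hp; have [d0 ds dk [G1 G2]] := hd.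
have h1 := h0; have h2 := hlen.
move=> y0 [pc cin cout /andP[c1 c2] clen cfirst nret] safe.
have out v : X v -> [\/ v <= c 0 - Gam, exists2 k, (k <= K + 3)%N & v = c k
    | c (K + 3)%N < v].
  by move=> /cout[hv|hv|hv]; [apply: Or31; lra|exact: Or32|exact: Or33].
have [[k /andP[kn ck]]|nent] := pselect (exists k, (k <= n)%N && (c 0 <= (S k).1)).
  have ex : exists k, (k <= n)%N && (c 0 <= (S k).1) by exists k; rewrite kn.
  case: (ex_minnP ex) => -[|n0] /andP[n0n ent] nm.
    by move: ent; rewrite S0 /=; lra.
  have before i : (i <= n0)%N -> (S i).1 <= c 0 - Gam.
    move=> hi; have lt : (S i).1 < c 0.
      rewrite ltNge; apply/negP => hge; have := nm i; rewrite hge andbT => /(_ _).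
      by move=> h3; have := h3 ltac:(nlia); nlia.
    case: i hi lt => [|i] hi lt; first by rewrite S0 /=; lra.
    have [Xi _ _] := gS i; case: (out _ Xi) => [//|[j jK e]|hgt].
      have : c 0 <= c j by apply: (pattern_le hp hd pc); nlia.
      by move: lt; rewrite e; lra.
    have : c 0 <= c (K + 3)%N by apply: (pattern_le hp hd pc); nlia.
    lra.
  apply: (entered_unvisited hp hd gS pc cin out before ent h1 _ clen _ cfirst nret safe).
    lra.
  lra.
apply/visitedP => -[k kn Sk]; apply: nent; exists k; rewrite kn Sk /=.
exact: lexx.
Qed.

Lemma left_behind_boundary z y c : 0 <= y -> lb z y c ->
  exists e, x e = c 0 /\ boundary rho x e.
Proof.
have [r0 s0 rho0 rho2 s2] := hp; have [d0 ds dk [G1 G2]] := hd.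
move=> y0 [pc cin cout /andP[c1 c2] _ _ _].
have [e ce] := x_cov (cin 0%N isT); exists e; split => //.
case: e ce => [|e] ce; first by [].
rewrite /boundary /= -ce.
have elt : x e < c 0 by rewrite ce; apply: x_lt.
case: (cout _ (x_in e)) => [hv|[j jK hv]|hv]; first by lra.
  have : c 0 <= c j by apply: (pattern_le hp hd pc); nlia.
  by rewrite -hv; lra.
have : c 0 <= c (K + 3)%N by apply: (pattern_le hp hd pc); nlia.
lra.
Qed.

(** [C] is large compared with the parts of a pattern that matter for distances. The bound
    [9 * D <= 8 * z] says that [z - 9 / 8 * D] is nonnegative, so [dense] asks only for patterns
    inside the domain of the walk; below that range [root] takes over. *)
Variables (C z : R).
Hypothesis hC : 10 * (Gam + delta + s + r) <= C.
Hypothesis hz : 100 * C <= z.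
Hypothesis dense : forall D, C <= D -> 9 * D <= 8 * z ->
  exists y c, [/\ z - 9 / 8 * D <= y, y <= z - D & lb z y c].
Hypothesis gap : forall v, X v -> v < z \/ z + 8 * C <= v.
Hypothesis root : forall z', exists c, lb z' 0 c.

Let L := Gam + delta + s + r.

Lemma start_out y : X y -> y < x 0 - rho \/ exists i, y = x i.
Proof. by move=> /x_cov; right. Qed.

Lemma x0_far : x 0 = x 0 /\ (exists c, x 0 = c 0 /\ lb z 0 c).
Proof.
have [r0 s0 rho0 rho2 s2] := hp; have [d0 ds dk [G1 G2]] := hd.
split => //; have [c lc] := root z; exists c; split => //.
have [pc cin cout /andP[c1 c2] _ _ _] := lc.
have [e ce] := x_cov (cin 0%N isT).
case: (cout _ (x_in 0%N)) => [hv|[j jK hv]|hv].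
- by have := X_ge0 (x_in 0%N); lra.
- have : c 0 <= c j by apply: (pattern_le hp hd pc); nlia.
  rewrite -hv => h1; apply/eqP; rewrite eq_le h1 andbT ce.
  exact: (x_le x_lt).
- have : c 0 <= c (K + 3)%N by apply: (pattern_le hp hd pc); nlia.
  move=> h1; apply/eqP; rewrite eq_le [in X in _ && X](le_trans h1 (ltW hv)) andbT ce.
  exact: (x_le x_lt).
Qed.

Lemma start_far : (S 0).1 < x 0 - rho.
Proof.
have [r0 s0 rho0 rho2 s2] := hp; have [d0 ds dk [G1 G2]] := hd.
have [_ [c [-> [pc cin cout /andP[c1 c2] _ _ _]]]] := x0_far.
by rewrite S0 /=; lra.
Qed.

(** The first [n] steps are all safe for some large horizon, and the pattern at [0] does not release
    its point under any horizon. *)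
Lemma root_unvisited n : ~~ visited S n (x 0, true).
Proof.
have [z' hz'] : exists z', forall k, (k < n)%N -> safe_step r s S z' k.
  elim: n => [|n [z' IH]]; first by exists 0.
  set d := sqdist r s (S n) (S n.+1).
  have d0 : 0 <= d.
    by rewrite /d /sqdist addr_ge0 ?sqr_ge0//; case: ifP => _; rewrite ?sqr_ge0.
  exists (Num.max z' (position s (S n) + d + 1)) => k.
  rewrite ltnS leq_eqVlt => /predU1P[->|/IH[h1 h2]].
    have hm : position s (S n) + d + 1 <= Num.max z' (position s (S n) + d + 1).
      by rewrite le_max lexx orbT.
    move: hm; set m := Num.max _ _ => hm; split; first by lra.
    by rewrite -/d; nra.
  have hm : z' <= Num.max z' (position s (S n) + d + 1) by rewrite le_max lexx.
  by move: hm; set m := Num.max _ _ => hm; split; [lra|nra].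
have [c lc] := root z'.
have := left_behind_unvisited (lexx 0) lc hz'.
suff -> : c 0 = x 0 by [].
have [_ [c' [-> lc']]] := x0_far.
have [r0 s0 rho0 rho2 s2] := hp; have [d0 ds dk [G1 G2]] := hd.
have le c1 c2 z1 z2 : lb z1 0 c1 -> lb z2 0 c2 -> c1 0 <= c2 0.
  move=> [pc1 _ out1 /andP[a1 a2] _ _ _] [pc2 in2 _ /andP[b1 b2] _ _ _].
  case: (out1 _ (in2 0%N isT)) => [|[j jK ->]|]; first by lra.
    by apply: (pattern_le hp hd pc1); nlia.
  have : c1 0 <= c1 (K + 3)%N by apply: (pattern_le hp hd pc1); nlia.
  lra.
by apply/eqP; rewrite eq_le (le _ _ _ _ lc lc') (le _ _ _ _ lc' lc).
Qed.

Lemma sqdist_le u w B : - B <= position s u - position s w <= B ->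
  sqdist r s u w <= (B + r) ^+ 2.
Proof.
have [r0 _ _ _ _] := hp.
move=> /andP[h1 h2]; have B0 : 0 <= B by lra.
have h3 : (position s u - position s w) ^+ 2 <= B ^+ 2 by nra.
by rewrite /sqdist; case: ifP => _; nra.
Qed.

Lemma sqdist_ge u w : (position s u - position s w) ^+ 2 <= sqdist r s u w.
Proof. by rewrite /sqdist; case: ifP => _; rewrite lerDl ?sqr_ge0. Qed.

Lemma position_ge u : u.1 <= position s u <= u.1 + s.
Proof.
have [_ s0 _ _ _] := hp.
by rewrite /position; case: ifP => _; apply/andP; split; lra.
Qed.

Lemma sqr_lt (a b : R) : 0 <= a -> a < b -> a ^+ 2 < b ^+ 2.
Proof. by move=> a0 ab; rewrite ltr_sqr ?nnegrE// ltW// (le_lt_trans a0). Qed.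

(** Let [U] be the first step that looks beyond [z], and let [T.+1] be the first time past [z]. If
    the walk drops below [x e1] between them, the invariant [P] keeps it below forever, against
    [S_cvg]. If it does not, then at time [T] the point [(x e2, true)], at most about [45 / 8 * C]
    behind [z], is unvisited and nearer than the other side of the gap of width [8 * C]. *)
Lemma no_bounce : False.
Proof.
have [r0 s0 rho0 rho2 s2] := hp; have [d0 ds dk [G1 G2]] := hd.
have rlt := r_lt_rho hp.
have hC' := hC; have hz' := hz; rewrite -/L in hC'.
have h1 := h0; have h2 := hlen.
have L1 : Gam + delta + s + r = L by [].
have L0 : 0 < L by lra.
have [Gp Lp] : 0 < Gam /\ rho < Gam by split; lra.
clear h1 h2 dk G1 G2 ds rho2.
have xout := start_out; have xst := start_far.
have cases := index_cases gS xout xst.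
have full := behind_complete hp gS x_lt x_in xout xst x_tie.
have betw n := (between_complete hp gS x_lt x_in xout xst x_tie n).1.
have belowb := below_boundary gS x_lt xout xst.
have posge := position_ge.
have [T [TP Tmin]] : exists T, z <= (S T.+1).1 /\ forall n, (n <= T)%N -> (S n).1 < z.
  have [n0 n0P] := S_cvg z.
  have ex : exists n, z <= (S n).1 by exists n0; exact/ltW/n0P.
  case: (ex_minnP ex) => -[|T] TP Tm; first by move: TP; rewrite S0 /=; lra.
  exists T; split => // n nT; rewrite ltNge; apply/negP => /Tm; nlia.
have crossT : z + 8 * C <= (S T.+1).1.
  by have [Xn _ _] := gS T; case: (gap Xn) => //; lra.
have unsafeT : ~ safe_step r s S z T.
  move=> [p1 p2]; have := sqdist_ge (S T) (S T.+1).
  have /andP[q1 q2] := posge (S T.+1).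
  have : (z - position s (S T)) ^+ 2 <
    (position s (S T.+1) - position s (S T)) ^+ 2 by apply: sqr_lt; lra.
  by rewrite -(sqrrN (position s (S T.+1) - _)) opprB; lra.
have ex : exists n, `[< ~ safe_step r s S z n >] by exists T; apply/asboolP.
case: (ex_minnP ex) => U /asboolP unsafeU Um.
have UT : (U <= T)%N by apply: Um; apply/asboolP.
have safeU k : (k < U)%N -> safe_step r s S z k.
  move=> kU; apply: contrapT => /asboolP/Um; nlia.
have pick D : C <= D -> 9 * D <= 8 * z -> exists y c e,
    [/\ lb z y c, z - 9 / 8 * D <= y, y <= z - D, 0 <= y &
      [/\ x e = c 0, boundary rho x e, y + Gam <= x e & x e <= y + Gam + delta]].
  move=> D1 D2; have [y [c [y1 y2 l]]] := dense D1 D2.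
  have y0 : 0 <= y by lra.
  have [e [xe be]] := left_behind_boundary y0 l.
  by exists y, c, e; split=> //; have /andP[c1 c2] := lb_c0 l; split=> //; lra.
have [y0 [c0 [e0 [l0 y01 y02 y00 [xe0 be0 xe01 xe02]]]]] := pick C (lexx _) ltac:(lra).
have [y1 [c1 [e1 [l1 y11 y12 y10 [xe1 be1 xe11 xe12]]]]] :=
  pick (4 * C) ltac:(lra) ltac:(lra).
have [y2 [c2 [e2 [l2 y21 y22 y20 [xe2 be2 xe21 xe22]]]]] :=
  pick (5 * C) ltac:(lra) ltac:(lra).
have unvU y c e : 0 <= y -> lb z y c -> x e = c 0 -> ~~ visited S U (x e, true).
  by move=> hy l ->; exact: (left_behind_unvisited hy l).
have e2e1 : (e2 < e1)%N by rewrite -(x_ltE x_lt); lra.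
have e1e0 : (e1 < e0)%N by rewrite -(x_ltE x_lt); lra.
(* Otherwise [(x e0, false)] would be unvisited and close enough to make step [U] safe. *)
have re0 m : (U <= m)%N -> reached S x m e0.
  move=> Um'; suff [i [b [ei v]]] : reached S x U e0.
    by exists i, b; split => //; exact: visited_le v.
  apply: contrapT => nre; apply: unsafeU.
  have lt : (S U).1 < x e0.
    rewrite ltNge; apply/negP => hge; apply: nre.
    have [i [b [SU ei]]] : exists i b, S U = (x i, b) /\ (e0 <= i)%N.
      by apply: (above_boundary hp gS x_lt xout xst); rewrite -leNgt.
    by exists i, b; split => //; rewrite -SU visited_self.
  have {}lt := belowb _ _ be0 lt.
  have /andP[q1 q2] := posge (S U).
  have un : ~~ visited S U (x e0, false).
    by apply/negP => v; apply: nre; exists e0, false.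
  split; first by lra.
  have := next_min gS (x_in e0 : X (x e0, false).1) un.
  have /andP[q3 q4] := posge (x e0, false); rewrite /= in q3 q4.
  have pe : position s (x e0, false) = x e0 by rewrite /position /= addr0.
  have : sqdist r s (S U) (x e0, false) <= (x e0 - position s (S U) + r) ^+ 2.
    by apply: sqdist_le; rewrite pe; apply/andP; split; lra.
  move=> h3 h4; apply: (le_lt_trans h4); apply: (le_lt_trans h3).
  by apply: sqr_lt; lra.
(* A missed point stays unvisited as long as some boundary separates it from the walk on its
   right. *)
pose P m := (S m).1 < x e1 /\ forall y c ey e, 0 <= y -> lb z y c -> x ey = c 0 ->
   boundary rho x e -> (ey < e)%N -> x e <= (S m).1 -> ~~ visited S m (x ey, true).
have Pstep m : (U <= m)%N -> P m -> P m.+1.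
  move=> Um' [mlt Pm]; have [Xv unv minv] := gS m.
  clear crossT y21 y22 y20 xe21 xe22 y02 y00 xe02 rho0 s2 rlt.
  have rem := re0 m Um'.
  have {}mlt' := belowb _ _ be1 mlt.
  have /andP[q1 q2] := posge (S m).
  set D := z - position s (S m).
  have D1 : 3 * C <= D by rewrite /D; lra.
  (* The pattern [e3] is just behind the walk and provides the separating boundary; the missed point
     is that of [e4], one scale further. Its distance is at most [(81 / 64 - 1) * D] up to multiples
     of [L]. Without room for [e4], the point missed at [0] is near enough. *)
  have [w [Xw [nw [w1 w2]]]] : exists w, X w.1 /\ ~~ visited S m w /\
      position s (S m) - position s w <= 17 / 64 * D + 5 * L /\
      - (17 / 64 * D + 5 * L) <= position s (S m) - position s w.
    have [Dz|Dz] := lerP (9 * (9 / 8 * (D + 2 * L) + L)) (8 * z); last first.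
      exists (x 0, true); split; [exact: x_in|split; first exact: root_unvisited].
      have [_ [c [xc0 [_ _ _ /andP[a1 a2] _ _ _]]]] := x0_far.
      rewrite [position s (x 0, true)]/position /= xc0.
      have pm0 : 0 <= (S m).1.
        by case: (m) => [|m']; [rewrite S0|have [Xm _ _] := gS m'; exact: X_ge0].
      by split; rewrite /D in Dz D1 *; lra.
    have [y3 [c3 [e3 [l3 y31 y32 y30 [xe3 be3 xe31 xe32]]]]] :=
      pick (D + 2 * L) ltac:(lra) ltac:(lra).
    have [y4 [c4 [e4 [l4 y41 y42 y40 [xe4 be4 xe41 xe42]]]]] :=
      pick (9 / 8 * (D + 2 * L) + L) ltac:(lra) Dz.
    have e43 : (e4 < e3)%N by rewrite -(x_ltE x_lt); lra.
    exists (x e4, true); split; [exact: x_in|split].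
      by apply: (Pm y4 c4 e4 e3) => //; rewrite /D in y32; lra.
    by rewrite [position s (x e4, true)]/position /= /D in y31 y32 y41 y42 D1 *; lra.
  have nb := minv w Xw nw.
  have hw : sqdist r s (S m) w <= (17 / 64 * D + 5 * L + r) ^+ 2.
    by apply: sqdist_le; apply/andP; split; lra.
  have [j [b Sm]] : exists j b, S m.+1 = (x j, b).
    by have [j hj] := x_cov Xv; exists j, (S m.+1).2; rewrite -hj; case: (S m.+1).
  (* The walk has been at or beyond [e0], so a later step to the right cannot land between the
     boundary [e] and [e0]: everything there is visited. To come back up it would have to leap to
     [e0] or beyond. *)
  have notfull e : boundary rho x e -> (e <= j < e0)%N -> (S m).1 < x e -> False.
    move=> be /andP[ej je0] lt; move: unv; rewrite Sm; case: (b).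
      by rewrite (betw m j e e0)// ej.
    by rewrite (full m j e0).
  have vlt : (S m.+1).1 < x e1.
    rewrite ltNge; apply/negP; rewrite Sm /= => hj.
    have e1j : (e1 <= j)%N by rewrite leqNgt -(x_ltE x_lt) -leNgt.
    have [je0|e0j] := ltnP j e0; first by apply: (notfull e1) => //; rewrite e1j.
    have xj : x e0 <= x j by apply: (x_le x_lt).
    have := sqdist_ge (S m) (S m.+1).
    have /andP[q3 q4] := posge (S m.+1); rewrite Sm /= in q3 q4.
    have far : D - 9 / 8 * C <= position s (S m.+1) - position s (S m).
      by rewrite /D Sm; lra.
    have near : 17 / 64 * D + 5 * L + r < D - 9 / 8 * C by lra.
    have near0 : 0 <= 17 / 64 * D + 5 * L + r by lra.
    have : (17 / 64 * D + 5 * L + r) ^+ 2 <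
      (position s (S m.+1) - position s (S m)) ^+ 2 by apply: sqr_lt; lra.
    by rewrite -(sqrrN (position s (S m.+1) - _)) opprB; lra.
  split => // y c ey e yy l xey be eye xev.
  rewrite visitedS negb_or; apply/andP; split.
    apply/eqP => h3; move: xev; rewrite -h3 /= leNgt (x_ltE x_lt) eye//.
  have [ule|ult] := lerP (x e) (S m).1; first exact: (Pm y c ey e).
  exfalso; apply: (notfull e) => //.
  have -> : (e <= j)%N by rewrite leqNgt -(x_ltE x_lt) -leNgt; rewrite Sm in xev.
  by rewrite Sm /= (x_ltE x_lt) in vlt; nlia.
have deep n : (U <= n <= T)%N -> x e1 <= (S n).1.
  move=> hn; rewrite leNgt; apply/negP => lt.
  have ex2 : exists n, (U <= n)%N && ((S n).1 < x e1).
    by exists n; rewrite lt andbT; nlia.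
  case: (ex_minnP ex2) => n1 /andP[Un1 lt1] n1m.
  have Pn1 : P n1.
    split => // y c ey e yy l xey be eye xev.
    apply/visitedP => -[k kn1 Sk].
    have ee1 : (ey < e1)%N.
      by rewrite -(x_ltE x_lt); have := x_lt eye; lra.
    have [kU|Uk] := leqP k U.
      by have /negP := unvU y c ey yy l xey; apply; apply/visitedP; exists k.
    have [kE|kn] := eqVneq k n1.
      by move: xev; rewrite -kE Sk /= leNgt (x_ltE x_lt) eye.
    have := n1m k; rewrite Sk /= (x_ltE x_lt) ee1 (ltnW Uk) => /(_ isT); nlia.
  have Pall m : (n1 <= m)%N -> P m.
    elim: m => [|m IH]; first by rewrite leqn0 => /eqP <-.
    rewrite leq_eqVlt => /predU1P[<-//|h3].
    by apply: Pstep; [nlia|apply: IH; nlia].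
  have [N NP] := S_cvg (x e1).
  have [lt2 _] := Pall (maxn n1 N) (leq_maxl _ _).
  by have := NP (maxn n1 N) (leq_maxr _ _); lra.
have un2 : ~~ visited S T (x e2, true).
  apply/visitedP => -[k kT Sk]; have [kU|Uk] := leqP k U.
    by have /negP := unvU y2 c2 e2 y20 l2 xe2; apply; apply/visitedP; exists k.
  have := deep k ltac:(nlia); rewrite Sk /= leNgt (x_ltE x_lt) e2e1.
  by [].
have nb := next_min gS (x_in e2 : X (x e2, true).1) un2.
have h3 := sqdist_ge (S T) (S T.+1).
have /andP[q1 q2] := posge (S T); have /andP[q3 q4] := posge (S T.+1).
have dT := deep T ltac:(nlia).
have zT := Tmin T (leqnn _).
have h4 : sqdist r s (S T) (x e2, true) <= (position s (S T) - y2 + r) ^+ 2.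
  by apply: sqdist_le; rewrite [position s (x e2, true)]/position /=;
    apply/andP; split; lra.
have h5 : 0 <= position s (S T) - y2 + r by lra.
have h6 : position s (S T) - y2 + r < position s (S T.+1) - position s (S T) by lra.
have := sqr_lt h5 h6.
by rewrite -(sqrrN (position s (S T.+1) - _)) opprB; lra.
Qed.

End bounce.

(** * Walks on locally finite sets *)

Definition locally_finite {R : realType} (X : set R) :=
  forall a b : R, finite_set (X `&` `[a, b]).

Lemma seq_argmin {T : eqType} {R : realType} (f : T -> R) (l : seq T) (v : T) :
  v \in l -> exists2 m, m \in l & forall w, w \in l -> f m <= f w.
Proof.
elim: l v => [//|a l IH] v _.
have [->|[w wl]] : l = [::] \/ exists w, w \in l.
- by case: l {IH} => [|w l]; [left|right; exists w; rewrite mem_head].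
- by exists a; rewrite ?mem_head// => w; rewrite inE => /eqP ->.
- have [m ml mP] := IH w wl; have [am|ma] := leP (f a) (f m).
    exists a; first exact: mem_head.
    by move=> x; rewrite inE => /predU1P[->//|/mP]; apply: le_trans.
  exists m; first by rewrite inE ml orbT.
  by move=> x; rewrite inE => /predU1P[->|/mP//]; exact: ltW.
Qed.

Lemma injective_leaves {T : eqType} (S : nat -> T) (l : seq T) :
  injective S -> exists n0, forall n, (n0 <= n)%N -> S n \notin l.
Proof.
move=> inj; elim: l => [|a l [n0 IH]]; first by exists 0%N.
have [[k Sk]|nk] := pselect (exists k, S k = a).
  exists (maxn n0 k.+1) => n; rewrite geq_max => /andP[h1 h2].
  rewrite inE negb_or IH// andbT; apply/eqP; rewrite -Sk => /inj; lia.
exists n0 => n h; rewrite inE negb_or IH// andbT; apply/eqP => e.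
by apply: nk; exists n.
Qed.

Section locally_finite.
Variables (R : realType) (X : set R).
Hypothesis lf : locally_finite X.

Lemma locally_finite_seq a b : exists l : seq R,
  forall y, (y \in l) <-> (X y /\ a <= y <= b).
Proof.
have /finite_seqP[l hl] := lf a b; exists l => y; split.
  move=> yl; have : (X `&` `[a, b]) y by rewrite hl.
  by case=> Xy; rewrite /= in_itv.
by move=> [Xy ab]; have : (X `&` `[a, b]) y by [split => //=; rewrite in_itv]; rewrite hl.
Qed.

Lemma locally_finite_min (P : R -> bool) o y : (forall v, P v -> o <= v) ->
  X y -> P y -> exists m, [/\ X m, P m & forall v, X v -> P v -> m <= v].
Proof.
move=> Po Xy Py; have [l hl] := locally_finite_seq o y.
have yl : y \in [seq v <- l | P v] by rewrite mem_filter Py; apply/hl; rewrite Po//=.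
have [m + mP] := seq_argmin id yl; rewrite mem_filter => /andP[Pm /hl[Xm /andP[om my]]].
exists m; split => // v Xv Pv; have [yv|vy] := leP y v; first exact: le_trans yv.
by apply: mP; rewrite mem_filter Pv; apply/hl; rewrite Po//= ltW.
Qed.

Hypothesis unbounded : forall M, exists2 y, X y & M < y.

Lemma enumeration o : exists x : nat -> R,
  [/\ forall i j, (i < j)%N -> x i < x j, forall i, X (x i), o <= x 0%N &
      forall y, X y -> o <= y -> exists i, y = x i].
Proof.
have next t : exists m, [/\ X m, t < m & forall v, X v -> t < v -> m <= v].
  have [y Xy ty] := unbounded t.
  by apply: (@locally_finite_min (fun v => t < v) t y) => // v /ltW.
have [g gP] := choice next.
have [x0 [Xx0 ox0 x0min]] : exists m, [/\ X m, o <= m & forall v, X v -> o <= v -> m <= v].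
  have [y Xy oy] := unbounded o.
  by apply: (@locally_finite_min (fun v => o <= v) o y) => //; exact: ltW.
pose x i := iter i g x0.
have xS i : x i < x i.+1 by have [] := gP (x i).
have xlt i j : (i < j)%N -> x i < x j.
  elim: j => // j IH; rewrite ltnS leq_eqVlt => /predU1P[->//|/IH h].
  exact: lt_trans (xS j).
have Xx i : X (x i) by case: i => [//|i]; have [] := gP (x i).
exists x; split => // y Xy oy; apply: contrapT => ny.
have lt i : x i < y.
  elim: i => [|i IH].
    rewrite lt_neqAle x0min// andbT; apply/eqP => e; apply: ny; by exists 0%N.
  rewrite lt_neqAle; have [_ _ ->//] := gP (x i); rewrite andbT.
  by apply/eqP => e; apply: ny; exists i.+1.
have inj : injective x.
  by move=> i j e; case: (ltngtP i j) => // /xlt; rewrite e ltxx.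
have [l hl] := locally_finite_seq o y.
have [n0 n0P] := injective_leaves l inj.
have := n0P n0 (leqnn _) => /negP; apply; apply/hl; split => //.
rewrite (ltW (lt _)) andbT; apply: (le_trans ox0).
case: (n0) => [|n]; first exact: lexx.
exact: (ltW (xlt 0%N n.+1 isT)).
Qed.

End locally_finite.

Section escape.
Variables (R : realType) (r s : R).
Hypothesis r0 : 0 <= r.
Hypothesis s0 : 0 <= s.
Variables (X : set R).
Hypothesis lf : locally_finite X.

Lemma sqdist_root (u v : R * bool) :
  position s u - position s v <= Num.sqrt (sqdist r s u v) /\
  position s v - position s u <= Num.sqrt (sqdist r s u v).
Proof.
have h : `|position s u - position s v| <= Num.sqrt (sqdist r s u v).
  rewrite -sqrtr_sqr ler_wsqrtr// /sqdist lerDl; case: ifP => _ //.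
  exact: sqr_ge0.
by move: h; rewrite ler_norml => /andP[h1 h2]; split; lra.
Qed.

Lemma exists_nearest u (l : seq (R * bool)) w : X w.1 -> w \notin l ->
  exists v, [/\ X v.1, v \notin l &
    forall v', X v'.1 -> v' \notin l -> sqdist r s u v <= sqdist r s u v'].
Proof.
have s0' := s0.
move=> Xw wl; set B := Num.sqrt (sqdist r s u w).
have [ly hy] := locally_finite_seq lf (position s u - B - s) (position s u + B + s).
pose cand := [seq v <- [seq (y, true) | y <- ly] ++ [seq (y, false) | y <- ly] | v \notin l].
have candP v : (v \in cand) = (v \notin l) && (v.1 \in ly).
  rewrite mem_filter mem_cat; congr (_ && _); case: v => y b /=.
  apply/idP/idP => [/orP[/mapP[y' h [-> _]]|/mapP[y' h [-> _]]]//|h].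
  by case: b; rewrite (map_f (fun y => (y, _)) h) ?orbT.
have close v : X v.1 -> sqdist r s u v <= sqdist r s u w -> v.1 \in ly.
  move=> Xv hv; apply/hy; split => //.
  have [h1 h2] := sqdist_root u v.
  have : Num.sqrt (sqdist r s u v) <= B by rewrite ler_wsqrtr.
  have : v.1 <= position s v <= v.1 + s.
    by rewrite /position; case: ifP => _; apply/andP; split; lra.
  by move=> /andP[h3 h4] h5; apply/andP; split; lra.
have wc : w \in cand by rewrite candP wl close.
have [v vc vmin] := seq_argmin (sqdist r s u) wc.
move: vc; rewrite candP => /andP[vl /hy[Xv _]].
exists v; split => // v' Xv' v'l.
have [le|/ltW le] := leP (sqdist r s u v') (sqdist r s u w).
  by apply: vmin; rewrite candP v'l close.
exact: le_trans (vmin _ wc) le.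
Qed.

Lemma exists_greedy u0 : (forall M, exists2 y, X y & M < y) ->
  exists S, S 0%N = u0 /\ greedy r s X S.
Proof.
move=> unb.
have next (p : (R * bool) * seq (R * bool)) : exists v, [/\ X v.1, v \notin p.2 &
    forall v', X v'.1 -> v' \notin p.2 -> sqdist r s p.1 v <= sqdist r s p.1 v'].
  have [w Xw wl] : exists2 w, X w.1 & w \notin p.2.
    have [M hM] : exists M, forall v, v \in p.2 -> v.1 <= M.
      elim: (p.2) => [|a l [M hM]]; first by exists 0.
      exists (Num.max a.1 M) => v; rewrite inE => /predU1P[->|/hM h].
        by rewrite le_max lexx.
      by rewrite le_max h orbT.
    have [y Xy My] := unb M; exists (y, true) => //.
    by apply/negP => /hM /=; rewrite leNgt My.
  exact: (exists_nearest p.1 Xw wl).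
have [g gP] := choice next.
pose H n := iter n (fun p => (g p, g p :: p.2)) (u0, [:: u0]).
pose S n := (H n).1.
have HS n v : visited S n v = (v \in (H n).2).
  elim: n => [|n IH]; first by rewrite /visited /= inE.
  by rewrite visitedS IH /= inE.
exists S; split => // n.
have [h1 h2 h3] := gP (H n); split => //; first by rewrite HS.
by move=> v Xv; rewrite HS; exact: h3.
Qed.

Variable S : nat -> R * bool.
Hypothesis gS : greedy r s X S.

Lemma greedy_inj : injective S.
Proof.
suff h i j : (i < j)%N -> S i <> S j.
  by move=> i j e; case: (ltngtP i j) => // /h; rewrite e.
case: j => // j ij e; have [_ /negP + _] := gS j; apply.
by apply/visitedP; exists i.
Qed.

Lemma greedy_leaves M : exists n0, forall n, (n0 <= n)%N -> M < `|(S n).1|.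
Proof.
have [l hl] := locally_finite_seq lf (- M) M.
have [n0 n0P] := injective_leaves ([seq (y, true) | y <- l] ++ [seq (y, false) | y <- l])
  greedy_inj.
exists (maxn n0 1) => n; rewrite geq_max => /andP[/n0P + n1].
case: n n1 => // n _; have [Xn _ _] := gS n.
apply: contraNT; rewrite -leNgt ler_norml => hM.
rewrite mem_cat; have : (S n.+1).1 \in l by apply/hl.
case: (S n.+1) => y [] /= yl; first by rewrite (map_f (fun y => (y, _)) yl).
by rewrite (map_f (fun y => (y, false)) yl) orbT.
Qed.

(** A step is never longer than the distance to the missed point plus [r]. Once the base point is
    beyond [M0] in absolute value, such a step cannot reach the other side, so its sign is
    eventually constant. *)
Lemma escape_or p : X p.1 -> (forall n, S n <> p) ->
  (forall M, exists n0, forall n, (n0 <= n)%N -> M < (S n).1) \/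
  (forall M, exists n0, forall n, (n0 <= n)%N -> (S n).1 < M).
Proof.
have r0' := r0; have s0' := s0.
move=> Xp np; have unp n : ~~ visited S n p by apply/visitedP => -[k _ /np].
set M0 := `|p.1| + 3 * s + r.
have [n0 n0P] := greedy_leaves M0.
have pM : - `|p.1| <= p.1 <= `|p.1|.
  by rewrite -ler_norml.
have step n : (n0 <= n)%N -> sqdist r s (S n) (S n.+1) <=
    (`|position s (S n) - position s p| + r) ^+ 2.
  move=> _; have [_ _ /(_ p Xp (unp n)) h] := gS n; apply: (le_trans h).
  rewrite /sqdist -(real_normK (num_real (position s (S n) - _))).
  have := normr_ge0 (position s (S n) - position s p).
  by set a := `|_|; case: ifP => _ a0; nra.
have pos v : v.1 <= position s v <= v.1 + s.
  by rewrite /position; case: ifP => _; apply/andP; split; lra.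
have keep n : (n0 <= n)%N -> (0 < (S n).1) = (0 < (S n.+1).1).
  move=> hn; have h1 := n0P n hn; have h2 := n0P n.+1 (leqW hn).
  have h3 := step n hn.
  have h4 : (position s (S n) - position s (S n.+1)) ^+ 2 <= sqdist r s (S n) (S n.+1).
    by rewrite /sqdist; case: ifP => _; rewrite lerDl ?sqr_ge0.
  have /andP[q1 q2] := pos (S n); have /andP[q3 q4] := pos (S n.+1).
  have /andP[q5 q6] := pos p; have /andP[p1 p2] := pM.
  have h5 := le_trans h4 h3; move: h1 h2 h5; rewrite /M0.
  have : `|position s (S n) - position s p| + r >= 0 by rewrite addr_ge0.
  have key (a b : R) : 0 <= b -> (a ^+ 2 <= b ^+ 2) -> a <= b /\ - a <= b.
    by move=> b0 ab; split; nra.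
  move=> h6 h1 h2 /(key _ _ h6)[h7 h8].
  apply/idP/idP => h9.
    rewrite ltNge; apply/negP => h10.
    rewrite (gtr0_norm h9) in h1; rewrite (ler0_norm h10) in h2.
    by rewrite ger0_norm in h7 h8; lra.
  rewrite ltNge; apply/negP => h10.
  rewrite (gtr0_norm h9) in h2; rewrite (ler0_norm h10) in h1.
  by rewrite ler0_norm in h7 h8; lra.
have sgn n : (n0 <= n)%N -> (0 < (S n).1) = (0 < (S n0).1).
  elim: n => [|n IH]; first by rewrite leqn0 => /eqP ->.
  by rewrite leq_eqVlt => /predU1P[->//|h]; rewrite -keep// IH.
have [pp|pn] := boolP (0 < (S n0).1).
  left => M; have [n1 n1P] := greedy_leaves M; exists (maxn n0 n1) => n.
  rewrite geq_max => /andP[h1 h2]; have := n1P n h2; rewrite gtr0_norm//.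
  by rewrite sgn.
right => M; have [n1 n1P] := greedy_leaves (- M); exists (maxn n0 n1) => n.
rewrite geq_max => /andP[h1 h2]; have := n1P n h2; rewrite ler0_norm; first by lra.
by rewrite leNgt sgn.
Qed.

End escape.

Definition no_tie {R : realType} (r s : R) (X : set R) :=
  forall u v w, X u.1 -> X v.1 -> X w.1 -> v <> w -> u <> v -> u <> w ->
  sqdist r s u v <> sqdist r s u w.

(** * From a cut to the failure of [returns] *)

Section no_return.
Variables (R : realType) (r s rho : R).
Hypothesis hp : shift_params r s rho.
Variables (X : set R) (S : nat -> R * bool).
Hypothesis gS : greedy r s X S.
Hypothesis nt : no_tie r s X.
Variables (T : nat) (q h : R).
Hypothesis XT : X (S T).1.
Hypothesis first : forall y, X y -> q <= y -> (S T).1 <= y.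
Hypothesis before : forall n, (n < T)%N -> (S n).1 < q.
Hypothesis after : forall n, (T <= n)%N -> q <= (S n).1.
Hypothesis close : forall n, (T <= n)%N -> 0 <= position s (S n) - q + h /\
  sqdist r s (S n) (S n.+1) < (position s (S n) - q + h) ^+ 2.

Lemma cut_in n : (T <= n)%N -> X (S n).1.
Proof.
by rewrite leq_eqVlt => /predU1P[<-//|]; case: n => // n _; case: (gS n).
Qed.

Lemma history_visited k v : q <= v.1 ->
  (v \in history S T k) = visited S (T + k) v.
Proof.
move=> qv; apply/idP/idP => [/mem_history[i /andP[_ h1] <-]|/visitedP[i h1 Si]].
  by apply/visitedP; exists i.
apply/mem_history; exists i => //; rewrite h1 andbT leqNgt; apply/negP => /before.
by rewrite Si; lra.
Qed.

Lemma near_lt m n : position s (S n) <= m ->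
  sqdist r s (S n) (S n.+1) < (m - position s (S n)) ^+ 2 -> (S n.+1).1 < m.
Proof.
have [r0 s0 rho0 rho2 s2] := hp.
move=> pm hlt; rewrite ltNge; apply/negP => hm.
have : m <= position s (S n.+1) by rewrite /position; case: ifP => _; lra.
have : (position s (S n) - position s (S n.+1)) ^+ 2 <= sqdist r s (S n) (S n.+1).
  by rewrite /sqdist; case: ifP => _; rewrite lerDl ?sqr_ge0.
nra.
Qed.

(** Without ties a greedy path is forced, and its condition on the horizon makes the walk unable to
    prefer a point outside the window. *)
Lemma path_history m l : greedy_path r s (window q m X) m (S T).2 l ->
  exists k, l = history S T k.
Proof.
elim: l => [//|v [|u l] IH].
  move=> [[Xv /andP[qv vm]] v2 vmin]; exists 0%N; congr (_ :: _).
  have h1 := first Xv qv.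
  have h2 : v.1 <= (S T).1.
    apply: vmin; split => //; rewrite after//=.
    exact: le_lt_trans h1 vm.
  by case: v v2 h1 h2 {qv Xv vmin vm} => y b /= -> h1 h2;
    rewrite (surjective_pairing (S T)); congr pair; apply/eqP; rewrite eq_le h1 h2.
rewrite greedy_path_cons => -[/IH[k hk] [[Xv /andP[qv vm]] vn] [p1 p2] vmin].
exists k.+1; rewrite hk; congr (_ :: _).
have [l' hl] := historyE S T k; rewrite hl in hk.
have uE : u = S (T + k)%N by case: hk.
have [Xn un mn] := gS (T + k)%N.
have nv : ~~ visited S (T + k) v by rewrite -history_visited// hl -hk.
have d1 := mn v Xv nv; rewrite -uE in d1.
have qn : q <= (S (T + k)%N.+1).1 by apply: after; lia.
have xm : (S (T + k)%N.+1).1 < m.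
  by apply: near_lt; rewrite -uE //; exact: le_lt_trans p2.
have d2 : sqdist r s u v <= sqdist r s u (S (T + k)%N.+1).
  apply: vmin; first by split => //; rewrite qn.
  by rewrite hk -hl history_visited.
rewrite addnS; apply: contrapT => ne; apply: (@nt u v (S (T + k)%N.+1)) => //.
- by rewrite uE; apply: cut_in; nlia.
- by move=> e; move: nv; rewrite -e uE visited_self.
- by move=> e; move: un; rewrite -e uE visited_self.
- by apply/eqP; rewrite eq_le d2.
Qed.

(** A stuck path is the history of the walk up to some time, but the next step of the walk stays at
    or right of [q] and is shorter than [position - q + h]. *)
Lemma cut_no_return m : ~ returns r s q m h (S T).2 X.
Proof.
move=> [u [l [gp hm far]]]; have [k hk] := path_history gp.
have [l' hl] := historyE S T k.
have uE : u = S (T + k)%N by move: hk; rewrite hl => -[].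
have [h1 h2] := close (n := (T + k)%N) ltac:(lia).
have [Xn un _] := gS (T + k)%N.
have qn : q <= (S (T + k)%N.+1).1 by apply: after; lia.
have h3 : sqdist r s (S (T + k)%N) (S (T + k)%N.+1) < (m - position s (S (T + k)%N)) ^+ 2.
  by apply: (lt_le_trans h2); rewrite -uE in h1 *; rewrite ler_sqr ?nnegrE; lra.
have := far (S (T + k)%N.+1); rewrite hk history_visited// uE => hfar.
suff : (position s (S (T + k)%N) - q + h) ^+ 2 <= sqdist r s (S (T + k)%N) (S (T + k)%N.+1) by lra.
apply: hfar => //; split => //; rewrite qn /=; apply: near_lt => //.
by rewrite uE in hm; lra.
Qed.

End no_return.

Lemma no_tie_gap {R : realType} (r s rho : R) (X : set R) y y' :
  shift_params r s rho -> no_tie r s X -> X y -> X y' -> y' - y != rho.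
Proof.
move=> [r0 s0 rho0 rho2 s2] nt Xy Xy'; apply/eqP => h.
apply: (nt (y, false) (y', false) (y, true)) => //=.
- by move=> []; lra.
- by rewrite sqdist_same sqdist_ft; have -> : y' = y + rho by [lra]; nra.
Qed.

(** The missed point bounds every step of the walk, which is the origin of [h]. A first empty
    interval of length [2 * rho] separates the start and [p] from the sequence [x]; the later ones
    provide boundaries beyond every index. *)
Lemma escape_no_return {R : realType} (r s rho : R) (X : set R) S p :
  shift_params r s rho -> locally_finite X -> no_tie r s X ->
  (forall M, exists2 y, X y & M < y) ->
  (forall M, exists2 a, M < a & forall y, X y -> ~ (a <= y < a + 2 * rho)) ->
  greedy r s X S -> X p.1 -> (forall n, S n <> p) ->
  (forall M, exists n0, forall n, (n0 <= n)%N -> M < (S n).1) ->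
  exists (q : rat) (h : nat) (b : bool),
    forall m, ~ returns r s (ratr q) m h%:R b X.
Proof.
move=> hp lf nt unb gaps gS Xp np S_cvg; have [r0 s0 rho0 rho2 s2] := hp.
have [a aM agap] := gaps (`|(S 0).1| + `|p.1|).
have [x [x_lt x_in ax x_cov]] := enumeration lf unb a.
have ax0 : a + 2 * rho <= x 0%N.
  by rewrite leNgt; apply/negP => lt; apply: (agap _ (x_in 0%N)); rewrite ax.
have out y : X y -> y < x 0%N - rho \/ exists i, y = x i.
  by move=> Xy; have [/(x_cov _ Xy)|lt] := leP a y; [right|left; lra].
have [S0a pa] : (S 0).1 < a /\ p.1 < a.
  have := ler_norm (S 0).1; have := ler_norm p.1.
  by have := normr_ge0 (S 0).1; have := normr_ge0 p.1; split; lra.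
have start : (S 0).1 < x 0%N - rho by lra.
have tie i : x i.+1 - x i != rho by exact: no_tie_gap hp nt (x_in _) (x_in _).
have bnd i : exists2 e, (i < e)%N & boundary rho x e.
  have [a' a'M gap'] := gaps (x i).
  have [y Xy a'y] := unb a'.
  have [j yj] := x_cov y Xy ltac:(have : x 0%N <= x i by [apply: (x_le x_lt)]; lra).
  have ex : exists e, a' <= x e by exists j; rewrite -yj ltW.
  case: (ex_minnP ex) => -[|e] ae em.
    by have : x 0%N <= x i by [apply: (x_le x_lt)]; lra.
  exists e.+1; first by rewrite -(x_ltE x_lt); lra.
  have xe : x e < a' by rewrite ltNge; apply/negP => /em; nlia.
  rewrite /boundary /=; have : a' + 2 * rho <= x e.+1; last by lra.
  by rewrite leNgt; apply/negP => lt; apply: (gap' _ (x_in e.+1)); rewrite ae.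
have [i [T [b [ST Safter Sbefore]]]] :=
  exists_cut hp gS x_lt x_in out start tie bnd S_cvg.
(* No base point lies strictly between [lo] and the cut, so a rational in between serves as [q], and
   only countably many events have to be excluded. *)
pose lo := if i is i'.+1 then x i' else x 0%N - rho.
have loi : lo < x i by rewrite /lo; case: (i) => [|i']; [lra|exact: x_lt].
have lolt y : y < x 0%N - rho -> y < lo.
  rewrite /lo; case: (i) => [//|i'] h; have : x 0%N <= x i' by apply: (x_le x_lt).
  lra.
have lole j : (j < i)%N -> x j <= lo.
  by rewrite /lo; case: (i) => [//|i'] h; apply: (x_le x_lt).
have [q /itvP hq] := rat_in_itvoo loi.
have [loq qi] : lo < ratr q /\ ratr q < x i by split; rewrite hq.
have [h hh] : exists h : nat, `|ratr q - p.1| + r < h%:R.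
  by exists (Num.bound (`|ratr q - p.1| + r)); apply: archi_boundP; rewrite addr_ge0// ltW.
have hq' := ler_norm (ratr q - p.1).
exists q, h, b => m; have -> : b = (S T).2 by rewrite ST.
have after n : (T <= n)%N -> ratr q <= (S n).1.
  move=> /Safter[j [b' [-> ij]]] /=; have : x i <= x j by apply: (x_le x_lt).
  lra.
apply: (@cut_no_return _ r s rho hp X S gS nt T (ratr q) h%:R).
- by rewrite ST; exact: x_in.
- move=> y Xy qy; rewrite ST /=; case: (out y Xy) => [/lolt|[j yj]]; first by lra.
  rewrite yj; apply: (x_le x_lt); rewrite leqNgt; apply/negP => /lole.
  by rewrite -yj; lra.
- move=> n /Sbefore; case: (index_cases gS out start n) => [/lolt h1 _|[j [b' ->]] /=].
    by lra.
  by rewrite (x_ltE x_lt) => /lole; lra.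
- exact: after.
- move=> n Tn; have qn := after n Tn; have [_ _ nb] := gS n.
  have [h1 h2] : (S n).1 <= position s (S n) /\ p.1 <= position s p <= p.1 + s.
    by rewrite /position; case: ifP => _; case: ifP => _; split;
      try (apply/andP; split); lra.
  have /andP[h3 h4] := h2.
  split; first by have := normr_ge0 (ratr q - p.1); lra.
  apply: (le_lt_trans (nb p Xp _)); first by apply/visitedP => -[k _ /np].
  have h5 : x 0%N <= x i by apply: (x_le x_lt).
  have h6 : position s p < position s (S n).
    have [j [b' [Sj ij]]] := Safter n Tn; move: h1; rewrite Sj /=.
    have : x i <= x j by apply: (x_le x_lt).
    lra.
  have h7 : (position s (S n) - position s p) ^+ 2 <= (position s (S n) - p.1) ^+ 2 by nra.
  have h8 : sqdist r s (S n) p <= (position s (S n) - p.1 + r) ^+ 2.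
    by rewrite /sqdist; case: ifP => _; nra.
  by apply: (le_lt_trans h8); rewrite ltr_sqr ?nnegrE; lra.
Qed.

(** * Random configurations *)

Section real_probability.
Context {d : measure_display} {T : measurableType d} {R : realType}
  (P : probability T R).

Definition pr (A : set T) : R := fine (P A).

Lemma prE A : measurable A -> P A = (pr A)%:E.
Proof. by move=> mA; rewrite /pr fineK// fin_num_measure. Qed.

Lemma pr_ge0 A : 0 <= pr A.
Proof. by rewrite /pr fine_ge0. Qed.

Lemma pr_le A B : measurable A -> measurable B -> A `<=` B -> pr A <= pr B.
Proof.
by move=> mA mB AB; rewrite -lee_fin -!prE//; apply: le_measure; rewrite ?inE.
Qed.

Lemma pr_setT : pr setT = 1.
Proof. by rewrite /pr probability_setT. Qed.

Lemma pr_set0 : pr set0 = 0.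
Proof. by rewrite /pr measure0. Qed.

Lemma pr_le1 A : measurable A -> pr A <= 1.
Proof. by move=> mA; rewrite -pr_setT; apply: pr_le. Qed.

Lemma pr_disjoint A B : measurable A -> measurable B -> A `&` B = set0 ->
  pr (A `|` B) = pr A + pr B.
Proof.
move=> mA mB AB; apply: EFin_inj; rewrite EFinD -!prE//; last exact: measurableU.
by rewrite measureU.
Qed.

Lemma pr_split A B : measurable A -> measurable B ->
  pr A = pr (A `&` B) + pr (A `\` B).
Proof.
move=> mA mB; rewrite -pr_disjoint.
- by rewrite setUIDK.
- exact: measurableI.
- exact: measurableD.
- by apply/seteqP; split => // x [[_ ?] []].
Qed.

Lemma pr_setC A : measurable A -> pr (~` A) = 1 - pr A.
Proof.
move=> mA; have := pr_split measurableT mA; rewrite pr_setT setTI setTD; lra.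
Qed.

Lemma pr_U A B : measurable A -> measurable B -> pr (A `|` B) <= pr A + pr B.
Proof.
move=> mA mB; have mAB := measurableU _ _ mA mB.
have mI : measurable ((A `|` B) `&` A) by exact: measurableI.
have mD : measurable ((A `|` B) `\` A) by exact: measurableD.
by rewrite (pr_split mAB mA) lerD//; apply: pr_le => // x [] // [].
Qed.

Lemma pr_bigU n (A : nat -> set T) : (forall i, measurable (A i)) ->
  pr (\bigcup_(i < n) A i) <= \sum_(i < n) pr (A i).
Proof.
move=> mA; elim: n => [|n IH].
  by rewrite big_ord0 -pr_set0; apply: pr_le => //; [exact: bigcup_measurable|move=> x []].
rewrite big_ord_recr /=; apply: le_trans (lerD IH (lexx _)).
apply: le_trans (pr_U _ _) => //; last exact: bigcup_measurable.
apply: pr_le; [exact: bigcup_measurable|apply: measurableU => //; exact: bigcup_measurable|].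
move=> x [i /= ni Ax]; have [ein|ne] := eqVneq i n; first by right; rewrite -ein.
by left; exists i => //=; lia.
Qed.

Lemma pr_decreasing (F : nat -> set T) (e : R) : (forall i, measurable (F i)) ->
  (forall m n, (m <= n)%N -> F n `<=` F m) -> 0 < e ->
  exists n, pr (F n) < pr (\bigcap_i F i) + e.
Proof.
move=> mF dF e0; have mI : measurable (\bigcap_i F i) by exact: bigcapT_measurable.
have : (P \o F) @ \oo --> P (\bigcap_i F i).
  apply: nonincreasing_cvg_mu => //; first by rewrite -ge0_fin_numE// fin_num_measure.
  by move=> m n mn; apply/subsetPset; exact: dF.
rewrite prE// => /fine_cvgP[_] /cvgrPdist_lt /(_ e e0)[n _ /(_ n (leqnn n))].
rewrite /= -/(pr (F n)) => h; exists n.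
by have := ler_norm (pr (F n) - pr (\bigcap_i F i)); rewrite distrC; lra.
Qed.

Lemma pr_null A : measurable A -> pr A = 0 -> P.-negligible A.
Proof.
by move=> mA A0; exists A; split => //; rewrite prE// A0.
Qed.

End real_probability.

Lemma trivIset_preimage (T U : Type) (f : T -> U) (F : nat -> set U) :
  trivIset setT F -> trivIset setT (fun i => f @^-1` F i).
Proof. by move=> tF i j _ _ [x [h1 h2]]; apply: tF => //; exists (f x). Qed.

(** * The sigma-algebra of configurations generated by avoidance events *)

Section configurations.
Context {R : realType}.
Local Notation mu := (@lebesgue_measure R).

Definition void (A : set R) : set (set R) := [set X | X `&` A = set0].

(** Avoidance events are stable under intersection, so independence and equality of laws need to be
    checked on them only. *)
Definition voids : set (set (set R)) :=
  [set V | exists A, [/\ measurable A, (mu A < +oo)%E & V = void A]].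

Definition conf := g_sigma_algebraType voids.

Lemma voidU A B : void A `&` void B = void (A `|` B).
Proof.
apply/seteqP; split => [X [h1 h2]|X h]; rewrite /void /= ?setIUr ?h1 ?h2 ?setU0//.
by move: h; rewrite /void /= setIUr setU_eq0.
Qed.

Lemma voids_setI : setI_closed voids.
Proof.
move=> _ _ [A [mA fA ->]] [B [mB fB ->]]; exists (A `|` B).
split; [exact: measurableU| |exact: voidU].
by apply: le_lt_trans (measureU2 _ _ _) _ => //; rewrite lte_add_pinfty.
Qed.

Lemma measurable_voids V : voids V -> measurable (V : set conf).
Proof. by move=> ?; exact: sub_gen_smallest. Qed.

Lemma conf_measurable_fun d (T : measurableType d) (f : T -> conf) :
  (forall A, measurable A -> (mu A < +oo)%E -> measurable (f @^-1` (void A))) ->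
  measurable_fun setT f.
Proof.
move=> h; apply: (@measurability _ _ T conf setT f voids) => // _ [V [A [mA fA ->]] <-].
by rewrite setTI; exact: h.
Qed.

Context {d : measure_display} {T : measurableType d} (P : probability T R).

(** The events independent of [F] are stable under complements and disjoint countable unions;
    Dynkin's theorem extends the property from the avoidance events. *)
Lemma conf_indep (f : T -> conf) (F : set T) : measurable_fun setT f ->
  measurable F ->
  (forall A, measurable A -> (mu A < +oo)%E ->
     pr P (f @^-1` (void A) `&` F) = pr P (f @^-1` (void A)) * pr P F) ->
  forall U : set conf, measurable U ->
     pr P (f @^-1` U `&` F) = pr P (f @^-1` U) * pr P F.
Proof.
move=> mf mF hv.
have mfU (U : set conf) : measurable U -> measurable (f @^-1` U).
  by move=> mU; rewrite -[X in measurable X]setTI; exact: mf.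
apply: (@dynkin_induction _ conf voids) => //.
- exact: voids_setI.
- by rewrite preimage_setT setTI pr_setT mul1r.
- by move=> V [A [mA fA ->]]; exact: hv.
- move=> U mU IH.
  have -> : f @^-1` (~` U) `&` F = F `\` (f @^-1` U).
    by apply/seteqP; split => x [].
  have := pr_split P mF (mfU _ mU); rewrite (setIC F) IH preimage_setC pr_setC; last exact: mfU.
  lra.
- move=> U mU tU IH; rewrite !preimage_bigcup.
  have mfi i : measurable (f @^-1` U i) by exact: mfU.
  have tf : trivIset setT (fun i => f @^-1` U i).
    exact: trivIset_preimage.
  apply: EFin_inj; rewrite EFinM -!prE//; last 2 first.
  + exact: bigcupT_measurable.
  + by apply: measurableI => //; exact: bigcupT_measurable.
  rewrite setI_bigcupl measure_bigcup//; last 2 first.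
  + by move=> i _; exact: measurableI.
  + exact: trivIset_setIr.
  rewrite measure_bigcup//.
  rewrite (prE P mF) muleC -nneseriesZl //.
  apply: eq_eseriesr => i _.
  have mIF : measurable (f @^-1` U i `&` F) by exact: measurableI.
  transitivity (pr P (f @^-1` U i `&` F))%:E; first exact: (prE P mIF).
  by rewrite IH mulrC EFinM -(prE P (mfi i)).
Qed.

Lemma conf_law d' (T' : measurableType d') (Q : probability T' R)
    (f : T -> conf) (g : T' -> conf) :
  measurable_fun setT f -> measurable_fun setT g ->
  (forall A, measurable A -> (mu A < +oo)%E ->
     pr P (f @^-1` (void A)) = pr Q (g @^-1` (void A))) ->
  forall U : set conf, measurable U -> pr P (f @^-1` U) = pr Q (g @^-1` U).
Proof.
move=> mf mg hv.
have mfU (U : set conf) : measurable U -> measurable (f @^-1` U).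
  by move=> mU; rewrite -[X in measurable X]setTI; exact: mf.
have mgU (U : set conf) : measurable U -> measurable (g @^-1` U).
  by move=> mU; rewrite -[X in measurable X]setTI; exact: mg.
apply: (@dynkin_induction _ conf voids) => //.
- exact: voids_setI.
- by rewrite !preimage_setT !pr_setT.
- by move=> V [A [mA fA ->]]; exact: hv.
- move=> U mU IH; have h1 := pr_setC P (mfU _ mU); have h2 := pr_setC Q (mgU _ mU).
  by rewrite -!preimage_setC h1 h2 IH.
- move=> U mU tU IH; rewrite !preimage_bigcup.
  apply: EFin_inj; rewrite -!prE//; last 2 first.
  + by apply: bigcupT_measurable => i; exact: mgU.
  + by apply: bigcupT_measurable => i; exact: mfU.
  rewrite !measure_bigcup//.
  + apply: eq_eseriesr => i _; transitivity (pr P (f @^-1` U i))%:E.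
      exact: (prE P (mfU _ (mU i))).
    by rewrite IH -(prE Q (mgU _ (mU i))).
  + by move=> i _; exact: mgU.
  + exact: trivIset_preimage.
  + by move=> i _; exact: mfU.
  + exact: trivIset_preimage.
Qed.

End configurations.
Arguments conf R : clear implicits.
Arguments void {R} A.

Section measurable_formulas.
Context {d : measure_display} {T : measurableType d} {R : realType}.
Implicit Types A B : T -> Prop.

Lemma measurable_and_set A B : measurable [set x | A x] ->
  measurable [set x | B x] -> measurable [set x | A x /\ B x].
Proof. by move=> mA mB; exact: measurableI. Qed.

Lemma measurable_not_set A : measurable [set x | A x] ->
  measurable [set x | ~ A x].
Proof. exact: measurableC. Qed.

Lemma measurable_imply_set A B : measurable [set x | A x] ->
  measurable [set x | B x] -> measurable [set x | A x -> B x].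
Proof.
move=> mA mB; rewrite (_ : mkset _ = ~` [set x | A x] `|` [set x | B x]).
  by apply: measurableU => //; exact: measurableC.
apply/seteqP; split => x /=; last by move=> [].
by move=> AB; have [/AB|] := pselect (A x); [right|left].
Qed.

Lemma measurable_exists_set (I : countType) (A : I -> T -> Prop) :
  (forall i, measurable [set x | A i x]) -> measurable [set x | exists i, A i x].
Proof.
move=> mA; rewrite (_ : mkset _ = \bigcup_i [set x | A i x]).
  by apply: countable_bigcupT_measurable => //; exact: countableP.
by apply/seteqP; split => x /= -[i]; exists i.
Qed.

Lemma measurable_forall_set (I : countType) (A : I -> T -> Prop) :
  (forall i, measurable [set x | A i x]) -> measurable [set x | forall i, A i x].
Proof.
move=> mA; rewrite (_ : mkset _ = ~` [set x | exists i, ~ A i x]).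
  apply: measurableC; apply: measurable_exists_set => i.
  exact: measurable_not_set.
apply/seteqP; split => x /= h; first by move=> [i]; apply.
by move=> i; apply: contrapT => n; apply: h; exists i.
Qed.

Lemma measurable_bool_set (f : T -> bool) : measurable_fun setT f ->
  measurable [set x | f x].
Proof.
by move=> mf; rewrite -[X in measurable X]setTI; apply: (mf _ [set true]).
Qed.

Lemma measurable_ltr_set (f g : T -> R) : measurable_fun setT f ->
  measurable_fun setT g -> measurable [set x | f x < g x].
Proof. by move=> mf mg; apply: measurable_bool_set; exact: measurable_fun_ltr. Qed.

Lemma measurable_ler_set (f g : T -> R) : measurable_fun setT f ->
  measurable_fun setT g -> measurable [set x | f x <= g x].
Proof. by move=> mf mg; apply: measurable_bool_set; exact: measurable_fun_ler. Qed.

Lemma measurable_const_set (b : Prop) : measurable [set x : T | b].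
Proof.
have [h|h] := pselect b.
  by rewrite (_ : mkset _ = setT)//; apply/seteqP; split.
by rewrite (_ : mkset _ = set0)//; apply/seteqP; split.
Qed.

End measurable_formulas.

(** * Measurable access to the points of a configuration *)

Section first_point.
Context {R : realType}.

(** [m] is the default value when no point lies in [[q, m[]. With [q] rational, these countably many
    measurable functions enumerate all the points below [m] of a locally finite set. *)
Definition first_point (m q : R) (X : set R) : R :=
  inf ([set y | X y /\ q <= y] `|` [set m]).

Lemma first_point_has_inf (m q : R) (X : set R) : has_inf ([set y | X y /\ q <= y] `|` [set m]).
Proof.
split; first by exists m; right.
have [qm mm] : Num.min q m <= q /\ Num.min q m <= m by rewrite !ge_min !lexx orbT.
by exists (Num.min q m); move=> y [[_ qy]|->//]; exact: le_trans qy.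
Qed.

Lemma first_point_lt m q X t : first_point m q X < t <->
  m < t \/ exists y, [/\ X y, q <= y & y < t].
Proof.
have hi := first_point_has_inf m q X; split.
  move=> /(inf_lt hi.1)[y [[Xy qy]|->] yt]; last by left.
  by right; exists y.
move=> [mt|[y [Xy qy yt]]].
  by apply: le_lt_trans mt; apply: ge_inf; [case: hi|right].
by apply: le_lt_trans yt; apply: ge_inf; [case: hi|left].
Qed.

Lemma first_point_le m q X y : X y -> q <= y -> first_point m q X <= y.
Proof.
by move=> Xy qy; apply: ge_inf; [case: (first_point_has_inf m q X)|left].
Qed.

Lemma first_point_in m q X : locally_finite X -> first_point m q X < m ->
  X (first_point m q X) /\ q <= first_point m q X.
Proof.
move=> lf /first_point_lt[|[y [Xy qy ym]]]; first by rewrite ltxx.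
have [f [Xf qf fmin]] := locally_finite_min lf (P := fun v => q <= v)
  (fun v => id) Xy qy.
have fm : f < m by apply: le_lt_trans ym; exact: fmin.
suff -> : first_point m q X = f by [].
apply/eqP; rewrite eq_le first_point_le//= leNgt; apply/negP.
move=> /first_point_lt[mf|[v [Xv qv]]]; first by move: (lt_trans fm mf); rewrite ltxx.
by rewrite ltNge fmin.
Qed.

Lemma first_point_rat m X y a : locally_finite X -> X y -> y < m -> a < y ->
  exists2 q : rat, a < ratr q & first_point m (ratr q) X = y.
Proof.
move=> lf Xy ym ay.
have [l hl] := locally_finite_seq lf a y.
have [b [ab by' bl]] : exists b, [/\ a <= b, b < y & forall v, X v -> b < v -> y <= v].
  have [b] := seq_argmin (fun v => - v) (mem_head a [seq v <- l | v < y]).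
  rewrite inE mem_filter => /orP hb bmin; exists b.
  have bP : a <= b < y.
    case: hb => [/eqP ->|/andP[h /hl[_ /andP[h1 h2]]]]; rewrite ?lexx//.
    by rewrite h1.
  case/andP: bP => ab by'; split=> // v Xv bv; rewrite leNgt; apply/negP => vy.
  have : - b <= - v.
    apply: bmin; rewrite inE mem_filter vy; apply/orP; right; apply/hl.
    by rewrite (le_trans ab (ltW bv)) ltW.
  lra.
have [q /andP[bq qy]] := rat_in_itvoo by'.
exists q; first exact: le_lt_trans bq.
apply/eqP; rewrite eq_le first_point_le ?(ltW qy)//= leNgt; apply/negP.
move=> /first_point_lt[my|[v [Xv qv vy]]]; first by move: (lt_trans ym my); rewrite ltxx.
by have := bl v Xv (lt_le_trans bq qv); rewrite leNgt vy.
Qed.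

Lemma measurable_void (A : set R) : measurable A -> (lebesgue_measure A < +oo)%E ->
  measurable (void A : set (conf R)).
Proof. by move=> mA fA; apply: measurable_voids; exists A. Qed.

Lemma measurable_void_itv a b : measurable (void `[a, b[ : set (conf R)).
Proof.
apply: measurable_void => //.
by rewrite lebesgue_measure_itv/= ; case: ifP => _; rewrite ?ltry// -EFinB ltry.
Qed.

Lemma measurable_first_point m q :
  measurable_fun setT (first_point m q : conf R -> R).
Proof.
apply: (measurability _ (RGenInftyO.measurableE R)) => //.
move=> _ [_ [t ->] <-]; rewrite setTI.
rewrite (_ : _ @^-1` _ = [set X : conf R | m < t] `|` ~` void `[q, t[).
  apply: measurableU; first exact: measurable_const_set.
  by apply: measurableC; exact: measurable_void_itv.
apply/seteqP; split => X /=; rewrite in_itv /=.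
  move=> /first_point_lt[|[y [Xy qy yt]]]; [by left|right => e].
  have : (X `&` `[q, t[) y by split => //=; rewrite in_itv/= qy.
  by rewrite e.
move=> [mt|/eqP/set0P[y [Xy]]]; first by apply/first_point_lt; left.
by rewrite /= in_itv/= => /andP[qy yt]; apply/first_point_lt; right; exists y.
Qed.

End first_point.

Section measurable_returns.
Context {R : realType} (r s o m h : R) (b : bool).
Implicit Types (X : set R) (p : rat * bool).

Definition rat_point p X : R * bool := (first_point m (ratr p.1) X, p.2).

Definition rat_window X : set R :=
  [set y | exists q : rat, y = first_point m (ratr q) X /\ o <= y < m].

Lemma rat_windowE X : locally_finite X -> rat_window X = window o m X.
Proof.
move=> lf; apply/seteqP; split => y.
  move=> [q [-> /andP[oy ym]]]; split; last by rewrite oy.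
  by have [] := first_point_in lf ym.
move=> [Xy /andP[oy ym]]; have [q _ qy] := first_point_rat lf Xy ym (ltac:(lra) : y - 1 < y).
by exists q; rewrite qy oy.
Qed.

Lemma rat_windowP X (w : R * bool) : rat_window X w.1 <->
  exists p, w = rat_point p X /\ o <= (rat_point p X).1 < m.
Proof.
split => [[q [e om]]|[p [-> om]]]; last by exists p.1.
by exists (q, w.2); rewrite /rat_point /= -e; split => //; case: w {e om}.
Qed.

Let position_measurable p :
  measurable_fun setT (fun X : conf R => position s (rat_point p X)).
Proof.
by apply: measurable_funD => //; exact: measurable_first_point.
Qed.

Let sqdist_measurable p p' :
  measurable_fun setT (fun X : conf R => sqdist r s (rat_point p X) (rat_point p' X)).
Proof.
rewrite /sqdist; apply: measurable_funD; last by rewrite /rat_point /=; exact: measurable_cst.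
by apply: measurable_funX; apply: measurable_funB.
Qed.

Let mem_measurable p (lp : seq (rat * bool)) :
  measurable [set X : conf R | rat_point p X \notin [seq rat_point p' X | p' <- lp]].
Proof.
apply: measurable_bool_set; apply: measurable_neg.
elim: lp => [|p' lp IH] //=.
rewrite (_ : (fun _ => _) = (fun X => ((rat_point p X).1 == (rat_point p' X).1) &&
    (p.2 == p'.2) || (rat_point p X \in [seq rat_point p' X | p' <- lp]))); last first.
  by apply/funext => X; rewrite inE /rat_point xpair_eqE.
apply: measurable_or => //; apply: measurable_and => //.
by apply: measurable_fun_eqr; exact: measurable_first_point.
Qed.

Let in_measurable p : measurable [set X : conf R | o <= (rat_point p X).1 < m].
Proof.
apply: measurable_bool_set; apply: measurable_and.
  by apply: measurable_fun_ler => //; exact: measurable_first_point.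
by apply: measurable_fun_ltr => //; exact: measurable_first_point.
Qed.

Lemma forall_rat_window X (Q : R * bool -> Prop) :
  (forall w, rat_window X w.1 -> Q w) <->
  (forall p, o <= (rat_point p X).1 < m -> Q (rat_point p X)).
Proof.
split=> [Qw p om|Qp w /rat_windowP[p [-> om]]]; last exact: Qp.
by apply: Qw; apply/rat_windowP; exists p.
Qed.

Definition rat_path (lp : seq (rat * bool)) X :=
  greedy_path r s (rat_window X) m b [seq rat_point p X | p <- lp].

Lemma measurable_rat_path lp : measurable (rat_path lp : set (conf R)).
Proof.
elim: lp => [|p [|p' lp] IH].
- exact: (measurable_const_set False).
- rewrite (_ : rat_path [:: p] = [set X : conf R | (o <= (rat_point p X).1 < m /\ p.2 = b) /\
      forall q : rat * bool, o <= (rat_point q X).1 < m ->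
        (rat_point p X).1 <= (rat_point q X).1]).
    apply: measurable_and_set; first by apply: measurable_and_set => //; exact: measurable_const_set.
    apply: measurable_forall_set => q; apply: measurable_imply_set => //.
    by apply: measurable_ler_set; exact: measurable_first_point.
  apply/seteqP; split => X /=.
    move=> [[q [e1 e2]] e3 e4]; split; first by rewrite /= e2.
    by move=> q' om; apply: e4; exists q'.1.
  move=> [[om pb] hq]; split => //; first by exists p.1.
  by move=> y [q [-> om']]; exact: (hq (q, false)).
- rewrite (_ : rat_path [:: p, p' & lp] = [set X : conf R | rat_path (p' :: lp) X /\
      ((o <= (rat_point p X).1 < m /\
        rat_point p X \notin [seq rat_point q X | q <- p' :: lp]) /\
      ((position s (rat_point p' X) <= m /\
        sqdist r s (rat_point p' X) (rat_point p X) <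
           (m - position s (rat_point p' X)) ^+ 2) /\
      forall q : rat * bool, o <= (rat_point q X).1 < m ->
        rat_point q X \notin [seq rat_point q X | q <- p' :: lp] ->
        sqdist r s (rat_point p' X) (rat_point p X) <=
        sqdist r s (rat_point p' X) (rat_point q X)))]).
    apply: measurable_and_set => //; apply: measurable_and_set.
      by apply: measurable_and_set.
    apply: measurable_and_set.
      apply: measurable_and_set; first exact: measurable_ler_set.
      apply: measurable_ltr_set => //; apply: measurable_funX.
      exact: measurable_funB.
    apply: measurable_forall_set => q; apply: measurable_imply_set => //.
    by apply: measurable_imply_set => //; exact: measurable_ler_set.
  apply/seteqP; split => X.
    move=> [e1 [e2 e3] e4 /forall_rat_window e5]; split => //; split; last by split.
    split => //; case: e2 => q [+ om]; rewrite /= => e2; exact: om.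
  move=> [e1 [[e2 e3] [e4 e5]]]; split => //; last exact/forall_rat_window.
  by split => //; exists p.1.
Qed.

(** [returns] ranges over paths of real points. Here the points of the path are named by rationals,
    which turns the quantifiers into countable ones; both versions agree on locally finite sets. *)
Definition returns_event : set (conf R) := [set X | exists pl : (rat * bool) * seq (rat * bool),
  rat_path (pl.1 :: pl.2) X /\
  (position s (rat_point pl.1 X) - o + h <= m - position s (rat_point pl.1 X) /\
   forall q : rat * bool, o <= (rat_point q X).1 < m ->
     rat_point q X \notin [seq rat_point p X | p <- pl.1 :: pl.2] ->
     (position s (rat_point pl.1 X) - o + h) ^+ 2 <=
     sqdist r s (rat_point pl.1 X) (rat_point q X))].

Lemma measurable_returns_event : measurable returns_event.
Proof.
apply: measurable_exists_set => -[p l]; apply: measurable_and_set.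
  exact: measurable_rat_path.
apply: measurable_and_set.
  apply: measurable_ler_set; last exact: measurable_funB.
  by apply: measurable_funD => //; exact: measurable_funB.
apply: measurable_forall_set => q; do 2 apply: measurable_imply_set => //.
apply: measurable_ler_set => //; apply: measurable_funX; apply: measurable_funD => //.
exact: measurable_funB.
Qed.

Lemma greedy_path_in Z v l : greedy_path r s Z m b l -> v \in l -> Z v.1.
Proof.
elim: l => [//|a [|a' l] IH].
  by move=> [Za _ _]; rewrite inE => /eqP ->.
rewrite greedy_path_cons => -[gp [Za _] _ _]; rewrite inE => /predU1P[-> //|].
exact: IH.
Qed.

Lemma returns_eventE X : locally_finite X ->
  returns_event X <-> returns r s o m h b X.
Proof.
move=> lf; have ew := rat_windowE lf; split.
  move=> [[p l] [gp [hm hw]]].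
  exists (rat_point p X), [seq rat_point p X | p <- l]; rewrite -ew.
  by split => // w /rat_windowP[q [-> om]]; exact: hw.
move=> [u [l [gp hm hw]]]; rewrite -ew in gp hw.
have [lp e] : exists lp, u :: l = [seq rat_point p X | p <- lp].
  have := fun v => @greedy_path_in _ v _ gp.
  elim: (u :: l) => [|a k IH] hk; first by exists [::].
  have hk' v : v \in k -> rat_window X v.1 by move=> vk; apply: hk; rewrite inE vk orbT.
  have [lp ->] := IH hk'.
  have [p [-> _]] := (rat_windowP X a).1 (hk a (mem_head _ _)).
  by exists (p :: lp).
case: lp e => [//|p lp] /= [eu el]; exists (p, lp).
rewrite eu el in gp hw; rewrite eu in hm; do 2 split => //.
by move=> q om; apply: hw; apply/rat_windowP; exists q.
Qed.

End measurable_returns.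

Section returns_facts.
Context {R : realType} (r s : R).
Implicit Types X : set R.

Lemma returns_window o m h b X Y : window o m X = window o m Y ->
  returns r s o m h b X -> returns r s o m h b Y.
Proof. by move=> e [u [l H]]; exists u, l; rewrite -e. Qed.

(** Apart from the window, the origin enters only through [position - o + h], so [h] compensates for
    moving it across an empty stretch. *)
Lemma returns_origin o o' m h b X : window o m X = window o' m X ->
  returns r s o' m (h + (o' - o)) b X -> returns r s o m h b X.
Proof.
move=> e [u [l [H1 H2 H3]]]; exists u, l; rewrite e.
have <- : position s u - o' + (h + (o' - o)) = position s u - o + h by ring.
by [].
Qed.

Let far (o m m' : R) X (u w : R * bool) : 0 <= s -> m <= m' -> position s u <= m ->
  window o m' X w.1 -> window o m X w.1 \/
    (m - position s u) ^+ 2 <= sqdist r s u w.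
Proof.
move=> s0 mm um [Xw /andP[ow wm']]; have [wm|mw] := ltP w.1 m.
  by left; rewrite /window /= ow wm.
right; rewrite /sqdist -[X in X <= _]addr0 lerD //; last by case: ifP; rewrite ?sqr_ge0.
have : m <= position s w by rewrite /position; case: ifP => _; lra.
by move=> mw'; rewrite -[leRHS]sqrrN opprB ler_sqr ?nnegrE; lra.
Qed.

Lemma greedy_path_le o m m' b X l : 0 <= s -> m <= m' ->
  greedy_path r s (window o m X) m b l -> greedy_path r s (window o m' X) m' b l.
Proof.
move=> s0 mm; have sub y : window o m X y -> window o m' X y.
  by move=> [Xy /andP[oy ym]]; split => //; rewrite oy (lt_le_trans ym mm).
elim: l => [//|v [|u l] IH].
  move=> [Zv vb hv]; split => //; first exact: sub.
  move=> y [Xy /andP[oy _]]; have [ym|] := ltP y m; first by apply: hv; rewrite /window /= oy.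
  by apply: le_trans; case: Zv => _ /andP[_ /ltW].
rewrite !greedy_path_cons => -[gp [Zv vl] [um dm] hv]; split; first exact: IH.
- by split => //; exact: sub.
- split; first exact: le_trans mm.
  by apply: lt_le_trans dm _; rewrite ler_sqr ?nnegrE; lra.
- move=> w /(far s0 mm um)[Zw wl|h _]; first exact: hv.
  exact: le_trans (ltW dm) h.
Qed.

(** Points that appear beyond the old horizon are farther than anything the path has looked at, and
    farther than the distance at which it got stuck. *)
Lemma returns_le o m m' h b X : 0 <= s -> 0 <= h -> m <= m' ->
  returns r s o m h b X -> returns r s o m' h b X.
Proof.
move=> s0 h0 mm [u [l [gp hm hw]]]; exists u, l; split.
- exact: greedy_path_le gp.
- lra.
have [Xu /andP[ou um]] := greedy_path_in gp (mem_head u l).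
have pu : o <= position s u by rewrite /position; case: ifP => _; lra.
have pm : position s u <= m by lra.
move=> w /(far s0 mm pm)[Zw wl|h' _]; first exact: hw.
by apply: le_trans h'; rewrite ler_sqr ?nnegrE; lra.
Qed.

Definition shift (a : R) X : set R := [set x | X (x + a)].

Let move_point (a : R) (u : R * bool) : R * bool := (u.1 - a, u.2).

Let move_inj a : injective (move_point a).
Proof. by move=> [x b] [x' b'] [/subIr -> ->]. Qed.

Let sqdist_move a u v : sqdist r s (move_point a u) (move_point a v) = sqdist r s u v.
Proof. by rewrite /sqdist /position /=; congr (_ ^+ 2 + _); ring. Qed.

Let position_move a u : position s (move_point a u) = position s u - a.
Proof. by rewrite /position /=; ring. Qed.

Let window_move a o m X (w : R * bool) : window (o - a) (m - a) (shift a X) w.1 ->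
  exists2 v, w = move_point a v & window o m X v.1.
Proof.
move=> [Xw /andP[ow wm]]; exists (w.1 + a, w.2).
  by case: w {Xw ow wm} => x b; rewrite /move_point /= addrK.
by split => //=; rewrite -lerBlDr ow -ltrBrDr.
Qed.

Let move_window a o m X y : window o m X y -> window (o - a) (m - a) (shift a X) (y - a).
Proof.
by move=> [Xy /andP[oy ym]]; split; rewrite /shift /= ?subrK// lerD2r oy ltrD2r.
Qed.

Let greedy_path_shift a o m b X l : greedy_path r s (window o m X) m b l ->
  greedy_path r s (window (o - a) (m - a) (shift a X)) (m - a) b (map (move_point a) l).
Proof.
elim: l => [//|v [|u l] IH].
  move=> [Zv vb hv]; split => //; first exact: move_window.
  move=> y Zy; have [[x c] /= [-> _] /hv] := @window_move a o m X (y, b) Zy.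
  by rewrite lerD2r.
rewrite greedy_path_cons => -[gp [Zv vl] [um dm] hv].
rewrite [map _ _]/= greedy_path_cons; split; first exact: IH.
- split; first exact: move_window.
  by rewrite -[_ :: _]/(map (move_point a) (u :: l)) mem_map.
- by rewrite position_move sqdist_move opprB addrA subrK lerD2r.
- move=> w /window_move[v' -> Zv'].
  rewrite -[_ :: _]/(map (move_point a) (u :: l)) mem_map// !sqdist_move.
  exact: hv.
Qed.

Lemma returns_shift a o m h b X : returns r s o m h b X ->
  returns r s (o - a) (m - a) h b (shift a X).
Proof.
move=> [u [l [gp hm hw]]]; exists (move_point a u), (map (move_point a) l); split.
- exact: (greedy_path_shift a gp).
- by rewrite position_move; lra.
- move=> w /window_move[v' -> Zv'].
  rewrite -[_ :: _]/(map (move_point a) (u :: l)) mem_map// sqdist_move position_move.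
  by move=> vl; have := hw v' Zv' vl; congr (_ ^+ 2 <= _); ring.
Qed.

Lemma shiftK a X : shift (- a) (shift a X) = X.
Proof. by apply/seteqP; split => x; rewrite /shift /= subrK. Qed.

Lemma shift_add a a' X : shift a (shift a' X) = shift (a + a') X.
Proof. by apply/seteqP; split => x; rewrite /shift /= addrA. Qed.

Lemma shift_returns a o m h b X : returns r s (o - a) (m - a) h b (shift a X) ->
  returns r s o m h b X.
Proof. by move=> /(returns_shift (- a)); rewrite shiftK !opprK !subrK. Qed.

End returns_facts.

Section translations.
Context {R : realType}.
Local Notation mu := (@lebesgue_measure R).

Lemma measurable_translate (a : R) (A : set R) : measurable A ->
  measurable ((fun x => x + a) @^-1` A).
Proof.
move=> mA; rewrite -[X in measurable X]setTI.
suff mf : measurable_fun [set: R] (fun x : R => x + a) by exact: mf.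
exact: measurable_funD.
Qed.

Lemma lebesgue_translate (a : R) (A : set R) : measurable A ->
  mu ((fun x => x + a) @^-1` A) = mu A.
Proof.
move=> mA; have mf : @measurable_fun _ _ (measurableTypeR R) (measurableTypeR R) setT
    (fun x => x + a).
  exact: measurable_funD.
pose f : {mfun measurableTypeR R >-> measurableTypeR R} :=
  HB.pack (fun x : measurableTypeR R => x + a) (@isMeasurableFun.Build _ _ (measurableTypeR R) (measurableTypeR R) _ mf).
rewrite -[LHS]/(pushforward mu f A).
apply/esym/lebesgue_measure_unique => //= _ [[b c]] _ <-.
rewrite /pushforward (_ : _ @^-1` _ = [set` `](b - a), (c - a)]]); last first.
  by apply/seteqP; split => x /=; rewrite !in_itv/= ltrBlDr lerBrDr.
by rewrite !lebesgue_measure_itv/= !lte_fin ltrD2r -!EFinB opprB addrA subrK.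
Qed.

End translations.

Section restriction.
Context {R : realType}.
Local Notation mu := (@lebesgue_measure R).

Definition restrict (B X : set R) : set R := X `&` B.

Lemma restrict_void B A : restrict B @^-1` void A = void (B `&` A).
Proof. by apply/seteqP; split => X; rewrite /void /restrict /= setIA. Qed.

Lemma measurable_restrict B : measurable B ->
  measurable_fun setT (restrict B : conf R -> conf R).
Proof.
move=> mB; apply: conf_measurable_fun => A mA fA; rewrite restrict_void.
apply: measurable_void; first exact: measurableI.
apply: le_lt_trans fA; apply: le_measure; rewrite ?inE//; exact: measurableI.
Qed.

Lemma shift_void (a : R) A : shift a @^-1` void A = void ((fun x => x + - a) @^-1` A).
Proof.
apply/seteqP; split => X e; apply/seteqP; split => // x [Xx Ax].
  have : (shift a X `&` A) (x - a) by split => //; rewrite /shift /= subrK.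
  by rewrite e.
have : (X `&` (fun x => x + - a) @^-1` A) (x + a) by split => //=; rewrite addrK.
by rewrite e.
Qed.

Lemma measurable_shift (a : R) : measurable_fun setT (shift a : conf R -> conf R).
Proof.
apply: conf_measurable_fun => A mA fA; rewrite shift_void.
apply: measurable_void; first exact: measurable_translate.
by rewrite lebesgue_translate.
Qed.

Definition single (a b : R) : set (set R) :=
  [set X | exists x, X `&` `[a, b[ = [set x]].

(** Two points would be separated by a rational, with both sides occupied; so uniqueness means that
    each rational leaves one side empty. *)
Lemma measurable_single a b : measurable (single a b : set (conf R)).
Proof.
rewrite (_ : single a b = ~` void `[a, b[ `&` [set X : conf R | forall q : rat,
    a <= ratr q <= b -> void `[a, ratr q[ X \/ void `[ratr q, b[ X]).
  apply: measurableI; first by apply: measurableC; exact: measurable_void_itv.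
  apply: measurable_forall_set => q; apply: measurable_imply_set.
    exact: measurable_const_set.
  by apply: measurableU; exact: measurable_void_itv.
apply/seteqP; split => X /=.
  move=> [x e]; split; first by move=> e'; have : [set x] x by []; rewrite -e e'.
  move=> q /andP[aq qb]; have [xq|qx] := ltP x (ratr q); [right|left].
    apply/seteqP; split => // y [Xy]; rewrite /= in_itv/= => /andP[qy yb].
    have : (X `&` `[a, b[) y by split => //=; rewrite in_itv/= yb (le_trans aq).
    by rewrite e => /= yx; move: xq; rewrite -yx ltNge qy.
  apply/seteqP; split => // y [Xy]; rewrite /= in_itv/= => /andP[ay yq].
  have : (X `&` `[a, b[) y by split => //=; rewrite in_itv/= ay (lt_le_trans yq).
  by rewrite e => /= yx; move: qx; rewrite -yx leNgt yq.
move=> [/eqP/set0P[x [Xx xab]] h]; exists x.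
have two u v : X u -> X v -> u \in `[a, b[ -> v \in `[a, b[ -> u < v -> False.
  rewrite !in_itv/= => Xu Xv /andP[au ub] /andP[av vb] uv.
  have [q] := rat_in_itvoo uv; rewrite in_itv/= => /andP[uq qv].
  have [|/seteqP[e _]|/seteqP[e _]] := h q.
  - by rewrite (le_trans au (ltW uq)) (le_trans (ltW qv) (ltW vb)).
  - by apply: (e u); split => //=; rewrite in_itv/= au.
  - by apply: (e v); split => //=; rewrite in_itv/= vb (ltW qv).
apply/seteqP; split => [y [Xy yab]|_ ->//].
by apply/eqP; case: ltgtP => // /two h'; exfalso; apply: h'.
Qed.

End restriction.

(** * Stationarity and independence from void probabilities *)

Section void_process.
Context {d : measure_display} {T : measurableType d} {R : realType}
  (P : probability T R).
Local Notation mu := (@lebesgue_measure R).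

(** These properties survive translation and reflection of the line. Independence over disjoint sets
    is not a field because it follows from the product form of the void probabilities. *)
Record void_process (Y : T -> conf R) : Prop := VoidProcess {
  vp_finite : forall w, locally_finite (Y w);
  vp_measurable : measurable_fun setT Y;
  vp_void : forall A, measurable A -> (mu A < +oo)%E ->
    pr P (Y @^-1` void A) = expR (- fine (mu A));
  vp_single : forall a b, a < b -> 0 < pr P (Y @^-1` single a b) }.

Variable Y : T -> conf R.
Hypothesis vY : void_process Y.

Lemma vp_event (U : set (conf R)) : measurable U -> measurable (Y @^-1` U).
Proof. by move=> mU; rewrite -[X in measurable X]setTI; exact: (vp_measurable vY). Qed.

Lemma vp_void_itv a b : a <= b -> pr P (Y @^-1` void `[a, b[) = expR (a - b).
Proof.
rewrite le_eqVlt => /predU1P[->|ab]; rewrite (vp_void vY)//= lebesgue_measure_itv/= lte_fin.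
- by rewrite ltxx/= oppr0 subrr.
- by rewrite ltxx ltry.
- by rewrite ab -EFinB /= opprB.
- by rewrite ab -EFinB ltry.
Qed.

(** Two successive applications of [conf_indep] reduce both events to avoidance events; there
    [expR (- mu A)] turns a disjoint union into a product. *)
Lemma vp_indep (B C : set R) (U V : set (conf R)) : measurable B -> measurable C ->
  B `&` C = set0 -> measurable U -> measurable V ->
  pr P (Y @^-1` (restrict B @^-1` U `&` restrict C @^-1` V)) =
  pr P (Y @^-1` (restrict B @^-1` U)) * pr P (Y @^-1` (restrict C @^-1` V)).
Proof.
move=> mB mC BC mU mV.
have mr (D : set R) : measurable D -> measurable_fun setT (restrict D \o Y : T -> conf R).
  move=> mD; apply: measurableT_comp; first exact: measurable_restrict.
  exact: (vp_measurable vY).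
have mrU (D : set R) (W : set (conf R)) : measurable D -> measurable W ->
    measurable (Y @^-1` (restrict D @^-1` W)).
  move=> mD mW; apply: vp_event; rewrite -[X in measurable X]setTI.
  exact: measurable_restrict.
have fin (D A : set R) : measurable D -> measurable A -> (mu A < +oo)%E ->
    measurable (D `&` A) /\ (mu (D `&` A) < +oo)%E.
  move=> mD mA fA; have mDA : measurable (D `&` A) by exact: measurableI.
  split => //; apply: le_lt_trans fA; apply: le_measure; rewrite ?inE//.
apply: (@conf_indep _ _ _ P (restrict B \o Y)) => //; [exact: mr|exact: (mrU C V)|].
move=> A mA fA; have mV' := measurable_void mA fA; rewrite setIC [RHS]mulrC.
apply: (@conf_indep _ _ _ P (restrict C \o Y)) => //; [exact: mr|exact: (mrU B (void A))|].
move=> A' mA' fA'.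
have [m1 f1] := fin _ _ mB mA fA; have [m2 f2] := fin _ _ mC mA' fA'.
have -> : (restrict C \o Y) @^-1` void A' `&` (restrict B \o Y) @^-1` void A =
    Y @^-1` void ((C `&` A') `|` (B `&` A)).
  by rewrite -voidU -!restrict_void.
have -> : (restrict C \o Y) @^-1` void A' = Y @^-1` void (C `&` A').
  by rewrite -restrict_void.
have -> : (restrict B \o Y) @^-1` void A = Y @^-1` void (B `&` A).
  by rewrite -restrict_void.
have dj : (C `&` A') `&` (B `&` A) = set0.
  by apply/seteqP; split => // x [[Cx _] [Bx _]]; rewrite -BC.
rewrite !(vp_void vY)//; last 2 first.
- exact: measurableU.
- by rewrite measureU// lte_add_pinfty.
rewrite measureU// fineD ?ge0_fin_numE// opprD expRD//.
Qed.

Lemma vp_shift a (U : set (conf R)) : measurable U ->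
  pr P (Y @^-1` (shift a @^-1` U)) = pr P (Y @^-1` U).
Proof.
apply: (@conf_law _ _ _ P _ _ P (shift a \o Y) Y).
- by apply: measurableT_comp; [exact: measurable_shift|exact: (vp_measurable vY)].
- exact: (vp_measurable vY).
move=> A mA fA; rewrite comp_preimage shift_void !(vp_void vY)//.
- by rewrite lebesgue_translate.
- exact: measurable_translate.
- by rewrite lebesgue_translate.
Qed.

End void_process.

(** * Null sets *)

Lemma expr_small {R : realType} (x e : R) : 0 <= x < 1 -> 0 < e ->
  exists n : nat, x ^+ n <= e.
Proof.
move=> /andP[x0 x1] e0; have h : `|x| < 1 by rewrite ger0_norm.
have /cvgrPdist_lt/(_ e e0)[n _ /(_ n (leqnn n))] := cvg_expr h.
by rewrite /= sub0r normrN ger0_norm ?exprn_ge0// => /ltW; exists n.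
Qed.

Section almost_everywhere.
Context {d : measure_display} {T : measurableType d} {R : realType}
  (P : probability T R).

Lemma pr_negligible A : (forall e, 0 < e ->
  exists E, [/\ measurable E, A `<=` E & pr P E <= e]) -> P.-negligible A.
Proof.
move=> h; have /choice[E hE] : forall n : nat, exists E,
    [/\ measurable E, A `<=` E & pr P E <= n.+1%:R^-1].
  by move=> n; apply: h; rewrite invr_gt0.
have mI : measurable (\bigcap_n E n) by apply: bigcapT_measurable => n; case: (hE n).
exists (\bigcap_n E n); split => //; last by move=> x Ax n _; case: (hE n) => _ + _; apply.
suff : pr P (\bigcap_n E n) <= 0.
  by move=> p0; rewrite (prE P mI); congr EFin; apply/eqP; rewrite eq_le p0 pr_ge0.
apply/ler_addgt0Pr => e e0; rewrite add0r.
have [n ne] : exists n : nat, n.+1%:R^-1 <= e.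
  exists (Num.truncn e^-1); rewrite -[leRHS]invrK lef_pV2 ?posrE ?invr_gt0//.
  exact/ltW/truncnS_gt.
have [mE _ pE] := hE n; apply: le_trans (le_trans pE ne).
by apply: pr_le => // x; apply.
Qed.

Lemma ae_forall_count (I : countType) (Q : I -> T -> Prop) :
  (forall i, {ae P, forall w, Q i w}) -> {ae P, forall w, forall i, Q i w}.
Proof.
move=> h.
have : {ae P, forall w, forall n : nat, if unpickle n is Some i then Q i w else True}.
  apply: ae_foralln => n; case: (unpickle n) => [i|]; first exact: h.
  exact: aeW.
by apply: filterS => w hw i; have := hw (pickle i); rewrite pickleK.
Qed.

Lemma pr_sum_disjoint n (F : nat -> set T) : (forall i, measurable (F i)) ->
  (forall i j, F i `&` F j !=set0 -> i = j) ->
  \sum_(i < n) pr P (F i) = pr P (\bigcup_(i < n) F i).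
Proof.
move=> mF tF; elim: n => [|n IH].
  rewrite big_ord0; have -> : \bigcup_(i < 0) F i = set0 by apply/seteqP; split => // x [].
  by rewrite pr_set0.
rewrite big_ord_recr /= IH -pr_disjoint//; last 2 first.
- exact: bigcup_measurable.
- apply/seteqP; split => // x [[i /= ni Fi] Fn].
  by have := tF i n ltac:(by exists x); lia.
congr (pr P _); apply/seteqP; split => x.
  by move=> [[i /= ni Fi]|Fn]; [exists i => //=; lia|exists n => /=].
move=> [i /= ni Fi]; have [e|ne] := eqVneq i n; first by right; rewrite -e.
by left; exists i => //=; lia.
Qed.

End almost_everywhere.

Section null_sets.
Context {d : measure_display} {T : measurableType d} {R : realType}
  (P : probability T R) (Y : T -> conf R).
Hypothesis vY : void_process P Y.

Lemma vp_hit_le a b : a <= b -> pr P (Y @^-1` (~` void `[a, b[)) <= b - a.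
Proof.
move=> ab; rewrite -preimage_setC pr_setC; last first.
  by apply: (vp_event vY); exact: measurable_void_itv.
rewrite (vp_void_itv vY ab); have := expR_ge1Dx (a - b); lra.
Qed.

Let cell_exists (a t x : R) n : a <= x < a + n%:R * t ->
  exists2 i, (i < n)%N & a + i%:R * t <= x < a + i.+1%:R * t.
Proof.
elim: n => [|n IH] /andP[ax xn]; first by exfalso; lra.
have [xn'|nx] := ltP x (a + n%:R * t); last by exists n => //; rewrite nx.
by have [|i ni h] := IH; [rewrite ax|exists i => //; lia].
Qed.

(** The value of [f] is determined outside [[a, b[], hence independent of what lies inside. Cut the
    interval into cells of length [t <= e]: given the cell that contains the value, this cell is
    occupied with probability at most [t]. *)
Lemma vp_null_point (f : conf R -> R) a b : measurable_fun setT f -> a < b ->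
  P.-negligible [set w | Y w (f (restrict (~` `[a, b[) (Y w))) /\
                         a <= f (restrict (~` `[a, b[) (Y w)) < b].
Proof.
move=> mf ab; apply: pr_negligible => e e0.
pose n := (Num.truncn ((b - a) / e)).+1; pose t := (b - a) / n%:R.
have n0 : 0 < n%:R :> R by rewrite ltr0n.
have t0 : 0 < t by rewrite divr_gt0// subr_gt0.
have te : t <= e.
  rewrite ler_pdivrMr// mulrC -ler_pdivrMr//; exact/ltW/truncnS_gt.
have nt : a + n%:R * t = b by rewrite /t mulrC divfK ?gt_eqF//; ring.
pose cell i : set R := `[a + i%:R * t, a + i.+1%:R * t[%classic.
have cellE i x : cell i x = (a + i%:R * t <= x < a + i.+1%:R * t) :> Prop.
  by rewrite /cell /= in_itv.
pose F i := Y @^-1` (restrict (~` `[a, b[) @^-1` (f @^-1` cell i)).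
pose E i := Y @^-1` (restrict `[a, b[ @^-1` (~` void (cell i)) `&`
                     restrict (~` `[a, b[) @^-1` (f @^-1` cell i)).
have mv i : measurable (void (cell i) : set (conf R)) by exact: measurable_void_itv.
have mfc i : measurable (f @^-1` cell i).
  by rewrite -[X in measurable X]setTI; apply: mf => //; exact: measurable_itv.
have mr (D : set R) (W : set (conf R)) : measurable D -> measurable W ->
    measurable (restrict D @^-1` W : set (conf R)).
  by move=> mD mW; rewrite -[X in measurable X]setTI; exact: measurable_restrict.
have mab : measurable (`[a, b[ : set R) by exact: measurable_itv.
have mab' : measurable (~` `[a, b[ : set R) by exact: measurableC.
have mF i : measurable (F i) by apply: (vp_event vY); exact: mr.
have mE i : measurable (E i).
  apply: (vp_event vY); apply: measurableI; last exact: mr.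
  by apply: mr => //; exact: measurableC.
exists (\bigcup_(i < n) E i); split.
- exact: bigcup_measurable.
- move=> w [Yf /andP[af fb]]; have [|i ni /andP[i1 i2]] :=
      @cell_exists a t (f (restrict (~` `[a, b[) (Y w))) n.
    by rewrite af nt.
  exists i => //; split; last by rewrite /= /cell /= in_itv /= i1.
  move=> v0; have : (restrict `[a, b[ (Y w) `&` cell i) (f (restrict (~` `[a, b[) (Y w))).
    by split; [split => //=; rewrite in_itv/= af|rewrite cellE i1].
  by rewrite v0.
apply: le_trans (pr_bigU P n mE) _.
apply: (@le_trans _ _ (\sum_(i < n) t * pr P (F i))).
  apply: ler_sum => i _; rewrite (vp_indep vY mab mab') ?setICr//; last exact: measurableC.
  apply: ler_wpM2r; first exact: pr_ge0.
  rewrite -(preimage_setC (restrict `[a, b[)) restrict_void setIidr.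
    by apply: le_trans (vp_hit_le _) _; [|]; rewrite -natr1; lra.
  move=> x; rewrite cellE => /andP[x1 x2]; rewrite /= in_itv/=; apply/andP; split.
    by apply: le_trans x1; rewrite lerDl mulr_ge0// ltW.
  apply: lt_le_trans x2 _; rewrite -nt lerD2l ler_pM2r// ler_nat; exact: ltn_ord.
rewrite -mulr_sumr pr_sum_disjoint//.
  rewrite -[leRHS]mulr1; apply: ler_pM => //; [exact: ltW|exact: pr_ge0|].
  by apply: pr_le1; exact: bigcup_measurable.
move=> i j [w []]; rewrite /F /preimage /mkset !cellE => /andP[h1 h2] /andP[h3 h4].
have := le_lt_trans h1 h4; have := le_lt_trans h3 h2.
by rewrite !ltrD2l !ltr_pM2r// !ltr_nat; lia.
Qed.

(** A rational interval around [y] that contains neither [x] nor [x'] makes both measurable with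
    respect to its outside, where they are named by [first_point]. Only countably many cases of
    [vp_null_point] arise. *)
Lemma vp_no_relation (f : R -> R -> R) :
  (forall g g' : conf R -> R, measurable_fun setT g -> measurable_fun setT g' ->
     measurable_fun setT (fun X => f (g X) (g' X))) ->
  {ae P, forall w, forall x x' y, Y w x -> Y w x' -> Y w y -> y != x -> y != x' ->
     y <> f x x'}.
Proof.
move=> mf.
have : {ae P, forall w, forall k : rat * rat * (rat * rat) * nat,
    (ratr k.1.1.1 < ratr k.1.1.2 :> R) ->
    let B := (~` `[ratr k.1.1.1, ratr k.1.1.2[) in
    let y := f (first_point k.2%:R (ratr k.1.2.1) (restrict B (Y w)))
               (first_point k.2%:R (ratr k.1.2.2) (restrict B (Y w))) in
    ~ (Y w y /\ ratr k.1.1.1 <= y < ratr k.1.1.2)}.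
  apply: ae_forall_count => -[[[p q] [t t']] m] /=.
  have [pq|qp] := ltP (ratr p : R) (ratr q); last by apply: aeW.
  have := vp_null_point (mf _ _ (measurable_first_point m%:R (ratr t))
    (measurable_first_point m%:R (ratr t'))) pq.
  by apply: negligibleS => w /= h; apply: contrapT => h'; apply: h.
apply: filterS => w h x x' y Yx Yx' Yy yx yx' e.
have [p [py px px']] : exists p : rat, [/\ (ratr p < y :> R), x < y -> x < ratr p &
    x' < y -> x' < ratr p].
  pose c := Num.max (y - 1) (Num.max (if x < y then x else y - 1) (if x' < y then x' else y - 1)).
  have cy : c < y by rewrite !gt_max; apply/and3P; split; [|case: ifP => //|case: ifP => //]; lra.
  have [p] := rat_in_itvoo cy; rewrite in_itv/= => /andP[]; rewrite !gt_max => /and3P[_ h1 h2] py.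
  by exists p; split => // l; [move: h1|move: h2]; rewrite l.
have [q [qy qx qx']] : exists q : rat, [/\ (y < ratr q :> R), y < x -> ratr q < x &
    y < x' -> ratr q < x'].
  pose c := Num.min (y + 1) (Num.min (if y < x then x else y + 1) (if y < x' then x' else y + 1)).
  have cy : y < c by rewrite !lt_min; apply/and3P; split; [|case: ifP => //|case: ifP => //]; lra.
  have [q] := rat_in_itvoo cy; rewrite in_itv/= => /andP[+]; rewrite !lt_min => qy /and3P[_ h1 h2].
  by exists q; split => // l; [move: h1|move: h2]; rewrite l.
pose m := (Num.truncn (`|x| + `|x'|)).+1.
have hm : `|x| + `|x'| < m%:R by exact: truncnS_gt.
have B (v : R) : v != y -> (v < y -> v < ratr p) -> (y < v -> ratr q < v) -> Y w v ->
    restrict (~` `[ratr p, ratr q[) (Y w) v.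
  move=> vy vp vq Yv; split => //=; rewrite in_itv/=; apply/negP; rewrite negb_and -!ltNge -leNgt.
  case: (ltgtP v y) vy => // [l|l] _; first by rewrite (vp l).
  by rewrite (ltW (vq l)) orbT.
have lf : locally_finite (restrict (~` `[ratr p, ratr q[) (Y w)).
  move=> a b; apply: sub_finite_set (vp_finite vY w a b).
  by move=> v [[Yv _] ?].
have [t _ tx] := @first_point_rat _ m%:R _ x (x - 1) lf (B x ltac:(by rewrite eq_sym) px qx Yx)
  ltac:(have := ler_norm x; have := normr_ge0 x'; lra) ltac:(lra).
have [t' _ tx'] := @first_point_rat _ m%:R _ x' (x' - 1) lf (B x' ltac:(by rewrite eq_sym) px' qx' Yx')
  ltac:(have := ler_norm x'; have := normr_ge0 x; lra) ltac:(lra).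
apply: (h (p, q, (t, t'), m)) => /=; first exact: lt_trans qy.
by rewrite tx tx' -e; split => //; rewrite qy ltW.
Qed.

End null_sets.

(** * Almost sure absence of ties *)

Section ties.
Context {R : realType} (r s rho : R).
Hypothesis hp : shift_params r s rho.

(** For the two signs [sg], these are the solutions [y] of [sqdist (x, i) (y, j) = sqdist (x, i)
    (x', k)]. *)
Definition tie_point (i j k sg : bool) (x x' : R) : R :=
  position s (x, i) + (-1) ^+ sg *
    Num.sqrt (sqdist r s (x, i) (x', k) - (if i == j then 0 else r ^+ 2)) -
  (if j then s else 0).

(** A tie expresses one base point by the other two, except when the two targets are twins. Then the
    squares cancel, and the linear equation that remains has the solution [x + rho ^ 2 / (2 * s)] or
    [x - rho ^ 2 / (2 * s)]. *)
Lemma no_tie_relations (X : set R) :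
  (forall i j k sg x x' y, X x -> X x' -> X y -> y != x -> y != x' ->
     y <> tie_point i j k sg x x') ->
  (forall (sg : bool) x x' y, X x -> X x' -> X y -> y != x -> y != x' ->
     y <> x + (-1) ^+ sg * (rho ^+ 2 / (2 * s))) ->
  no_tie r s X.
Proof.
move=> h1 h2 [x i] [y j] [x' k] /= Xx Xy Xx' vw uv uw tie.
have [r0 s0 _ rho2 _] := hp.
have single_out y' j' x'' k' : X y' -> X x'' -> y' != x -> y' != x'' ->
    sqdist r s (x, i) (y', j') <> sqdist r s (x, i) (x'', k').
  move=> Xy' Xx'' n1 n2 e.
  have sq : (position s (y', j') - position s (x, i)) ^+ 2 =
      sqdist r s (x, i) (x'', k') - (if i == j' then 0 else r ^+ 2).
    by rewrite -e /sqdist /= -sqrrN opprB addrK.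
  have := sqrtr_sqr (position s (y', j') - position s (x, i)); rewrite sq.
  case: (ger0P (position s (y', j') - position s (x, i))) => _ h.
    by apply: (h1 i j' k' false x x'' y' Xx Xx'' Xy' n1 n2); rewrite /tie_point h /position /=; ring.
  by apply: (h1 i j' k' true x x'' y' Xx Xx'' Xy' n1 n2); rewrite /tie_point h /position /=; ring.
have s2 : 2 * s != 0 by rewrite gt_eqF//; lra.
have cE : rho ^+ 2 / (2 * s) * (2 * s) = rho ^+ 2 by rewrite divfK.
have twin b : x != y -> sqdist r s (x, i) (y, b) <> sqdist r s (x, i) (y, ~~ b).
  move=> xy; rewrite eq_sym in xy; suff : sqdist r s (x, i) (y, i) <> sqdist r s (x, i) (y, ~~ i).
    by case: i b {uv uw tie single_out} => -[] //= h e; apply: h.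
  rewrite sqdist_same; case: i {uv uw tie single_out}; rewrite ?sqdist_tf ?sqdist_ft => e.
    apply: (h2 false x x y) => //; rewrite expr0 mul1r; apply: (mulIf s2).
    by move: e cE; clear -rho2; nra.
  apply: (h2 true x x y) => //; rewrite expr1 mulN1r; apply: (mulIf s2).
  by move: e cE; clear -rho2; nra.
have [yx|nyx] := eqVneq y x; last first.
  have [yx'|nyx'] := eqVneq y x'; last exact: (single_out y j x' k).
  subst x'; have kj : k = ~~ j by case: j k vw {tie uw uv} => -[].
  by apply: (twin j); [rewrite eq_sym|rewrite -kj].
subst y; have [xx'|nxx'] := eqVneq x' x.
  by subst x'; case: i j k vw uv uw {single_out twin tie} => -[] [].
by apply: (single_out x' k x j) => //.
Qed.

Context {d : measure_display} {T : measurableType d}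
  (P : probability T R) (Y : T -> conf R).
Hypothesis vY : void_process P Y.

Lemma ae_no_tie : {ae P, forall w, no_tie r s (Y w)}.
Proof.
have t1 : {ae P, forall w, forall q : bool * bool * bool * bool, forall x x' y,
    Y w x -> Y w x' -> Y w y -> y != x -> y != x' ->
    y <> tie_point q.1.1.1 q.1.1.2 q.1.2 q.2 x x'}.
  apply: ae_forall_count => -[[[i j] k] sg] /=; apply: (vp_no_relation vY) => g g' mg mg'.
  have mpos b (u : conf R -> R) : measurable_fun setT u -> measurable_fun setT (fun X => position s (u X, b)).
    by move=> mu; rewrite /position /=; exact: measurable_funD.
  rewrite /tie_point /sqdist; apply: measurable_funB; last exact: measurable_cst.
  apply: measurable_funD; first exact: mpos.
  apply: measurable_funM; first exact: measurable_cst.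
  apply: (measurableT_comp (continuous_measurable_fun (@sqrt_continuous R))).
  apply: measurable_funB; last exact: measurable_cst.
  apply: measurable_funD; last by rewrite /=; exact: measurable_cst.
  by apply: measurable_funX; apply: measurable_funB; exact: mpos.
have t2 : {ae P, forall w, forall sg : bool, forall x x' y,
    Y w x -> Y w x' -> Y w y -> y != x -> y != x' ->
    y <> x + (-1) ^+ sg * (rho ^+ 2 / (2 * s))}.
  apply: ae_forall_count => sg; apply: (vp_no_relation vY) => g g' mg mg'.
  by apply: measurable_funD => //; exact: measurable_cst.
apply: filterS2 t1 t2 => w h1 h2; apply: no_tie_relations.
  by move=> i j k sg; exact: (h1 (i, j, k, sg)).
exact: h2.
Qed.

End ties.

(** * Independent trials in consecutive blocks *)

Section blocks.
Context {d : measure_display} {T : measurableType d} {R : realType}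
  (P : probability T R) (Y : T -> conf R).
Hypothesis vY : void_process P Y.

Lemma restrict_shift_sub (a L : R) (B X : set R) : `[a, a + L[ `<=` B ->
  restrict `[0, L[ (shift a (restrict B X)) = restrict `[0, L[ (shift a X).
Proof.
move=> aB; apply/seteqP; split => x [].
  by move=> [Xx _] x0; split.
move=> Xx x0; split => //; split => //; apply: aB => /=.
by move: x0; rewrite /= !in_itv/= => /andP[h1 h2]; apply/andP; split; lra.
Qed.

Lemma measurable_preshift a (U : set (conf R)) : measurable U ->
  measurable (shift a @^-1` U : set (conf R)).
Proof. by move=> mU; rewrite -[X in measurable X]setTI; exact: measurable_shift. Qed.

Lemma measurable_prerestrict B (U : set (conf R)) : measurable B -> measurable U ->
  measurable (restrict B @^-1` U : set (conf R)).
Proof. by move=> mB mU; rewrite -[X in measurable X]setTI; exact: measurable_restrict. Qed.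

Definition all_blocks (o L : R) (U : set (set R)) (n : nat) : set (set R) :=
  [set X | forall i, (i < n)%N -> U (restrict `[0, L[ (shift (o + i%:R * L) X))].

Lemma measurable_all_blocks o L (U : set (conf R)) n : measurable U ->
  measurable (all_blocks o L U n : set (conf R)).
Proof.
move=> mU; apply: measurable_forall_set => i; apply: measurable_imply_set.
  exact: measurable_const_set.
apply: (@measurable_preshift _ (restrict `[0, L[ @^-1` U)).
by apply: measurable_prerestrict => //; exact: measurable_itv.
Qed.

Lemma pr_all_blocks o L (U : set (conf R)) n : 0 <= L -> measurable U ->
  pr P (Y @^-1` all_blocks o L U n) = pr P (Y @^-1` (restrict `[0, L[ @^-1` U)) ^+ n.
Proof.
move=> L0 mU; elim: n => [|n IH].
  rewrite expr0 (_ : all_blocks o L U 0 = setT) ?preimage_setT ?pr_setT//.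
  by apply/seteqP; split.
pose a := o + n%:R * L.
pose V : set (conf R) := restrict `[0, L[ @^-1` U.
have mI : measurable (`[0, L[ : set R) by exact: measurable_itv.
have mV : measurable V by exact: measurable_prerestrict.
have -> : all_blocks o L U n.+1 = restrict `[o, a[ @^-1` (all_blocks o L U n) `&`
    restrict `[a, (a + L)[ @^-1` (shift a @^-1` V).
  apply/seteqP; split => X.
    move=> h; split; last by rewrite /V /= restrict_shift_sub//; exact: h.
    move=> i ni; rewrite restrict_shift_sub; first by apply: h; lia.
    move=> x; rewrite /= !in_itv/= => /andP[h1 h2]; apply/andP; split.
      by apply: le_trans h1; rewrite lerDl mulr_ge0.
    apply: lt_le_trans h2 _; rewrite -addrA lerD2l -[X in _ + X]mul1r -mulrDl natr1.
    by rewrite ler_wpM2r// ler_nat.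
  move=> [h1 h2] i; rewrite ltnS leq_eqVlt => /predU1P[->|ni].
    by move: h2; rewrite /V /= restrict_shift_sub.
  have := h1 i ni; rewrite restrict_shift_sub//.
  move=> x; rewrite /= !in_itv/= => /andP[h3 h4]; apply/andP; split.
    by apply: le_trans h3; rewrite lerDl mulr_ge0.
  apply: lt_le_trans h4 _; rewrite -addrA lerD2l -[X in _ + X]mul1r -mulrDl natr1.
  by rewrite ler_wpM2r// ler_nat.
rewrite (vp_indep vY); [|exact: measurable_itv|exact: measurable_itv| | |]; last 3 first.
- apply/seteqP; split => // x []; rewrite /= !in_itv/= => /andP[_ h1] /andP[h2 _].
  by move: h1; rewrite ltNge h2.
- exact: measurable_all_blocks.
- exact: measurable_preshift.
rewrite exprSr -IH; congr (_ * _).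
  congr (pr P (Y @^-1` _)); apply/seteqP; split => X h i ni; have := h i ni;
  rewrite restrict_shift_sub//.
    move=> x; rewrite /= !in_itv/= => /andP[h3 h4]; apply/andP; split.
      by apply: le_trans h3; rewrite lerDl mulr_ge0.
    apply: lt_le_trans h4 _; rewrite -addrA lerD2l -[X in _ + X]mul1r -mulrDl natr1.
    by rewrite ler_wpM2r// ler_nat.
  move=> x; rewrite /= !in_itv/= => /andP[h3 h4]; apply/andP; split.
    by apply: le_trans h3; rewrite lerDl mulr_ge0.
  apply: lt_le_trans h4 _; rewrite -addrA lerD2l -[X in _ + X]mul1r -mulrDl natr1.
  by rewrite ler_wpM2r// ler_nat.
rewrite -(vp_shift vY a mV); congr (pr P (Y @^-1` _)).
by apply/seteqP; split => X; rewrite /V /= restrict_shift_sub.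
Qed.

Lemma ae_some_block o L (U : set (conf R)) : 0 <= L -> measurable U ->
  pr P (Y @^-1` (restrict `[0, L[ @^-1` U)) < 1 ->
  {ae P, forall w, exists i : nat, ~ U (restrict `[0, L[ (shift (o + i%:R * L) (Y w)))}.
Proof.
move=> L0 mU lt1; apply: pr_negligible => e e0.
have [n hn] : exists n : nat, pr P (Y @^-1` (restrict `[0, L[ @^-1` U)) ^+ n <= e.
  by apply: expr_small => //; rewrite pr_ge0.
exists (Y @^-1` all_blocks o L U n); split.
- by apply: (vp_event vY); exact: measurable_all_blocks.
- by move=> w h i ni; apply: contrapT => h'; apply: h; exists i.
- by rewrite pr_all_blocks.
Qed.

Lemma ae_unbounded : {ae P, forall w, forall M, exists2 y, Y w y & M < y}.
Proof.
have : {ae P, forall w, forall k : nat, exists i : nat,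
    ~ void `[0, 1[ (restrict `[0, 1[ (shift (k%:R + i%:R * 1) (Y w)))}.
  apply: ae_forall_count => k; apply: ae_some_block => //.
  - exact: measurable_void_itv.
  - by rewrite restrict_void setIid (vp_void_itv vY)// -[ltRHS]expR0 ltr_expR; lra.
apply: filterS => w h M; have [i] := h (Num.truncn M).+1.
move=> /eqP/set0P[x [[Yx _] /=]]; rewrite in_itv/= => /andP[x0 _].
exists (x + ((Num.truncn M).+1%:R + i%:R * 1)) => //.
by have := truncnS_gt M; have : 0 <= i%:R :> R by []; lra.
Qed.

Lemma ae_gaps L : 0 < L -> {ae P, forall w, forall M, exists2 a, M < a &
  forall y, Y w y -> ~ (a <= y < a + L)}.
Proof.
move=> L0; have : {ae P, forall w, forall k : nat, exists i : nat,
    ~ (~` void `[0, L[) (restrict `[0, L[ (shift (k%:R + i%:R * L) (Y w)))}.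
  apply: ae_forall_count => k; apply: ae_some_block => //; first exact: ltW.
  - by apply: measurableC; exact: measurable_void_itv.
  - rewrite -(preimage_setC (restrict _)) -(preimage_setC Y) restrict_void setIid.
    rewrite pr_setC; last by apply: (vp_event vY); exact: measurable_void_itv.
    by rewrite (vp_void_itv vY) ?(ltW L0)//; have := expR_gt0 (0 - L); lra.
apply: filterS => w h M; have [i] := h (Num.truncn M).+1.
move=> /contrapT; rewrite /void /= => e.
exists ((Num.truncn M).+1%:R + i%:R * L).
  have := truncnS_gt M; have : 0 <= i%:R * L by rewrite mulr_ge0// ltW.
  lra.
move=> y Yy /andP[h1 h2].
have : (restrict `[0, L[ (shift ((Num.truncn M).+1%:R + i%:R * L) (Y w)) `&` `[0, L[)
    (y - ((Num.truncn M).+1%:R + i%:R * L)).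
  by split; [split; rewrite /shift /= ?subrK//|] => /=; rewrite in_itv/=; apply/andP; split; lra.
by rewrite e.
Qed.

End blocks.

(** * The event that the walk does not return *)

Section agreement.
Context {R : realType}.
Implicit Types X : set R.

Definition agree (b : R) X X' := forall x, 0 <= x < b -> (X x <-> X' x).

Lemma agree_sym b X X' : agree b X X' -> agree b X' X.
Proof. by move=> h x /h[]; split. Qed.

Lemma agree_void b X X' a c : agree b X X' -> 0 <= a -> c <= b ->
  void `[a, c[ X -> void `[a, c[ X'.
Proof.
move=> ag a0 cb e; apply/seteqP; split => // x [X'x]; rewrite /= in_itv/= => /andP[ax xc].
have : (X `&` `[a, c[) x.
  split; last by rewrite /= in_itv/= ax.
  by apply/ag => //; rewrite (le_trans a0 ax) (lt_le_trans xc cb).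
by rewrite e.
Qed.

Lemma agree_single b X X' a c : agree b X X' -> 0 <= a -> c <= b ->
  single a c X -> single a c X'.
Proof.
move=> ag a0 cb [x e]; exists x; rewrite -e; apply/seteqP; split => v [Xv];
  rewrite /= in_itv/= => /andP[av vc]; split; rewrite /= ?in_itv/= ?av//;
  by apply/ag => //; rewrite (le_trans a0 av) (lt_le_trans vc cb).
Qed.

Lemma agree_window b X X' o m : agree b X X' -> 0 <= o -> m <= b ->
  window o m X = window o m X'.
Proof.
move=> ag o0 mb; apply/seteqP; split => x [Xx /andP[ox xm]]; split; rewrite ?ox//;
  by apply/ag => //; rewrite (le_trans o0 ox) (lt_le_trans xm mb).
Qed.

Lemma agree_restrict (b : R) (B X : set R) : `[0, b[ `<=` B -> agree b X (restrict B X).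
Proof.
move=> bB x xb; split; last by case.
by move=> Xx; split => //; apply: bB; rewrite /= in_itv.
Qed.

Lemma locally_finite_sub X X' : locally_finite X -> X' `<=` X -> locally_finite X'.
Proof. by move=> lf sub a b; apply: sub_finite_set (lf a b) => x [/sub]. Qed.

Lemma locally_finite_shift a X : locally_finite X -> locally_finite (shift a X).
Proof.
move=> lf b c; apply: (@sub_finite_set _ _ ((fun x => x - a) @` (X `&` `[b + a, c + a]))).
  move=> x [Xx]; rewrite /= in_itv/= => /andP[bx xc]; exists (x + a); last by rewrite addrK.
  by split => //=; rewrite in_itv/= !lerD2r bx.
exact: finite_image.
Qed.

End agreement.

Section escape_event.
Context {R : realType} (r s rho delta Gam h : R) (K : nat).
Hypothesis hp : shift_params r s rho.
Hypothesis hd : [/\ 0 < delta, 8 * delta < s, (rho + 3 * delta) * (2 * s) < rho ^+ 2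
  & rho ^+ 2 < Gam * (2 * s) /\ 4 * rho < Gam].

(** Each pattern point is confined to a cell of width [delta], so a gap deviates by less than
    [delta] from the difference of offsets. This yields exactly the intervals required by
    [pattern]. *)
Definition offset (k : nat) : R := match k with
  | 0 => Gam
  | 1 => Gam + (rho - 2 * delta)
  | k'.+2 => Gam + (rho - 2 * delta) + s + k'%:R * (rho + 2 * delta)
  end.

Lemma offset_gap k : offset k + delta < offset k.+1.
Proof.
have [r0 s0 rho0 rho2 s2] := hp; have [d0 ds _ _] := hd.
case: k => [|[|k]] /=; rewrite ?mul0r; [lra|lra|].
by rewrite -natr1 mulrDl mul1r; lra.
Qed.

Lemma offset_ge0 k : 0 <= offset k.
Proof.
have [r0 s0 rho0 rho2 s2] := hp; have [d0 ds _ [_ G]] := hd.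
elim: k => [|k IH]; first by rewrite /=; lra.
by have := offset_gap k; lra.
Qed.

Fixpoint fits (n : nat) : set (set R) := if n is n'.+1
  then fits n' `&` (single (offset n') (offset n' + delta) `&`
                    void `[offset n' + delta, offset n'.+1[)
  else void `[0, offset 0[.

Lemma measurable_fits n : measurable (fits n : set (conf R)).
Proof.
elim: n => [|n IH] /=; first exact: measurable_void_itv.
apply: measurableI => //; apply: measurableI; first exact: measurable_single.
exact: measurable_void_itv.
Qed.

Lemma agree_fits n b X X' : agree b X X' -> offset n <= b -> fits n X -> fits n X'.
Proof.
have [d0 _ _ _] := hd; move=> ag; elim: n => [|n IH] nb.
  exact: agree_void ag _ _.
have g := offset_gap n; have g0 := offset_ge0 n.
move=> [f [h1 h2]]; split; first by apply: IH => //; lra.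
by split; [apply: agree_single ag _ _ h1; lra|apply: agree_void ag _ _ h2; lra].
Qed.

Let len := offset (K + 3).

(** The last pattern point is treated apart from [fits]: it is also the first point of the released
    walk, so it belongs to the independent part on [[len, +oo[]. *)
Definition starts_block : set (set R) := fits (K + 3) `&` ~` void `[len, len + delta[.

Definition no_return_to (t : R) : set (set R) :=
  starts_block `&` ~` returns_event r s len t h (~~ odd K).

(** By monotonicity in the horizon, integer horizons are enough, and the intersection stays
    countable. *)
Definition no_return : set (set R) := [set X | forall n : nat, no_return_to n%:R X].

Lemma measurable_no_return_to t : measurable (no_return_to t : set (conf R)).
Proof.
apply: measurableI; last by apply: measurableC; exact: measurable_returns_event.
apply: measurableI; first exact: measurable_fits.
by apply: measurableC; exact: measurable_void_itv.
Qed.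

Lemma measurable_no_return : measurable (no_return : set (conf R)).
Proof. by apply: measurable_forall_set => n; exact: measurable_no_return_to. Qed.

Hypothesis h0 : 0 <= h.

Lemma no_return_to_le t t' X : locally_finite X -> t <= t' -> no_return_to t' X ->
  no_return_to t X.
Proof.
have [_ s0 _ _ _] := hp.
move=> lf tt [sb n]; split => // /(returns_eventE _ _ _ _ _ _ lf) ret; apply: n.
by apply/(returns_eventE _ _ _ _ _ _ lf); apply: returns_le ret => //; exact: ltW.
Qed.

Lemma no_return_toW t X : locally_finite X -> no_return X -> no_return_to t X.
Proof.
move=> lf /(_ (Num.truncn t).+1); apply: no_return_to_le => //.
exact/ltW/truncnS_gt.
Qed.

Lemma agree_no_return_to t b X X' : locally_finite X -> locally_finite X' ->
  agree b X X' -> t <= b -> len + delta <= b -> no_return_to t X -> no_return_to t X'.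
Proof.
have [d0 _ _ _] := hd; have l0 := offset_ge0 (K + 3).
move=> lf lf' ag tb lb [[f hit] n]; split; first split.
- by apply: agree_fits ag _ f; rewrite -/len; lra.
- by move=> v; apply: hit; apply: agree_void (agree_sym ag) _ _ v.
move=> /(returns_eventE _ _ _ _ _ _ lf') ret; apply: n.
apply/(returns_eventE _ _ _ _ _ _ lf); apply: returns_window ret.
exact/esym/(agree_window ag).
Qed.

Lemma agree_no_return X X' : locally_finite X -> locally_finite X' ->
  (forall x, 0 <= x -> (X x <-> X' x)) -> no_return X -> no_return X'.
Proof.
move=> lf lf' ag nr n; apply: (@agree_no_return_to _ (n%:R + (len + delta)) X) => //.
- by move=> x /andP[x0 _]; exact: ag.
- by rewrite lerDl; have := offset_ge0 (K + 3); have [d0 _ _ _] := hd; rewrite -/len; lra.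
- by rewrite lerDr.
Qed.

Lemma fits_points n X : fits n X -> exists c : nat -> R,
  (forall k, (k < n)%N -> X (c k) /\ offset k <= c k < offset k + delta) /\
  (forall v, X v -> 0 <= v < offset n -> exists2 k, (k < n)%N & v = c k).
Proof.
elim: n => [|n IH] /=.
  move=> v0; exists (fun=> 0); split => // v Xv v1.
  have : (X `&` `[0, Gam[) v by split => //=; rewrite in_itv.
  by rewrite v0.
move=> [/IH[c [c1 c2]] [[x e] v0]].
have [Xx] : (X `&` `[offset n, (offset n + delta)[) x by rewrite e.
rewrite /= in_itv/= => xn.
exists (fun k => if k == n then x else c k); split.
  move=> k; rewrite ltnS leq_eqVlt; case: eqVneq => [->//|_] /= kn; exact: c1.
move=> v Xv /andP[v1 v2].
have [vn|nv] := ltP v (offset n).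
  have [|k kn ->] := c2 v Xv; first by rewrite v1.
  by exists k; [lia|rewrite ifN//; apply/eqP; lia].
have [vd|dv] := ltP v (offset n + delta).
  exists n => //; rewrite eqxx.
  have : (X `&` `[offset n, (offset n + delta)[) v by split => //=; rewrite in_itv/= nv.
  by rewrite e.
have : (X `&` `[(offset n + delta), offset n.+1[) v by split => //=; rewrite in_itv/= dv.
by rewrite v0.
Qed.

Lemma no_return_leaves t y X : locally_finite X -> no_return_to t (shift y X) ->
  exists c, leaves_behind r s rho delta Gam h len K X (y + t) y c.
Proof.
have [r0 s0 rho0 rho2 s2] := hp; have [d0 ds _ _] := hd.
move=> lf [[f hit] nr].
have [c0 [c1 c2]] := fits_points f.
have lf' := locally_finite_shift y lf.
move: hit => /eqP/set0P[p [Xp]]; rewrite /= in_itv/= => /andP[lp pl].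
have [f0 [Xf0 lf0 f0min]] := locally_finite_min lf' (P := fun v => len <= v)
  (fun v => id) Xp lp.
have f0d : f0 < len + delta by apply: le_lt_trans pl; exact: f0min.
pose c k := y + (if (k < K + 3)%N then c0 k else f0).
have cin k : (k <= K + 3)%N -> X (c k) /\ y + offset k <= c k < y + offset k + delta.
  move=> kK; rewrite /c; case: ltnP => [kl|kg].
    by have [h1 /andP[h2 h3]] := c1 k kl; split; [rewrite addrC; exact: h1|apply/andP; split; lra].
  have -> : k = (K + 3)%N by apply/eqP; rewrite eqn_leq kK kg.
  by split; [rewrite addrC; exact: Xf0|rewrite -/len; apply/andP; split; lra].
have [K1 K2] : (1 <= K + 3)%N /\ (2 <= K + 3)%N by rewrite addn3.
have cE : c (K + 3)%N = y + f0 by rewrite /c ltnn.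
have ofE : offset 0 = Gam by [].
have of1 : offset 1 = Gam + (rho - 2 * delta) by [].
have of2 : offset 2 = Gam + (rho - 2 * delta) + s by rewrite /= mul0r addr0.
exists c; split.
- split.
  + have [_ /andP[h1 h2]] := cin 0%N (leq0n _).
    have [_ /andP[h3 h4]] := cin 1%N K1.
    by rewrite ofE in h1 h2; rewrite of1 in h3 h4; apply/andP; split; lra.
  + have [_ /andP[h1 h2]] := cin 1%N K1.
    have [_ /andP[h3 h4]] := cin 2%N K2.
    by rewrite of1 in h1 h2; rewrite of2 in h3 h4; apply/andP; split; lra.
  + move=> k /andP[k2 kK].
    have [_ /andP[h1 h2]] := cin k (ltnW kK).
    have [_ /andP[h3 h4]] := cin k.+1 kK.
    have e : offset k.+1 = offset k + (rho + 2 * delta).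
      by case: k k2 {kK h1 h2 h3 h4} => [|[|k]] // _; rewrite /= -natr1; ring.
    by rewrite e in h3 h4; apply/andP; split; lra.
- by move=> k /cin[].
- move=> v Xv; have [vy|yv] := ltP v y; first by constructor 1.
  have Xv' : shift y X (v - y) by rewrite /shift /= subrK.
  have [vl|lv] := ltP (v - y) len.
    have [|k kl e] := c2 _ Xv'; first by apply/andP; split => //; lra.
    constructor 2; exists k; first exact: ltnW.
    by rewrite /c kl -e; lra.
  have := f0min _ Xv' lv; rewrite le_eqVlt => /predU1P[e|lt].
    by constructor 2; exists (K + 3)%N => //; rewrite cE e; lra.
  by constructor 3; rewrite cE; lra.
- have [_ /andP[h1 h2]] := cin 0%N (leq0n _); rewrite ofE in h1 h2.
  by apply/andP; split; lra.
- by rewrite cE; lra.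
- move=> v Xv lv; rewrite cE; have := f0min (v - y).
  by rewrite /shift /= subrK => /(_ Xv ltac:(lra)); lra.
- move=> ret; apply: nr; apply/(returns_eventE _ _ _ _ _ _ lf').
  have := returns_shift y ret.
  by rewrite addrAC subrr add0r [y + t]addrC addrK.
Qed.

End escape_event.

(** * Positive probability of a pattern followed by a walk that does not return *)

Section positivity.
Context {d : measure_display} {T : measurableType d} {R : realType}
  (P : probability T R) (Y : T -> conf R) (r s rho delta Gam : R).
Hypothesis vY : void_process P Y.
Hypothesis hp : shift_params r s rho.
Hypothesis hd : [/\ 0 < delta, 8 * delta < s, (rho + 3 * delta) * (2 * s) < rho ^+ 2
  & rho ^+ 2 < Gam * (2 * s) /\ 4 * rho < Gam].

Lemma indep_gt0 (B C : set R) (U V W : set (conf R)) : measurable B -> measurable C ->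
  B `&` C = set0 -> measurable U -> measurable V -> measurable W ->
  (forall w, U (Y w) -> U (restrict B (Y w))) ->
  (forall w, V (Y w) -> V (restrict C (Y w))) ->
  (forall w, U (restrict B (Y w)) -> V (restrict C (Y w)) -> W (Y w)) ->
  0 < pr P (Y @^-1` U) -> 0 < pr P (Y @^-1` V) -> 0 < pr P (Y @^-1` W).
Proof.
move=> mB mC BC mU mV mW hU hV hW U0 V0.
have mU' := measurable_prerestrict mB mU; have mV' := measurable_prerestrict mC mV.
have := vp_indep vY mB mC BC mU mV => e.
apply: (@lt_le_trans _ _ (pr P (Y @^-1` (restrict B @^-1` U `&` restrict C @^-1` V)))).
  rewrite e; apply: mulr_gt0.
    by apply: (lt_le_trans U0); apply: pr_le; [exact: (vp_event vY)|exact: (vp_event vY)|exact: hU].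
  by apply: (lt_le_trans V0); apply: pr_le; [exact: (vp_event vY)|exact: (vp_event vY)|exact: hV].
apply: pr_le; [|exact: (vp_event vY)|by move=> w []; exact: hW].
by apply: (vp_event vY); exact: measurableI.
Qed.

Let restrict_id (a c : R) X : restrict `[a, c[ X `&` `[a, c[ = X `&` `[a, c[.
Proof. by rewrite /restrict -setIA setIid. Qed.

Let itv_disjoint (a b c : R) : `[a, b[ `&` `[b, c[ = set0 :> set R.
Proof.
apply/seteqP; split => // x []; rewrite /= !in_itv/= => /andP[_ h1] /andP[h2 _].
by move: h1; rewrite ltNge h2.
Qed.

Let offset_gap' k := offset_gap hp hd k.

Lemma pr_fits_gt0 n : 0 < pr P (Y @^-1` fits s rho delta Gam n).
Proof.
have [d0 _ _ _] := hd; have o0 k := offset_ge0 hp hd k.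
elim: n => [|n IH].
  by rewrite (vp_void_itv vY) ?expR_gt0//; exact: o0 0%N.
have g := offset_gap' n; have on := o0 n.
set a := offset s rho delta Gam n in g on *; set c := offset s rho delta Gam n.+1 in g *.
have mv : measurable (single a (a + delta) `&` void `[(a + delta), c[ : set (conf R)).
  by apply: measurableI; [exact: measurable_single|exact: measurable_void_itv].
apply: (@indep_gt0 `[0, a[ `[a, c[ (fits s rho delta Gam n)
  (single a (a + delta) `&` void `[(a + delta), c[)) => //.
- exact: measurable_fits.
- exact: measurable_fits.
- move=> w; apply: (agree_fits hp hd (agree_restrict _ (@subset_refl _ _))).
  exact: lexx.
- move=> w [[x e] v0]; split.
    exists x; rewrite -e /restrict -setIA; congr (_ `&` _); apply/seteqP; split => y [] //.
    rewrite /= !in_itv/= => /andP[h1 h2]; split; rewrite ?in_itv/= h1//=.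
    exact: lt_trans g.
  by apply/seteqP; split => // y [[Yy _] yi]; rewrite -v0.
- move=> w f [[x e] v0]; split.
    apply: (agree_fits hp hd (agree_sym (agree_restrict (Y w) (@subset_refl _ `[0, a[%classic))) _ f).
    exact: lexx.
  split.
    exists x; rewrite -e /restrict -setIA; congr (_ `&` _); apply/seteqP; split => y.
      rewrite /= !in_itv/= => /andP[h1 h2]; split; rewrite ?in_itv/= h1//=.
      exact: lt_trans g.
    by case.
  apply/seteqP; split => // y [Yy yi]; rewrite -v0; split => //; split => //.
  move: yi; rewrite /= !in_itv/= => /andP[h1 h2]; apply/andP; split => //.
  by apply: le_trans h1; rewrite lerDl ltW.
apply: (@indep_gt0 `[a, (a + delta)[ `[(a + delta), c[ (single a (a + delta))
  (void `[(a + delta), c[)) => //.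
- exact: measurable_single.
- exact: measurable_void_itv.
- by move=> w; rewrite /single /= restrict_id.
- by move=> w; rewrite /void /= restrict_id.
- by move=> w; rewrite /single /void /= !restrict_id.
- by apply: (vp_single vY); lra.
- by rewrite (vp_void_itv vY) ?expR_gt0//; exact: ltW.
Qed.

Definition entry (h : R) (b : bool) : set (set R) := [set X |
  ~ void `[0, delta[ X /\ forall n : nat, ~ returns_event r s 0 n%:R h b X].

Lemma measurable_entry h b : measurable (entry h b : set (conf R)).
Proof.
apply: measurable_and_set; first by apply: measurable_not_set; exact: measurable_void_itv.
by apply: measurable_forall_set => n; apply: measurable_not_set; exact: measurable_returns_event.
Qed.

Lemma pr_negligible0 A : measurable A -> P.-negligible A -> pr P A = 0.
Proof. by move=> mA /(measure_negligible mA) e; rewrite /pr e. Qed.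

(** If the leftmost point is in the [k]th cell of width [delta], taking that cell as origin merely
    raises [h] by [k%:R * delta]. Some [k] must have positive probability because there are
    countably many. *)
Lemma pr_entry_gt0 (h : R) b : 0 <= h ->
  0 < pr P (Y @^-1` [set X | forall n : nat, ~ returns_event r s 0 n%:R h b X]) ->
  exists k : nat, 0 < pr P (Y @^-1` entry (h + k%:R * delta) b).
Proof.
have [d0 _ _ _] := hd; have [_ s0 _ _ _] := hp.
move=> h0 gt0; apply: contrapT => no.
have p0 k : pr P (Y @^-1` (shift (k%:R * delta) @^-1` entry (h + k%:R * delta) b)) = 0.
  rewrite (vp_shift vY); last exact: measurable_entry.
  apply/eqP; rewrite eq_le pr_ge0 andbT leNgt; apply/negP => lt.
  by apply: no; exists k.
have mE k : measurable (Y @^-1` (shift (k%:R * delta) @^-1` entry (h + k%:R * delta) b)).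
  by apply: (vp_event vY); apply: measurable_preshift; exact: measurable_entry.
have nk : P.-negligible (\bigcup_(k : nat)
    Y @^-1` (shift (k%:R * delta) @^-1` entry (h + k%:R * delta) b)).
  by apply: negligible_bigcup => k; apply: pr_null.
have mA : measurable (Y @^-1` [set X : conf R | forall n : nat, ~ returns_event r s 0 n%:R h b X]).
  apply: (vp_event vY); apply: measurable_forall_set => n; apply: measurable_not_set.
  exact: measurable_returns_event.
suff : pr P (Y @^-1` [set X | forall n : nat, ~ returns_event r s 0 n%:R h b X]) = 0.
  by move=> e; move: gt0; rewrite e ltxx.
apply: pr_negligible0 => //.
have nu := ae_unbounded vY.
apply: negligibleS (negligibleU nk nu) => w nr.
have [unb|] := pselect (forall M, exists2 y, Y w y & M < y); last by right.
left; have lf := vp_finite vY w.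
have [p Yp p0'] := unb 0.
have [y [Yy y0 ymin]] := locally_finite_min lf (P := fun v => 0 <= v)
  (fun v => id) Yp (ltW p0').
pose k := Num.truncn (y / delta); exists k => //.
have /andP[ky yk] : k%:R * delta <= y < k%:R * delta + delta.
  have yd : 0 <= y / delta by rewrite divr_ge0// ltW.
  have := truncn_itv yd; rewrite -/k => /andP[h1 h2].
  by rewrite -ler_pdivlMr// h1 -[X in _ + X]mul1r -mulrDl natr1 -ltr_pdivrMr.
have lf' := locally_finite_shift (k%:R * delta) lf; split.
  move=> v0; have : (shift (k%:R * delta) (Y w) `&` `[0, delta[) (y - k%:R * delta).
    split; first by rewrite /shift /= subrK.
    by rewrite /= in_itv/=; apply/andP; split; lra.
  by rewrite v0.
move=> n /(returns_eventE _ _ _ _ _ _ lf') ret.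
have {}ret : returns r s (k%:R * delta) (n%:R + k%:R * delta) (h + k%:R * delta) b (Y w).
  by apply: (@shift_returns _ _ _ (k%:R * delta)); rewrite subrr addrK.
have {}ret : returns r s 0 (n%:R + k%:R * delta) h b (Y w).
  apply: (@returns_origin _ r s 0 (k%:R * delta)); last by rewrite subr0.
  apply/seteqP; split => x [Yx /andP[h1 h2]]; split => //; rewrite h2 andbT.
    by apply: le_trans ky _; exact: ymin.
  by apply: le_trans h1; rewrite mulr_ge0// ltW.
apply: (nr (Num.truncn (n%:R + k%:R * delta)).+1).
apply/(returns_eventE _ _ _ _ _ _ lf); apply: returns_le ret => //; first exact: ltW.
exact/ltW/truncnS_gt.
Qed.

(** The pattern lives on [[0, len[] and the released walk on [[len, +oo[], so positive probabilities
    multiply. *)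
Lemma pr_no_return_gt0 (h : R) (K : nat) : 0 <= h ->
  0 < pr P (Y @^-1` entry h (~~ odd K)) ->
  0 < pr P (Y @^-1` no_return r s rho delta Gam h K).
Proof.
move=> h0 gt0; set len := offset s rho delta Gam (K + 3).
have [d0 _ _ _] := hd; have [_ s0 _ _ _] := hp.
have l0 : 0 <= len by exact: (offset_ge0 hp hd).
have lfr (B : set R) w : locally_finite (restrict B (Y w)).
  by apply: locally_finite_sub (vp_finite vY w) _ => x [].
apply: (@indep_gt0 `[0, len[ `[len, +oo[ (fits s rho delta Gam (K + 3))
  (shift len @^-1` entry h (~~ odd K))) => //.
- apply/seteqP; split => // x []; rewrite /= !in_itv/= andbT => /andP[_ h1] h2.
  by move: h1; rewrite ltNge h2.
- exact: measurable_fits.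
- by apply: measurable_preshift; exact: measurable_entry.
- exact: measurable_no_return.
- move=> w; apply: (agree_fits hp hd (agree_restrict _ (@subset_refl _ _))).
  exact: lexx.
- move=> w [hit nr]; split.
    move=> v0; apply: hit; apply/seteqP; split => // x [Yx xd]; rewrite -v0.
    split => //; split => //; rewrite /= in_itv/= andbT.
    by move: xd; rewrite /= in_itv/= => /andP[x0 _]; lra.
  have lf1 := locally_finite_shift len (vp_finite vY w).
  have lf2 := locally_finite_shift len (lfr `[len, +oo[%classic w).
  move=> n /(returns_eventE _ _ _ _ _ _ lf2) ret; apply: (nr n).
  apply/(returns_eventE _ _ _ _ _ _ lf1); apply: returns_window ret.
  apply/seteqP; split => x [Yx /andP[x0 xn]]; split; rewrite ?x0 ?xn//; first by case: Yx.
  by split => //; rewrite /= in_itv/= andbT; lra.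
- move=> w f [hit nr] n.
  have lf := vp_finite vY w.
  split; first split.
  + apply: (agree_fits hp hd (agree_sym (agree_restrict (Y w) (@subset_refl _ `[0, len[%classic))) _ f).
    exact: lexx.
  + move=> v0; apply: hit; apply/seteqP; split => // x [[Yx _] xd].
    have : (Y w `&` `[len, (len + delta)[) (x + len).
      split => //; move: xd; rewrite /= !in_itv/= => /andP[x0 xd].
      by apply/andP; split; lra.
    by rewrite v0.
  + have lf2 := locally_finite_shift len (lfr `[len, +oo[%classic w).
    move=> /(returns_eventE _ _ _ _ _ _ lf) ret; apply: (nr n).
    apply/(returns_eventE _ _ _ _ _ _ lf2).
    apply: (@returns_le _ _ _ 0 (n%:R - len)) => //; [exact: ltW|lra|].
    have <- : len - len = 0 :> R by rewrite subrr.
    apply: returns_shift; apply: returns_window ret.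
    apply/seteqP; split => x [Yx /andP[x0 xn]]; split; rewrite -/len ?x0 ?xn//; last by case: Yx.
    by split => //; rewrite /= in_itv/= andbT.
- exact: pr_fits_gt0.
- by rewrite (vp_shift vY)//; exact: measurable_entry.
Qed.

(** [K] has two tasks: its parity selects the line on which the released walk begins, and its size
    puts the missed point at least [h] before the end of the pattern. *)
Lemma exists_cells (h : R) b : exists K : nat, ~~ odd K = b /\
  Gam + delta + s + h <= offset s rho delta Gam (K + 3).
Proof.
have [r0 s0 rho0 rho2 s2] := hp; have [d0 ds _ _] := hd.
pose N := (Num.truncn ((Gam + delta + s + h) / rho)).+1.
exists ((N.*2) + ~~ b)%N; split; first by rewrite oddD odd_double; case: b.
have hN : Gam + delta + s + h <= N%:R * rho.
  by rewrite -ler_pdivrMr//; exact/ltW/truncnS_gt.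
rewrite !addnS addn0 /=; set k := (_ + _)%N.
have kN : N%:R <= k.+1%:R :> R by rewrite ler_nat /k -addnn; lia.
have : N%:R * rho <= k.+1%:R * (rho + 2 * delta).
  by apply: ler_pM => //; [exact: ltW|lra].
have := offset_ge0 hp hd 2; rewrite /= mul0r addr0 -/k; lra.
Qed.

End positivity.

(** * The maximal inequality and the contradiction *)

Section maximal_inequality.
Context {R : realType}.

Definition heavy (f : nat -> R) (k : nat) : Prop :=
  exists j, (j < k)%N /\ (k - j)%:R <= 32 * \sum_(j <= i < k) f i.

(** The intervals in [heavy] all extend to the left, so no covering constant is lost. If the last
    index is heavy through [j], then the indices from [j] on are paid for by that interval, and the
    rest follows by induction up to [j]. *)
Lemma maximal_inequality (f : nat -> R) n : (forall i, 0 <= f i) ->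
  \sum_(0 <= k < n) (`[< heavy f k.+1 >])%:R <= 32 * \sum_(0 <= i < n) f i.
Proof.
move=> f0; have [N le] := ubnP n; elim: N => // N IH in n le *.
case: n le => [|n] le; first by rewrite !big_geq// mulr0.
have [[j [jn hj]]|nh] := pselect (heavy f n.+1).
  have jn' : (j <= n.+1)%N by exact: ltnW.
  rewrite (big_cat_nat _ jn')//= [X in _ <= 32 * X](big_cat_nat _ jn')//= mulrDr lerD//.
    by apply: IH; exact: leq_trans jn _.
  apply: le_trans hj; apply: (@le_trans _ _ (\sum_(j <= i < n.+1) 1)).
    by apply: ler_sum => i _; case: asboolP.
  by rewrite sumr_const_nat.
rewrite !big_nat_recr//= asboolF// addr0 mulrDr; apply: le_trans (IH n _) _ => //.
by rewrite lerDl mulr_ge0.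
Qed.

(** If every index at distance between [x] and [9 / 8 * x] belonged to [A], there would be about
    [x / 8] of them, and [32] times that exceeds [9 / 8 * x]: the index [k] would be heavy. The
    bound [100 <= x] absorbs the rounding. *)
Lemma light_between (A : nat -> Prop) k (x : R) :
  ~ heavy (fun i => (`[< A i >])%:R) k -> 100 <= x -> 9 * x <= 8 * k%:R ->
  exists i, [/\ (i < k)%N, ~ A i, x <= (k - i.+1)%:R & 8 * (k - i)%:R <= 9 * x].
Proof.
move=> nh x100 xk; apply: contrapT => no; apply: nh.
have x0 : 0 <= x by lra.
have /andP[a1 a2] := truncn_itv x0; set a := Num.truncn x in a1 a2.
have x9 : 0 <= 9 / 8 * x by lra.
have /andP[b1 b2] := truncn_itv x9; set b := Num.truncn (9 / 8 * x) in b1 b2.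
rewrite -natr1 in a2; rewrite -natr1 in b2.
have bk : (b <= k)%N by rewrite -(ler_nat R); lra.
have ab : (a.+1 <= b)%N by rewrite -(ler_nat R) -natr1; lra.
have b0 : (0 < b)%N by exact: leq_trans ab.
exists (k - b)%N; split; first by lia.
have kb : (k - b <= k - a.+1)%N by lia.
have ka : (k - a.+1 <= k)%N by lia.
rewrite (big_cat_nat kb ka) /=.
have -> : (k - (k - b))%N = b by lia.
have s2 : 0 <= \sum_(k - a.+1 <= i < k) (`[< A i >])%:R :> R by apply: sumr_ge0.
suff : \sum_(k - b <= i < k - a.+1) (`[< A i >])%:R = b%:R - a%:R - 1 :> R by move=> ->; lra.
rewrite (eq_big_nat _ _ (F2 := fun=> 1)).
  rewrite sumr_const_nat (_ : _ - _ = b - a.+1)%N; last by lia.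
  by rewrite natrB// -natr1; ring.
move=> i /andP[i1 i2]; rewrite asboolT//; apply: contrapT => nA; apply: no.
exists i; split => //; first by lia.
  have : (a.+1 <= k - i.+1)%N by lia.
  by rewrite -(ler_nat R) -natr1; lra.
have : (k - i <= b)%N by lia.
by rewrite -(ler_nat R); lra.
Qed.

End maximal_inequality.

Section expectation.
Context {d : measure_display} {T : measurableType d} {R : realType}
  (P : probability T R).

Lemma integral_sum_indic n (A : nat -> set T) : (forall i, measurable (A i)) ->
  (\int[P]_w (\sum_(0 <= i < n) \1_(A i) w)%:E = (\sum_(0 <= i < n) pr P (A i))%:E)%E.
Proof.
move=> mA; under eq_integral do rewrite -sumEFin.
rewrite ge0_integral_sum//.
- rewrite -sumEFin; apply: eq_bigr => i _.
  by rewrite integral_indic// setIT -(prE P (mA i)).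
- by move=> i; apply/measurable_EFinP; exact: measurable_indic.
Qed.

Lemma pr_sum_le n m (A B : nat -> set T) (c : R) : 0 <= c ->
  (forall i, measurable (A i)) -> (forall i, measurable (B i)) ->
  (forall w, \sum_(0 <= i < n) \1_(A i) w <= c * \sum_(0 <= i < m) \1_(B i) w :> R) ->
  \sum_(0 <= i < n) pr P (A i) <= c * \sum_(0 <= i < m) pr P (B i).
Proof.
move=> c0 mA mB le; rewrite -lee_fin EFinM -!integral_sum_indic//.
have ms k (F : nat -> set T) : (forall i, measurable (F i)) ->
    measurable_fun setT (fun w => \sum_(0 <= i < k) \1_(F i) w : R).
  by move=> mF; apply: measurable_sum => i; exact: measurable_indic.
rewrite -ge0_integralZl_EFin//; last 2 first.
- by move=> x _; rewrite lee_fin sumr_ge0.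
- by apply/measurable_EFinP; exact: ms.
have m1 : measurable_fun setT (fun w => (\sum_(0 <= i < n) \1_(A i) w : R)%:E).
  by apply/measurable_EFinP; exact: ms.
have m2 : measurable_fun setT
    (fun w => c%:E * (\sum_(0 <= i < m) \1_(B i) w : R)%:E)%E.
  by apply/measurable_EFinP; apply: measurable_funM => //; exact: ms.
apply: ge0_le_integral => //.
- by move=> x _; rewrite lee_fin sumr_ge0.
- by move=> x _; rewrite -EFinM lee_fin.
Qed.

End expectation.

(** * Supercells of translates and the trap before [z] *)

Section renewal.
Context {R : realType} (r s rho delta Gam h : R) (K : nat).
Hypothesis hp : shift_params r s rho.
Hypothesis hd : [/\ 0 < delta, 8 * delta < s, (rho + 3 * delta) * (2 * s) < rho ^+ 2
  & rho ^+ 2 < Gam * (2 * s) /\ 4 * rho < Gam].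
Hypothesis h0 : 0 <= h.
Let len := offset s rho delta Gam (K + 3).
Hypothesis hlen : Gam + delta + s + h <= len.

Let W (t : R) : set (conf R) := no_return_to r s rho delta Gam h K t.
Let U : set (conf R) := no_return r s rho delta Gam h K.

Let mW t : measurable (W t).
Proof. exact: measurable_no_return_to. Qed.

Let mU : measurable U.
Proof. exact: measurable_no_return. Qed.

Variables (M : R) (n : nat).
Hypothesis hM : len + delta <= M.

Let M0 : 0 < M.
Proof.
have [d0 _ _ _] := hd; have := offset_ge0 hp hd (K + 3); have := hM; rewrite -/len; lra.
Qed.

Let grid (i j : nat) : R := i%:R * (n%:R * M) + j%:R * M.

Definition barren (i : nat) : set (set R) :=
  [set X | forall j, (j < n)%N -> ~ U (shift (grid i j) X)].

(** The horizon makes this the stronger failure, since [U] implies every [W]. Bounds on heaviness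
    for [barren] therefore pass to this version, which in return is determined before [z]. *)
Definition barren_to (z : R) (i : nat) : set (set R) :=
  [set X | forall j, (j < n)%N -> ~ W (z - grid i j) (shift (grid i j) X)].

Definition heavy_event (A : nat -> set (set R)) (k : nat) : set (set R) :=
  [set X | heavy (fun i => (`[< A i X >])%:R : R) k].

Lemma measurable_barren i : measurable (barren i : set (conf R)).
Proof.
apply: measurable_forall_set => j; apply: measurable_imply_set.
  exact: measurable_const_set.
by apply: measurable_not_set; exact: (measurable_preshift (grid i j) mU).
Qed.

Lemma measurable_barren_to z i : measurable (barren_to z i : set (conf R)).
Proof.
apply: measurable_forall_set => j; apply: measurable_imply_set.
  exact: measurable_const_set.
by apply: measurable_not_set; exact: (measurable_preshift (grid i j) (mW _)).
Qed.

Lemma measurable_heavy_event (A : nat -> set (conf R)) k :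
  (forall i, measurable (A i)) -> measurable (heavy_event A k : set (conf R)).
Proof.
move=> mA; apply: measurable_exists_set => j; apply: measurable_and_set.
  exact: measurable_const_set.
apply: measurable_ler_set => //; apply: measurable_funM => //.
apply: measurable_sum => i.
rewrite (_ : (fun _ => _) = (\1_(A i) : conf R -> R)); first exact: measurable_indic.
apply/funext => X; rewrite indicE; congr (_%:R).
Qed.

Lemma heavy_sub (A B : nat -> set (set R)) k X : (forall i, A i X -> B i X) ->
  heavy_event A k X -> heavy_event B k X.
Proof.
move=> AB [j [jk hj]]; exists j; split => //; apply: le_trans hj _.
rewrite ler_pM2l//; apply: ler_sum => i _; rewrite ler_nat.
by case: asboolP => // /AB ?; rewrite asboolT.
Qed.

Lemma barren_to_sub z i X : locally_finite X -> barren_to z i X -> barren i X.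
Proof.
move=> lf b j jn u; apply: (b j jn).
by apply: (no_return_toW hp h0) u; exact: locally_finite_shift.
Qed.

Let grid_end i j k : (i < k)%N -> (j < n)%N -> grid i j + M <= k%:R * (n%:R * M).
Proof.
move=> ik jn; rewrite /grid -addrA -[X in _ + (_ + X)]mul1r -mulrDl natr1.
have h1 : j.+1%:R * M <= n%:R * M by rewrite ler_pM2r// ler_nat.
have h2 : i.+1%:R * (n%:R * M) <= k%:R * (n%:R * M).
  by apply: ler_wpM2r; [rewrite mulr_ge0// ltW|rewrite ler_nat].
by apply: le_trans h2; rewrite -[i.+1%:R]natr1 [leRHS]mulrDl mul1r lerD2l.
Qed.

Let grid_ge0 i j : 0 <= grid i j.
Proof. by rewrite /grid addr_ge0// !mulr_ge0// ltW. Qed.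

(* Everything that happens before [z] and forces a walk from [0] to come back
   as soon as [[z, z + 8 * C[] is empty. *)
Definition trap (k : nat) : set (set R) :=
  W (k%:R * (n%:R * M)) `&` ~` heavy_event (barren_to (k%:R * (n%:R * M))) k.

Lemma measurable_trap k : measurable (trap k : set (conf R)).
Proof.
apply: measurableI; first exact: mW.
apply: measurableC; apply: measurable_heavy_event => i.
exact: measurable_barren_to.
Qed.

Lemma agree_trap k b X X' : locally_finite X -> locally_finite X' -> agree b X X' ->
  k%:R * (n%:R * M) <= b -> len + delta <= b -> trap k X -> trap k X'.
Proof.
move=> lf lf' ag kb lb [w nh]; split.
  exact: (agree_no_return_to hp hd lf lf' ag).
move=> hv; apply: nh; move: hv; set z := k%:R * _ in kb w *.
move=> [j [jk hj]]; exists j; split => //; apply: le_trans hj _.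
rewrite ler_pM2l//; rewrite !big_nat; apply: ler_sum => i /andP[_ ik]; rewrite ler_nat.
case: asboolP => // bi; rewrite asboolT// => j' jn' w'; apply: (bi j' jn').
have ge := grid_end ik jn'; have g0 := grid_ge0 i j'.
apply: (agree_no_return_to hp hd (locally_finite_shift _ lf) (locally_finite_shift _ lf')
  (b := z - grid i j') _ _ _ w').
- move=> x /andP[x0 xb]; apply: ag; apply/andP; split; first by lra.
  by apply: lt_le_trans kb; lra.
- exact: lexx.
- by have := hM; rewrite -/z in ge *; rewrite -/len; lra.
Qed.

(** Removing the points left of [0] affects neither [U] nor [W], and it leaves [+oo] as the only way
    for a walk to escape, so [no_bounce] applies. Its density hypothesis comes from [light_between]
    in units of a supercell; [100 * (n%:R * M) <= C] supplies its lower bound [100]. *)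
Lemma trap_no_gap k C X : locally_finite X -> no_tie r s X ->
  (forall M', exists2 y, X y & M' < y) ->
  10 * (Gam + delta + s + r) <= C -> 100 * (n%:R * M) <= C ->
  100 * C <= k%:R * (n%:R * M) -> (0 < n)%N ->
  trap k X -> void `[k%:R * (n%:R * M), (k%:R * (n%:R * M) + 8 * C)[ X -> U X -> False.
Proof.
move=> lf nt unb hC1 hC2 hC3 n0 [_ nh] vd uX.
have [r0 s0 rho0 rho2 s2] := hp; have [d0 ds _ [_ G]] := hd.
have n0' : 0 < n%:R :> R by rewrite ltr0n.
set l := n%:R * M in hC2 hC3 nh vd; set z := k%:R * l in hC3 nh vd.
have l0 : 0 < l by rewrite mulr_gt0.
pose X' := restrict `[0, +oo[ X.
have XX' x : 0 <= x -> (X x <-> X' x).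
  by move=> x0; split => [Xx|[]//]; split => //; rewrite /= in_itv/= x0.
have X'0 x : X' x -> 0 <= x by move=> [_]; rewrite /= in_itv/= andbT.
have X'X x : X' x -> X x by case.
have lf' : locally_finite X' by apply: locally_finite_sub lf _ => x /X'X.
have unb' M' : exists2 y, X' y & M' < y.
  have [y Xy] := unb (Num.max 0 M'); rewrite gt_max => /andP[y0 My].
  by exists y => //; apply/XX' => //; exact: ltW.
have [x [x_lt x_in x0 x_cov]] := enumeration lf' unb' 0.
have [S [S0 gS]] := exists_greedy r (ltW s0) lf' (0, false) unb'.
have S_cvg M' : exists n0, forall m, (n0 <= m)%N -> M' < (S m).1.
  have [m0 hm] := greedy_leaves lf' gS M'; exists (maxn m0 1) => m.
  rewrite geq_max => /andP[/hm + m1]; case: m m1 => // m _.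
  by rewrite ger0_norm//; apply: X'0; have [] := gS m.
have C0 : 0 < C by lra.
apply: (@no_bounce _ r s rho delta Gam h len K hp hd h0 hlen X' S x gS S0 x_lt x_in
  (fun y Xy => x_cov y Xy (X'0 y Xy)) X'0
  (fun i => no_tie_gap hp nt (X'X _ (x_in i)) (X'X _ (x_in i.+1))) S_cvg C z) => //.
- move=> D CD Dz.
  have [||i [ik nb Di iD]] := @light_between _ (fun i => barren_to z i X) k (D / l) nh.
  + by rewrite ler_pdivlMr//; lra.
  + by rewrite mulrA ler_pdivrMr// -mulrA -/z.
  rewrite ler_pdivrMr// in Di; rewrite mulrA ler_pdivlMr// -mulrA in iD.
  have [j jn] : exists2 j, (j < n)%N & W (z - grid i j) (shift (grid i j) X).
    apply: contrapT => no; apply: nb => j jn w; apply: no; exists j => //.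
  move=> w; have ge := grid_end ik jn; have g0 := grid_ge0 i j.
  have iz : grid i j + M <= z by [].
  have w' : W (z - grid i j) (shift (grid i j) X').
    apply: (agree_no_return_to hp hd (locally_finite_shift _ lf) (locally_finite_shift _ lf')
      (b := z - grid i j) _ _ _ w).
    - by move=> v /andP[v0 _]; apply: XX'; rewrite addr_ge0.
    - exact: lexx.
    - by have := hM; rewrite -/len; lra.
  have [c lb] := no_return_leaves hp hd h0 lf' w'.
  exists (grid i j), c; split; last by rewrite addrC subrK in lb.
  + have : z - grid i j <= (k - i)%:R * l.
      rewrite natrB ?(ltnW ik)// mulrBl -/z /grid -/l.
      have : 0 <= j%:R * M by rewrite mulr_ge0// ltW.
      lra.
    lra.
  + have : (k - i.+1)%:R * l <= z - grid i j.
      rewrite natrB// mulrBl -/z /grid -/l -natr1 mulrDl mul1r.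
      have : j%:R * M <= l by rewrite ler_wpM2r// ?ler_nat ?(ltnW jn)// ltW.
      lra.
    lra.
- move=> v /X'X Xv; have [vz|zv] := ltP v z; [by left|right].
  rewrite leNgt; apply/negP => vC.
  have : (X `&` `[z, (z + 8 * C)[) v by split => //; rewrite /= in_itv/= zv.
  by rewrite vd.
- move=> z'; have u' : U X' by apply: (agree_no_return hp hd lf lf').
  have s0' : shift 0 X' = X' by apply/seteqP; split => y; rewrite /shift /= addr0.
  have w' : W z' (shift 0 X') by rewrite s0'; exact: (no_return_toW hp h0).
  by have [c] := no_return_leaves hp hd h0 lf' w'; rewrite add0r; exists c.
Qed.

End renewal.

(** * The event [no_return] has probability zero *)

Section no_return_null.
Context {d : measure_display} {T : measurableType d} {R : realType}
  (P : probability T R) (Y : T -> conf R) (r s rho delta Gam h : R) (K : nat).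
Hypothesis vY : void_process P Y.
Hypothesis hp : shift_params r s rho.
Hypothesis hd : [/\ 0 < delta, 8 * delta < s, (rho + 3 * delta) * (2 * s) < rho ^+ 2
  & rho ^+ 2 < Gam * (2 * s) /\ 4 * rho < Gam].
Hypothesis h0 : 0 <= h.
Let len := offset s rho delta Gam (K + 3).
Hypothesis hlen : Gam + delta + s + h <= len.

Let W (t : R) : set (conf R) := no_return_to r s rho delta Gam h K t.
Let U : set (conf R) := no_return r s rho delta Gam h K.
Let u := pr P (Y @^-1` U).

Let mW t : measurable (Y @^-1` W t).
Proof. by apply: (vp_event vY); exact: measurable_no_return_to. Qed.

Let mU : measurable (Y @^-1` U).
Proof. by apply: (vp_event vY); exact: measurable_no_return. Qed.

Let len0 : 0 <= len + delta.
Proof.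
have [d0 _ _ _] := hd; have := offset_ge0 hp hd (K + 3).
rewrite -/len; lra.
Qed.

Let lfY w : locally_finite (Y w).
Proof. exact: (vp_finite vY). Qed.

Let lfr B w : locally_finite (restrict B (Y w)).
Proof. by apply: locally_finite_sub (lfY w) _ => x []. Qed.

Let subUW t : Y @^-1` U `<=` Y @^-1` W t.
Proof. by move=> w; apply: (no_return_toW hp h0). Qed.

Lemma pr_no_return_cvg e : 0 < e ->
  exists N : nat, forall t, N%:R <= t -> pr P (Y @^-1` W t) < u + e.
Proof.
move=> e0; have [||N hN] := @pr_decreasing _ _ _ P (fun i => Y @^-1` W i%:R) e _ _ e0.
- by [].
- move=> i j ij w; apply: (no_return_to_le hp h0) => //; by rewrite ler_nat.
exists N => t Nt; have -> : u = pr P (\bigcap_i (Y @^-1` W i%:R)).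
  by congr (pr P _); apply/seteqP; split => w hw i; [move=> _|]; exact: hw.
apply: le_lt_trans hN; apply: pr_le => // w.
exact: (no_return_to_le hp h0).
Qed.

Let pr_WD t : pr P (Y @^-1` W t `\` Y @^-1` U) = pr P (Y @^-1` W t) - u.
Proof.
have := pr_split P (mW t) mU; rewrite (_ : _ `&` _ = Y @^-1` U); last first.
  by apply/setIidPr; exact: subUW.
rewrite -/u; lra.
Qed.

Let barren_shift M n i : barren r s rho delta Gam h K M n i =
  shift (i%:R * (n%:R * M)) @^-1` barren r s rho delta Gam h K M n 0.
Proof.
apply/seteqP; split => X; rewrite /barren /preimage /= => b j jn; have := b j jn;
  by rewrite shift_add mul0r add0r addrC.
Qed.

(** With horizon [M], blocks of length [M] are independent. The number [n] is chosen first, to make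
    [(1 - u) ^ n] small; then [M] is chosen so large that the passage from horizon [M] to no horizon
    costs at most [eps / 2 / n] per block. *)
Lemma exists_supercell eps : 0 < eps -> 0 < u -> exists (M : R) (n : nat),
  [/\ len + delta <= M, (0 < n)%N &
      forall i, pr P (Y @^-1` barren r s rho delta Gam h K M n i) <= eps].
Proof.
move=> e0 u0; have u1 : u <= 1 by exact: pr_le1.
have [n' hn'] : exists n, (1 - u) ^+ n <= eps / 2.
  by apply: expr_small; [apply/andP; split; lra|lra].
pose n := n'.+1; have n0 : 0 < n%:R :> R by rewrite ltr0n.
have hn : (1 - u) ^+ n <= eps / 2.
  apply: le_trans hn'; rewrite exprS ler_piMl ?exprn_ge0//; lra.
have [N hN] := @pr_no_return_cvg (eps / 2 / n%:R) ltac:(by rewrite !divr_gt0).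
pose M := N%:R + (len + delta); have lM : len + delta <= M by rewrite lerDr.
exists M, n; split => // i; rewrite barren_shift (vp_shift vY); last first.
  exact: measurable_barren.
pose Q := no_return_to r s rho delta Gam h K M.
have mQ : measurable (Q : set (conf R)) by exact: measurable_no_return_to.
have mI : measurable (`[0, M[ : set R) by exact: measurable_itv.
have agM w : agree M (Y w) (restrict `[0, M[ (Y w)) by exact: agree_restrict.
pose D j := Y @^-1` (shift (0 + j%:R * M) @^-1` (Q `\` U)).
have mQU : measurable (Q `\` U : set (conf R)).
  by apply: measurableD => //; exact: measurable_no_return.
have mD j : measurable (D j) by apply: (vp_event vY); exact: measurable_preshift.
have mB : measurable (Y @^-1` all_blocks 0 M (~` Q) n).
  by apply: (vp_event vY); apply: measurable_all_blocks; exact: measurableC.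
apply: (@le_trans _ _ (pr P (Y @^-1` all_blocks 0 M (~` Q) n `|` \bigcup_(j < n) D j))).
  apply: pr_le.
  - by apply: (vp_event vY); exact: measurable_barren.
  - by apply: measurableU => //; exact: bigcup_measurable.
  move=> w; rewrite /barren /preimage /= => b; have [al|nal] := pselect (all_blocks 0 M (~` Q) n (Y w)); first by left.
  right; apply: contrapT => no; apply: nal => j jn q; apply: no; exists j => //; split.
    apply: (agree_no_return_to hp hd _ _ (agree_sym (@agree_restrict _ M `[0, M[ _ _)) _ lM q) => //.
      by apply: (locally_finite_sub (locally_finite_shift (0 + j%:R * M) (lfY w))) => x [].
    exact: locally_finite_shift.
  by have := b j jn; rewrite mul0r.
apply: le_trans (pr_U _ _ _) _ => //; first exact: bigcup_measurable.
have h1 : pr P (Y @^-1` all_blocks 0 M (~` Q) n) <= eps / 2.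
  rewrite (pr_all_blocks vY) ?(le_trans len0 lM)//; last exact: measurableC.
  apply: le_trans hn; apply: lerXn2r; rewrite ?nnegrE ?pr_ge0//; first lra.
  rewrite -(preimage_setC (restrict _)) -(preimage_setC Y) pr_setC; last first.
    by apply: (vp_event vY); exact: measurable_prerestrict.
  rewrite lerD2l lerN2; apply: pr_le => //.
    by apply: (vp_event vY); exact: measurable_prerestrict.
  move=> w /(@subUW M) q; exact: (agree_no_return_to hp hd (lfY w) (lfr _ w) (agM w) (lexx M) lM q).
have h2 : pr P (\bigcup_(j < n) D j) <= eps / 2.
  apply: le_trans (pr_bigU P n mD) _.
  rewrite (eq_bigr (fun=> pr P (Y @^-1` Q) - u)); last first.
    by move=> j _; rewrite /D (vp_shift vY)//; exact: pr_WD.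
  rewrite sumr_const card_ord -[leLHS]mulr_natr -ler_pdivlMr// lerBlDl.
  by apply/ltW/hN; rewrite lerDl.
lra.
Qed.

Let trap_k M n k : set (conf R) := trap r s rho delta Gam h K M n k.
Let heavy_k M n k : set (conf R) := @heavy_event R (barren r s rho delta Gam h K M n) k.

Let mheavy M n k : measurable (heavy_k M n k).
Proof. by apply: measurable_heavy_event => i; exact: measurable_barren. Qed.

(** Summed over the first [2 * k0] indices, heaviness has total probability at most [64 * k0 * eps],
    so it cannot exceed [65 * eps] at each of the last [k0] of them. *)
Lemma exists_light M n eps k0 : 0 < eps -> (0 < k0)%N ->
  (forall i, pr P (Y @^-1` barren r s rho delta Gam h K M n i) <= eps) ->
  exists2 k, (k0 <= k)%N & pr P (Y @^-1` heavy_k M n k) <= 65 * eps.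
Proof.
move=> e0 k00 hb; apply: contrapT => no.
have big k : (k0 <= k)%N -> 65 * eps < pr P (Y @^-1` heavy_k M n k).
  by move=> kk; rewrite ltNge; apply/negP => le; apply: no; exists k.
have mb i : measurable (Y @^-1` barren r s rho delta Gam h K M n i).
  by apply: (vp_event vY); exact: measurable_barren.
have mh i : measurable (Y @^-1` heavy_k M n i.+1) by exact: (vp_event vY).
have := @pr_sum_le _ _ _ P (k0 + k0) (k0 + k0) _ _ 32 _ mh mb => h1.
have {}h1 : \sum_(0 <= i < k0 + k0) pr P (Y @^-1` heavy_k M n i.+1) <=
    32 * \sum_(0 <= i < k0 + k0) pr P (Y @^-1` barren r s rho delta Gam h K M n i).
  apply: h1 => // w.
  exact: (@maximal_inequality _
    (fun i => (`[< barren r s rho delta Gam h K M n i (Y w) >])%:R) (k0 + k0)).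
have h2 : \sum_(0 <= i < k0 + k0) pr P (Y @^-1` barren r s rho delta Gam h K M n i) <=
    (k0 + k0)%:R * eps.
  rewrite mulr_natl -[(k0 + k0)%N in leRHS]subn0 -sumr_const_nat.
  by apply: ler_sum => i _.
have kk : (k0 <= k0 + k0)%N by lia.
have h3 : k0%:R * (65 * eps) <= \sum_(0 <= i < k0 + k0) pr P (Y @^-1` heavy_k M n i.+1).
  rewrite (big_cat_nat (leq0n k0) kk)/=.
  rewrite -[leLHS]add0r lerD//; first by apply: sumr_ge0 => i _; exact: pr_ge0.
  rewrite mulr_natl -[k0 in leLHS](addnK k0) -sumr_const_nat !big_nat.
  by apply: ler_sum => i /andP[ki _]; apply/ltW/big; exact: leqW.
rewrite natrD in h2; have k0' : 0 < k0%:R :> R by rewrite ltr0n.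
have := mulr_gt0 k0' e0; lra.
Qed.

(** The trap has probability at least [u / 2], and the independent gap after [z] has probability
    [g]. Together they refute [no_return], up to a null set, although [W z] holds. So [W z] without
    [U] has probability at least [u / 2 * g], whereas it is below [g * u / 4] for large [z]. *)
Theorem no_return_null : u = 0.
Proof.
apply/eqP; rewrite eq_le pr_ge0 andbT leNgt; apply/negP => u0.
have [r0 s0 rho0 rho2 s2] := hp; have [d0 ds _ [_ G]] := hd.
(* Heaviness will cost [65 * u / 256], less than [u / 2]. *)
have e0 : 0 < u / 256 by rewrite divr_gt0.
have [M [n [lM n0 hb]]] := exists_supercell e0 u0.
have n0' : 0 < n%:R :> R by rewrite ltr0n.
have len1 : 0 < len + delta.
  by have := offset_ge0 hp hd (K + 3); rewrite -/len; lra.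
set l := n%:R * M; have l0 : 0 < l by rewrite mulr_gt0//; lra.
pose C := 10 * (Gam + delta + s + r) + 100 * l.
have C0 : 0 < C by rewrite /C; lra.
pose g := expR (- (8 * C)); have g0 : 0 < g by exact: expR_gt0.
(* The order of the choices matters: [C] and [g] depend on the supercell only, so the horizon, and
   with it [k], can still be taken large in terms of [g]. *)
have [N hN] := @pr_no_return_cvg (g * u / 4) ltac:(by rewrite divr_gt0// mulr_gt0).
pose k0 := (Num.truncn ((100 * C + N%:R + (len + delta)) / l)).+1.
have [k kk hk] := exists_light e0 (ltn0Sn _ : (0 < k0)%N) hb.
set z := k%:R * l.
have hz : 100 * C + N%:R + (len + delta) <= z.
  rewrite -ler_pdivrMr//; apply: (@le_trans _ _ k0%:R); last by rewrite ler_nat.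
  exact/ltW/truncnS_gt.
have N0 : 0 <= N%:R :> R by [].
have z0 : 0 <= z by lra.
pose E := trap_k M n k; pose V : set (set R) := void `[z, (z + 8 * C)[.
have mE : measurable E by exact: measurable_trap.
have mV : measurable (V : set (conf R)) by exact: measurable_void_itv.
have mEV : measurable (E `&` V : set (conf R)) by exact: measurableI.
have mY (S : set (conf R)) : measurable S -> measurable (Y @^-1` S) by exact: (vp_event vY).
have pE : u / 2 <= pr P (Y @^-1` E).
  have : u <= pr P (Y @^-1` E `|` Y @^-1` heavy_k M n k).
    apply: pr_le => //; first by apply: measurableU; [exact: (mY _ mE)|exact: (mY _ (mheavy M n k))].
    move=> w uw; have [|nh] := pselect (heavy_k M n k (Y w)); first by right.
    left; split; first exact: (no_return_toW hp h0).
    move=> hv; apply: nh; apply: heavy_sub hv => i.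
    exact: (barren_to_sub hp h0).
  have := pr_U P (mY _ mE) (mY _ (mheavy M n k)); lra.
have mI1 : measurable (`[0, z[ : set R) by exact: measurable_itv.
have mI2 : measurable (`[z, (z + 8 * C)[ : set R) by exact: measurable_itv.
have pEV : u / 2 * g <= pr P (Y @^-1` (E `&` V)).
  have dj : `[0, z[ `&` `[z, (z + 8 * C)[ = set0 :> set R.
    apply/seteqP; split => // x []; rewrite /= !in_itv/= => /andP[_ h1] /andP[h2 _].
    by move: h1; rewrite ltNge h2.
  have agz w : agree z (Y w) (restrict `[0, z[ (Y w)) by exact: agree_restrict.
  have lz : len + delta <= z by lra.
  apply: (@le_trans _ _ (pr P (Y @^-1` (restrict `[0, z[ @^-1` E `&`
      restrict `[z, (z + 8 * C)[ @^-1` V)))).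
    rewrite (vp_indep vY)//.
    have -> : pr P (Y @^-1` (restrict `[z, (z + 8 * C)[ @^-1` V)) = g.
      rewrite restrict_void setIid (vp_void_itv vY); last by lra.
      by rewrite /g; congr expR; ring.
    rewrite ler_pM2r//; apply: le_trans pE _; apply: pr_le; [exact: mY| |].
      by apply: mY; exact: measurable_prerestrict.
    by move=> w e; exact: (agree_trap hp hd lM (lfY w) (lfr _ w) (agz w) (lexx z) lz e).
  apply: pr_le; [|exact: mY|].
    by apply: mY; apply: measurableI; exact: measurable_prerestrict.
  move=> w [e v]; split.
    exact: (agree_trap hp hd lM (lfr _ w) (lfY w) (agree_sym (agz w)) (lexx z) lz e).
  by move: v; rewrite /V /void /restrict /= -setIA setIid.
have nul : pr P (Y @^-1` (E `&` V) `&` Y @^-1` U) = 0.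
  apply: pr_negligible0; first by apply: measurableI => //; exact: mY.
  apply: negligibleS (negligibleU (ae_no_tie hp vY) (ae_unbounded vY)).
  move=> w [[e v] uw]; have [nt|] := pselect (no_tie r s (Y w)); last by left.
  have [ub|] := pselect (forall M', exists2 y, Y w y & M' < y); last by right.
  exfalso; apply: (trap_no_gap hp hd h0 hlen lM (lfY w) nt ub _ _ _ n0 e v uw).
  - by rewrite /C; lra.
  - by rewrite -/l /C; lra.
  - by rewrite -/l -/z; lra.
have := pr_split P (mY _ mEV) mU; rewrite nul add0r => e1.
have : pr P (Y @^-1` (E `&` V) `\` Y @^-1` U) <= pr P (Y @^-1` W z `\` Y @^-1` U).
  apply: pr_le; [|exact: measurableD|].
    by apply: measurableD => //; exact: mY.
  by move=> w [[[e _] _] nu]; split.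
rewrite pr_WD; have := hN z ltac:(lra); have := mulr_gt0 g0 u0; lra.
Qed.

End no_return_null.

(** * Almost surely no walk that misses a point escapes to the right *)

Section no_escape.
Context {d : measure_display} {T : measurableType d} {R : realType}
  (P : probability T R) (Y : T -> conf R) (r s rho : R).
Hypothesis vY : void_process P Y.
Hypothesis hp : shift_params r s rho.

Lemma exists_tolerance : exists delta Gam : R,
  [/\ 0 < delta, 8 * delta < s, (rho + 3 * delta) * (2 * s) < rho ^+ 2
  & rho ^+ 2 < Gam * (2 * s) /\ 4 * rho < Gam].
Proof.
have [r0 s0 rho0 rho2 s2] := hp.
have a0 : 0 < rho ^+ 2 - 2 * rho * s.
  have : 0 < rho * (rho - 2 * s) by rewrite mulr_gt0// subr_gt0.
  by rewrite expr2; lra.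
(* For [delta <= e] the excess [6 * delta * s] uses at most half of the room
   [rho ^ 2 - 2 * rho * s]. *)
pose e := (rho ^+ 2 - 2 * rho * s) / (12 * s).
have e0 : 0 < e by rewrite divr_gt0//; lra.
have eE : e * (12 * s) = rho ^+ 2 - 2 * rho * s by rewrite divfK// gt_eqF//; lra.
pose dl := Num.min (s / 16) e.
have [d0 d1 d2] : [/\ 0 < dl, dl <= s / 16 & dl <= e].
  by rewrite lt_min !ge_min !lexx orbT e0 andbT; split => //; lra.
exists dl, (rho ^+ 2 / (2 * s) + 4 * rho + 1); split; [by []|lra| |split].
- have h : dl * (12 * s) <= e * (12 * s) by rewrite ler_pM2r//; lra.
  have -> : (rho + 3 * dl) * (2 * s) = 2 * rho * s + dl * (12 * s) / 2 by field.
  by rewrite eE in h; lra.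
- have c : rho ^+ 2 / (2 * s) * (2 * s) = rho ^+ 2 by rewrite divfK// gt_eqF//; lra.
  have p0 : 0 < 4 * rho * (2 * s) by rewrite !mulr_gt0.
  have -> : (rho ^+ 2 / (2 * s) + 4 * rho + 1) * (2 * s) =
      rho ^+ 2 / (2 * s) * (2 * s) + 4 * rho * (2 * s) + 2 * s by ring.
  by rewrite c; lra.
- have : 0 <= rho ^+ 2 / (2 * s) by rewrite divr_ge0 ?sqr_ge0//; lra.
  lra.
Qed.

Lemma pr_never_returns (h : R) b : 0 <= h ->
  pr P (Y @^-1` [set X | forall n : nat, ~ returns_event r s 0 n%:R h b X]) = 0.
Proof.
move=> h0; have [dl [Gam hd]] := exists_tolerance.
apply/eqP; rewrite eq_le pr_ge0 andbT leNgt; apply/negP => gt0.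
have [k pk] := pr_entry_gt0 vY hp hd h0 gt0.
have h0' : 0 <= h + k%:R * dl by case: hd => d0 _ _ _; rewrite addr_ge0// mulr_ge0// ltW.
have [K [Kb hlen]] := exists_cells hp hd (h + k%:R * dl) b.
rewrite -Kb in pk; have := pr_no_return_gt0 vY hp hd h0' pk.
by rewrite (no_return_null vY hp hd h0' hlen) ltxx.
Qed.

Lemma ae_returns : {ae P, forall w, forall q : rat * nat * bool, exists m,
  returns r s (ratr q.1.1) m q.1.2%:R q.2 (Y w)}.
Proof.
apply: ae_forall_count => -[[q h] b] /=.
pose V : set (conf R) := [set X | forall n : nat, ~ returns_event r s 0 n%:R h%:R b X].
have mV : measurable V.
  apply: measurable_forall_set => n; apply: measurable_not_set.
  exact: measurable_returns_event.
have nul : P.-negligible (Y @^-1` (shift (ratr q) @^-1` V)).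
  apply: pr_null; first by apply: (vp_event vY); exact: measurable_preshift.
  by rewrite (vp_shift vY)//; exact: pr_never_returns.
apply: negligibleS nul => w no n.
move=> /(returns_eventE _ _ _ _ _ _ (locally_finite_shift _ (vp_finite vY w))) ret.
apply: no; exists (n%:R + ratr q).
by apply: (@shift_returns _ _ _ (ratr q)); rewrite subrr addrK.
Qed.

Lemma ae_no_escape : {ae P, forall w, forall S p, greedy r s (Y w) S -> Y w p.1 ->
  (forall n, S n <> p) ->
  ~ (forall M, exists n0, forall n, (n0 <= n)%N -> M < (S n).1)}.
Proof.
have [r0 s0 rho0 _ _] := hp.
have gaps : {ae P, forall w, forall M, exists2 a, M < a &
    forall y, Y w y -> ~ (a <= y < a + 2 * rho)}.
  by apply: (ae_gaps vY); lra.
apply: filterS3 ae_returns (filterI (ae_no_tie hp vY) (ae_unbounded vY)) gaps.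
move=> w ret [nt unb] gp S p gS Yp np esc.
have [q [h [b no]]] := escape_no_return hp (vp_finite vY w) nt unb gp gS Yp np esc.
by have [m /no] := ret (q, h, b).
Qed.

End no_escape.

(** * Reduction to one line and one direction *)

Section poisson.
Context {d : measure_display} {Omega : measurableType d} {R : realType}
  (P : probability Omega R) (Pi0 : Omega -> set R).
Hypothesis hPi : poisson_process P 1 Pi0.
Local Notation mu := (@lebesgue_measure R).

Lemma counting_eq0 (X : set R) : counting X = 0%:E :> \bar R <-> X = set0.
Proof.
rewrite /counting; split; last first.
  by move=> ->; rewrite asboolT// fset_set0 finmap.cardfs0.
case: asboolP => // fX [] /eqP; rewrite pnatr_eq0 finmap.cardfs_eq0 => /eqP e.
by rewrite -(fset_setK fX) e set_fset0.
Qed.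

Lemma counting_eq1 (X : set R) : counting X = 1%:E :> \bar R -> exists x, X = [set x].
Proof.
rewrite /counting; case: asboolP => // fX [] /eqP; rewrite pnatr_eq1 => /finmap.cardfs1P[x e].
by exists x; rewrite -(fset_setK fX) e set_fset1.
Qed.

Lemma poisson_void_process (tau tau' : R -> R) : cancel tau tau' -> cancel tau' tau ->
  (forall A, measurable A -> measurable (tau' @^-1` A) /\ mu (tau' @^-1` A) = mu A) ->
  (forall a b, exists a' b', forall x, a <= x <= b -> a' <= tau x <= b') ->
  void_process P (fun w => tau @^-1` Pi0 w : conf R).
Proof.
move=> tauK tauK' mtau btau; have [[fin meas] law _] := hPi.
have voidE A : (fun w => tau @^-1` Pi0 w : conf R) @^-1` void A =
    [set w | npoints Pi0 (tau' @^-1` A) w = 0%:R%:E].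
  apply/seteqP; split => w /=.
    move=> e; apply/counting_eq0/seteqP; split => // x [Px Ax].
    have : ((tau @^-1` Pi0 w) `&` A) (tau' x) by split => //=; rewrite tauK'.
    by rewrite e.
  move=> /counting_eq0 e; apply/seteqP; split => // x [Px Ax].
  have : (Pi0 w `&` tau' @^-1` A) (tau x) by split => //=; rewrite tauK.
  by rewrite e.
have mnp A (c : \bar R) : measurable A ->
    measurable [set w | npoints Pi0 (tau' @^-1` A) w = c].
  move=> mA; have [mA' _] := mtau A mA.
  rewrite -[X in measurable X]setTI; apply: (meas _ mA' measurableT [set c]).
  exact: emeasurable_set1.
split.
- move=> w a b; have [a' [b' h]] := btau a b.
  apply: (@sub_finite_set _ _ (tau' @` (Pi0 w `&` `[a', b']))).
    move=> x [Px]; rewrite /= in_itv/= => xab; exists (tau x); last exact: tauK.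
    by split => //=; rewrite in_itv/= h.
  exact/finite_image/fin.
- by apply: conf_measurable_fun => A mA fA; rewrite voidE; exact: mnp.
- move=> A mA fA; have [mA' eA] := mtau A mA; rewrite voidE.
  by rewrite /pr law ?eA//= expr0 fact0 invr1 !mul1r.
- move=> a b ab; have mab : measurable (`[a, b[ : set R) by exact: measurable_itv.
  have [mA' eA] := mtau _ mab.
  have fA : (mu `[a, b[ < +oo)%E by rewrite lebesgue_measure_itv/= lte_fin ab -EFinB ltry.
  have lt : 0 < pr P [set w | npoints Pi0 (tau' @^-1` `[a, b[) w = 1%:R%:E].
    rewrite /pr law ?eA//= lebesgue_measure_itv/= lte_fin ab -EFinB/= expr1 factS fact0 muln1 divr1 mul1r.
    by rewrite mulr_gt0 ?expR_gt0// subr_gt0.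
  apply: (lt_le_trans lt); apply: pr_le.
  + exact: mnp.
  + have mf : measurable_fun setT (fun w => tau @^-1` Pi0 w : conf R).
      by apply: conf_measurable_fun => A mA fA'; rewrite voidE; exact: mnp.
    by rewrite -[X in measurable X]setTI; apply: mf => //; exact: measurable_single.
  + move=> w /counting_eq1[x e]; exists (tau' x); apply/seteqP; split => y.
      move=> [Py yab]; have : (Pi0 w `&` tau' @^-1` `[a, b[) (tau y) by split => //=; rewrite tauK.
      by rewrite e => /= <-; rewrite tauK.
    move=> /= ->; have : [set x] x by []; rewrite -e => -[Px xab].
    by split => //=; rewrite tauK'.
Qed.

Lemma poisson_translate (t : R) : void_process P (fun w => (fun y => y + t) @^-1` Pi0 w : conf R).
Proof.
apply: (@poisson_void_process _ (fun y => y + - t)).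
- by move=> x; rewrite addrK.
- by move=> x; rewrite subrK.
- by move=> A mA; split; [exact: measurable_translate|exact: lebesgue_translate].
- by move=> a b; exists (a + t), (b + t) => x; rewrite !lerD2r.
Qed.

Lemma poisson_reflect (t : R) : void_process P (fun w => (fun y => - y + t) @^-1` Pi0 w : conf R).
Proof.
apply: (@poisson_void_process _ (fun y => - y + t)).
- by move=> x; ring.
- by move=> x; ring.
- move=> A mA.
  have -> : (fun y => - y + t) @^-1` A = -%R @^-1` ((fun y => y + t) @^-1` A) by [].
  have mA' := measurable_translate t mA; split.
    rewrite -[X in measurable X]setTI.
    suff mf : measurable_fun [set: R] (-%R : R -> R) by exact: mf.
    exact: oppr_measurable.
  by rewrite -(lebesgue_translate t mA); exact: (lebesgue_measureN mA').
- by move=> a b; exists (- b + t), (- a + t) => x /andP[h1 h2]; apply/andP; split; lra.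
Qed.

End poisson.

Lemma sqdistC {R : realType} (r s : R) u v : sqdist r s u v = sqdist r s v u.
Proof. by rewrite /sqdist -sqrrN opprB [u.2 == _]eq_sym. Qed.

Section charts.
Context {R : realType} (r sg rho : R).
Hypothesis hp : shift_params r sg rho.
Variables (e swap : bool).

(** Coordinates adapted to a direction of escape: [e] reflects the plane and [swap] exchanges the
    lines, so that the offset between the lines is positive and the escape is to the right. *)
Definition chart (v : R * bool) : R * R :=
  ((-1) ^+ e * position sg v, if v.2 (+) swap then r else 0).

Definition chart_inv (p : R * R) : R * bool :=
  let b := (p.2 == r) (+) swap in ((-1) ^+ e * p.1 - (if b then sg else 0), b).

Let sign2 (x : R) : (-1) ^+ e * ((-1) ^+ e * x) = x.
Proof. by rewrite mulrA -expr2 sqrr_sign mul1r. Qed.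

Lemma chartK : cancel chart chart_inv.
Proof.
have [r0 _ _ _ _] := hp; move=> [y b]; rewrite /chart_inv /chart /=.
have -> : ((if b (+) swap then r else 0) == r) = b (+) swap.
  by case: (b (+) swap); rewrite ?eqxx// eq_sym gt_eqF.
by rewrite -addbA addbb addbF sign2 /position /= addrK.
Qed.

Lemma chart_invK p : p.2 = 0 \/ p.2 = r -> chart (chart_inv p) = p.
Proof.
have [r0 _ _ _ _] := hp; case: p => x l /= hl; rewrite /chart /chart_inv /position /=.
rewrite subrK sign2 -addbA addbb addbF.
by case: hl => ->; rewrite ?eqxx// [0 == r]eq_sym gt_eqF.
Qed.

Lemma euclid_chart u v : euclid_dist (chart u) (chart v) = Num.sqrt (sqdist r sg u v).
Proof.
rewrite /euclid_dist /sqdist /chart /= -mulrBr exprMn sqrr_sign mul1r.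
congr (Num.sqrt (_ + _)); case: (u.2) (v.2) swap => -[] [] /=; rewrite ?subrr ?expr0n//=;
  by rewrite ?subr0 ?sub0r ?sqrrN.
Qed.

Let sqdist_ge0 u v : 0 <= sqdist r sg u v.
Proof. by rewrite /sqdist addr_ge0 ?sqr_ge0//; case: ifP => _; rewrite ?sqr_ge0. Qed.

Variables (Pi : set (R * R)) (Y : set R).
Hypothesis PiY : forall v, Pi (chart v) <-> Y v.1.
Hypothesis PiL : forall p, Pi p -> p.2 = 0 \/ p.2 = r.

Lemma greedy_chart S : is_greedy_walk euclid_dist Pi (0, 0) S ->
  greedy r sg Y (chart_inv \o S) /\ forall n, chart (chart_inv (S n)) = S n.
Proof.
move=> [S0 gS].
have SK n : chart (chart_inv (S n)) = S n.
  case: n => [|n]; first by rewrite S0; apply: chart_invK; left.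
  by have [[Pn _] _] := gS n; apply: chart_invK; exact: PiL.
split=> // n; have [[Pn new] min] := gS n; split.
- by apply/PiY; rewrite SK.
- by apply/visitedP => -[k kn /= ek]; apply: (new k kn); rewrite -(SK n.+1) -ek SK.
- move=> v Yv /visitedP nv.
  have := min (chart v); rewrite -(SK n) -(SK n.+1) !euclid_chart ler_sqrt//.
  rewrite ![sqdist _ _ _ (chart_inv (S n))]sqdistC.
  apply; split; first exact/PiY.
  by move=> k kn ek; apply: nv; exists k => //=; rewrite -ek chartK.
Qed.

Lemma chart_greedy S : chart (S 0%N) = (0, 0) -> greedy r sg Y S ->
  is_greedy_walk euclid_dist Pi (0, 0) (chart \o S).
Proof.
move=> S0 gS; split => // n; have [Yn /visitedP new min] := gS n; split; first split.
- exact/PiY.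
- by move=> k kn /(can_inj chartK) ek; apply: new; exists k.
- move=> p [Pp np] /=; rewrite -(chart_invK (PiL Pp)) !euclid_chart ler_sqrt//.
  rewrite ![sqdist _ _ _ (S n)]sqdistC; apply: min.
    by apply/PiY; rewrite chart_invK//; exact: PiL.
  apply/visitedP => -[k kn ek]; apply: (np k kn).
  by rewrite /= ek chart_invK//; exact: PiL.
Qed.

End charts.

Section two_charts.
Context {R : realType} (r sg rho : R).
Hypothesis hp : shift_params r sg rho.

Definition never_escapes (Y : set R) := forall S p, greedy r sg Y S -> Y p.1 ->
  (forall n, S n <> p) ->
  ~ (forall M, exists n0, forall n, (n0 <= n)%N -> M < (S n).1).

Variable Pi : set (R * R).
Hypothesis PiL : forall p, Pi p -> p.2 = 0 \/ p.2 = r.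

Lemma chart_inv_bounds (e swap : bool) (p : R * R) :
  (-1) ^+ e * p.1 - sg <= (chart_inv r sg e swap p).1 <= (-1) ^+ e * p.1.
Proof.
have [_ s0 _ _ _] := hp; rewrite /chart_inv /=; case: ifP => _; apply/andP; split; lra.
Qed.

Lemma chart_no_escape (e swap : bool) Y S p :
  (forall v, Pi (chart r sg e swap v) <-> Y v.1) -> never_escapes Y ->
  is_greedy_walk euclid_dist Pi (0, 0) S -> Pi p -> (forall n, S n <> p) ->
  ~ (forall M, exists n0, forall n, (n0 <= n)%N -> M < (-1) ^+ e * (S n).1).
Proof.
move=> PiY ne gS Pp np esc.
have [gS' SK] := greedy_chart hp PiY PiL gS.
have pK : chart r sg e swap (chart_inv r sg e swap p) = p by apply: (chart_invK hp); exact: PiL.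
apply: (ne _ (chart_inv r sg e swap p) gS').
- by apply/PiY; rewrite pK.
- by move=> n /= en; apply: (np n); rewrite -(SK n) en pK.
- move=> M; have [n0 hn] := esc (M + sg); exists n0 => n /hn h.
  have /andP[h' _] := chart_inv_bounds e swap (S n).
  by apply: lt_le_trans h'; rewrite ltrBrDr.
Qed.

Variables (sw1 sw2 : bool) (Y1 Y2 : set R).
Hypothesis PiY1 : forall v, Pi (chart r sg false sw1 v) <-> Y1 v.1.
Hypothesis PiY2 : forall v, Pi (chart r sg true sw2 v) <-> Y2 v.1.
Hypothesis lf1 : locally_finite Y1.

(** By [escape_or], a walk that misses a point escapes to one side. The first chart excludes the
    right side and the reflected chart the left one. *)
Lemma two_charts_visit S p : never_escapes Y1 -> never_escapes Y2 ->
  is_greedy_walk euclid_dist Pi (0, 0) S -> Pi p -> exists n, S n = p.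
Proof.
have [r0 s0 _ _ _] := hp.
move=> ne1 ne2 gS Pp; apply: contrapT => no.
have np n : S n <> p by move=> e; apply: no; exists n.
have [gS' SK] := greedy_chart hp PiY1 PiL gS.
pose p' := chart_inv r sg false sw1 p.
have pK : chart r sg false sw1 p' = p by apply: (chart_invK hp); exact: PiL.
have Yp' : Y1 p'.1 by apply/PiY1; rewrite pK.
have np' n : (chart_inv r sg false sw1 \o S) n <> p'.
  by move=> /= en; apply: (np n); rewrite -(SK n) en pK.
have [esc|esc] := escape_or (ltW r0) (ltW s0) lf1 gS' Yp' np'.
  apply: (chart_no_escape PiY1 ne1 gS Pp np) => M.
  have [n0 hn] := esc M; exists n0 => n /hn h.
  have /andP[_] := chart_inv_bounds false sw1 (S n); exact: lt_le_trans.
apply: (chart_no_escape PiY2 ne2 gS Pp np) => M.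
have [n0 hn] := esc (- M - sg); exists n0 => n /hn h.
have /andP[h1 _] := chart_inv_bounds false sw1 (S n).
have := le_lt_trans h1 h; rewrite expr0 expr1; lra.
Qed.

Lemma two_charts_walk : (forall M, exists2 y, Y1 y & M < y) ->
  exists S, is_greedy_walk euclid_dist Pi (0, 0) S.
Proof.
have [r0 s0 _ _ _] := hp.
move=> unb; have [S [S0 gS]] := exists_greedy r (ltW s0) lf1 (chart_inv r sg false sw1 (0, 0)) unb.
exists (chart r sg false sw1 \o S); apply: (chart_greedy hp PiY1 PiL _ gS).
by rewrite S0 (chart_invK hp)//; left.
Qed.

End two_charts.

Lemma two_line_process0 {R : realType} (r s : R) X x : r != 0 ->
  two_line_process r s X (x, 0) <-> X x.
Proof.
move=> r0; split; last by left.
by case=> -[] //= _ e; move: r0; rewrite -e eqxx.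
Qed.

Lemma two_line_processr {R : realType} (r s : R) X x : r != 0 ->
  two_line_process r s X (x, r) <-> X (x - s).
Proof.
move=> r0; split; last by right.
by case=> -[] //= _ e; move: r0; rewrite e eqxx.
Qed.

Lemma two_line_processP {R : realType} (r s : R) X p :
  two_line_process r s X p -> p.2 = 0 \/ p.2 = r.
Proof. by case=> -[_ ->]; [left|right]. Qed.

Lemma exists_shift_params {R : realType} (r s : R) : 0 < r -> 0 < s ->
  s < r / Num.sqrt 3 -> exists rho, shift_params r s rho.
Proof.
move=> r0 s0 sr; pose rho := Num.sqrt (r ^+ 2 + s ^+ 2).
have p0 : 0 < r ^+ 2 + s ^+ 2 by rewrite addr_gt0// exprn_gt0.
have q0 : 0 < Num.sqrt 3 :> R by rewrite sqrtr_gt0.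
have h3 : 3 * s ^+ 2 < r ^+ 2.
  have : s * Num.sqrt 3 < r by rewrite -ltr_pdivlMr.
  rewrite -ltr_sqr ?nnegrE ?mulr_ge0 ?ltW// exprMn sqr_sqrtr//; lra.
exists rho; split => //.
- by rewrite sqrtr_gt0.
- by rewrite sqr_sqrtr// ltW.
- rewrite -ltr_sqr ?nnegrE ?sqrtr_ge0 ?mulr_ge0 ?ltW// sqr_sqrtr ?(ltW p0)// exprMn.
  by rewrite -natrX; lra.
Qed.

Theorem theorem4 (R : realType) (d : measure_display) (Omega : measurableType d)
    (P : probability Omega R) (r s : R) (Pi0 : Omega -> set R) :
  0 < r ->
  0 < `|s| ->
  `|s| < r / Num.sqrt 3 ->
  poisson_process P 1 Pi0 ->
  {ae P, forall w : Omega,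
    let Pi := two_line_process r s (Pi0 w) in
    (exists S : nat -> R * R, is_greedy_walk euclid_dist Pi (0, 0) S) /\
    (forall S : nat -> R * R, is_greedy_walk euclid_dist Pi (0, 0) S ->
      forall x : R * R, Pi x -> exists n : nat, S n = x)}.
Proof.
move=> r0 s0 sr hPi; have [rho hp] := exists_shift_params r0 s0 sr.
have rN0 : r != 0 by rewrite gt_eqF.
suff [Y1 [Y2 [sw1 [sw2 [v1 v2 hY1 hY2]]]]] : exists (Y1 Y2 : Omega -> conf R) sw1 sw2,
    [/\ void_process P Y1, void_process P Y2,
        forall w v, two_line_process r s (Pi0 w) (chart r `|s| false sw1 v) <-> Y1 w v.1 &
        forall w v, two_line_process r s (Pi0 w) (chart r `|s| true sw2 v) <-> Y2 w v.1].
  apply: filterS3 (ae_no_escape v1 hp) (ae_no_escape v2 hp) (ae_unbounded v1) => w ne1 ne2 unb.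
  split; first exact: (two_charts_walk hp (@two_line_processP _ _ _ _) (hY1 w) (vp_finite v1 w) unb).
  move=> S gS x; exact: (two_charts_visit hp (@two_line_processP _ _ _ _) (hY1 w) (hY2 w)
    (vp_finite v1 w) ne1 ne2 gS).
(* The base line must be the one whose copy is shifted to the right. For [s < 0] the lines are
   exchanged in the unreflected chart, for [s > 0] in the reflected one. *)
have [sgt|slt|s00] := ltgtP s 0; last by move: s0; rewrite s00 normr0 ltxx.
  exists (fun w => (fun y => y + - s) @^-1` Pi0 w), (fun w => (fun y => - y + 0) @^-1` Pi0 w), true, false.
  split; [exact: poisson_translate|exact: poisson_reflect| |];
    move=> w [y b]; rewrite /chart /position ltr0_norm//; case: b => /=;
    rewrite ?expr0 ?expr1 ?mul1r ?mulN1r;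
    (rewrite two_line_process0// || rewrite two_line_processr//);
    by [rewrite ?addr0|rewrite opprD opprK addrK addr0].
exists (fun w => (fun y => y + 0) @^-1` Pi0 w), (fun w => (fun y => - y + - s) @^-1` Pi0 w), false, true.
split; [exact: poisson_translate|exact: poisson_reflect| |];
  move=> w [y b]; rewrite /chart /position gtr0_norm//; case: b => /=;
  rewrite ?expr0 ?expr1 ?mul1r ?mulN1r;
  (rewrite two_line_process0// || rewrite two_line_processr//);
  by [rewrite ?addr0|rewrite addrK addr0|rewrite opprD].
Qed.
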